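(* Let $N\ge2$ and $k\in\{1,\dots,N-1\}$. Let $\omega\subseteq\mathbb{R}^{N-k}$ be a nonempty open bounded set. Then, for every $1<p<\infty$ and every $q>p$ such that $q<p^*=\frac{Np}{N-p}$ if $p<N$, $q<\infty$ if $p=N$, $q\le\infty$ if $p>N$, there exists an extremal for $\lambda_{p,q}(\mathbb{R}^k\times\omega)$.
   Context: For an open set $\Omega\subseteq\mathbb{R}^N$, $W^{1,p}_0(\Omega)$ is the closure of $C^\infty_0(\Omega)$ in $W^{1,p}(\Omega)$, and $$\lambda_{p,q}(\Omega)=\inf_{\varphi\in C^\infty_0(\Omega)}\Big\{\int_\Omega|\nabla\varphi|^p\,dx:\ \|\varphi\|_{L^q(\Omega)}=1\Big\}.$$ An extremal for $\lambda_{p,q}(\Omega)$ is a function $u\in W^{1,p}_0(\Omega)\setminus\{0\}$ with $\int_\Omega|\nabla u|^p\,dx=\lambda_{p,q}(\Omega)\,\|u\|_{L^q(\Omega)}^p$ (also for $q=\infty$). *)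

(* Defs.v *)
From HB Require Import structures.
From mathcomp Require Import all_boot all_order all_algebra.
From mathcomp Require Import all_classical all_reals all_analysis.

Set Implicit Arguments.
Unset Strict Implicit.
Unset Printing Implicit Defensive.

Import Order.TTheory GRing.Theory Num.Theory.
Import numFieldNormedType.Exports.

Local Open Scope classical_set_scope.
Local Open Scope ring_scope.

(* R^n is 'rV[R]_n, whose library topology and norm are used for openness,
   compactness and boundedness.  Its sigma-algebra is generated by the
   coordinate projections, exactly as the library does for n.-tuple R; it is
   the Borel sigma-algebra of that topology. *)
Definition rV_display : measure_display -> measure_display.
Proof. exact. Qed.

Section measurable_rV.
Context {d} {T : sigmaRingType d}.
Variable n : nat.

Let coord : 'I_n -> 'rV[T]_n -> T := fun i x => x ord0 i.

Let rV_set0 : g_sigma_preimage coord set0.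
Proof. exact: sigma_algebra0. Qed.

Let rV_setC A : g_sigma_preimage coord A -> g_sigma_preimage coord (~` A).
Proof. exact: sigma_algebraC. Qed.

Let rV_bigcup (F : _^nat) : (forall i, g_sigma_preimage coord (F i)) ->
  g_sigma_preimage coord (\bigcup_i (F i)).
Proof. exact: sigma_algebra_bigcup. Qed.

HB.instance Definition _ := @isMeasurable.Build (rV_display d)
  'rV[T]_n (g_sigma_preimage coord) rV_set0 rV_setC rV_bigcup.

End measurable_rV.

Section measurable_rV_theory.
Context d1 d2 (T1 : measurableType d1) (T2 : measurableType d2).

Lemma measurable_rV_coord n (i : 'I_n) :
  measurable_fun [set: 'rV[T2]_n] (fun x : 'rV[T2]_n => x ord0 i).
Proof.
move=> _ Y mY; rewrite setTI; apply: sub_sigma_algebra => /=.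
rewrite -bigcup_seq/=; exists i => /=; first by rewrite mem_index_enum.
by exists Y => //; rewrite setTI.
Qed.

Lemma measurable_fun_rV n (f : T1 -> 'rV[T2]_n) :
  (forall i, measurable_fun [set: T1] (fun x => f x ord0 i)) ->
  measurable_fun [set: T1] f.
Proof.
move=> mf _ Y mY; rewrite setTI.
suff : g_sigma_preimage (fun i (x : 'rV[T2]_n) => x ord0 i) `<=`
  [set A | measurable (f @^-1` A)] by exact.
apply: smallest_sub.
  split=> /=.
  - by rewrite preimage_set0.
  - by move=> A mA; rewrite setTD preimage_setC; exact: measurableC.
  - by move=> F mF; rewrite preimage_bigcup; exact: bigcup_measurable.
rewrite -bigcup_seq/=; apply: bigcup_sub => i _ _ [B mB <-] /=.
by have := mf i measurableT B mB; rewrite !setTI.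
Qed.

End measurable_rV_theory.

Section lebesgue_measure_rV.
Variable R : realType.

Definition rV_cons n (tv : R * 'rV[R]_n) : 'rV[R]_n.+1 :=
  @row_mx R 1 1 n (const_mx tv.1) tv.2.

Definition rV_uncons n (v : 'rV[R]_n.+1) : R * 'rV[R]_n :=
  (v ord0 ord0, @rsubmx R 1 1 n v).

Lemma rV_consK n : cancel (@rV_cons n) (@rV_uncons n).
Proof.
move=> [t v]; rewrite /rV_uncons /rV_cons /= row_mxKr; congr pair.
have -> : (ord0 : 'I_n.+1) = lshift n (ord0 : 'I_1) by apply/val_inj.
by rewrite (@row_mxEl R 1 1 n) mxE.
Qed.

Lemma measurable_rV_cons n :
  measurable_fun [set: measurableTypeR R * 'rV[R]_n] (@rV_cons n).
Proof.
apply: measurable_fun_rV => i.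
case: (@splitP 1 n i) => j ij.
  have -> : i = lshift n j by apply/val_inj.
  rewrite (_ : (fun _ => _) = fst); first exact: measurable_fst.
  by apply/funext => tv; rewrite (@row_mxEl R 1 1 n) mxE.
have -> : i = rshift 1 j by apply/val_inj.
rewrite (_ : (fun _ => _) = (fun x : 'rV[R]_n => x ord0 j) \o snd).
  by apply: measurableT_comp => //; exact: measurable_rV_coord.
by apply/funext => tv; rewrite (@row_mxEr R 1 1 n).
Qed.

Lemma measurable_rV_uncons n :
  measurable_fun [set: 'rV[R]_n.+1]
    (@rV_uncons n : _ -> measurableTypeR R * 'rV[R]_n).
Proof.
apply: measurable_fun_pair; first exact: measurable_rV_coord.
apply: measurable_fun_rV => i.
rewrite (_ : (fun _ => _) = (fun x : 'rV[R]_n.+1 => x ord0 (rshift 1 i))).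
  exact: measurable_rV_coord.
by apply/funext => v; rewrite !mxE.
Qed.

(* n-fold product of the Lebesgue measure of the line *)
Fixpoint lebesgue_rV n : set 'rV[R]_n -> \bar R :=
  match n with
  | 0 => \d_ (0 : 'rV[R]_0)
  | n.+1 => pushforward (@lebesgue_measure R \x @lebesgue_rV n)%E (@rV_cons n)
  end.

Let pack_measure d (T : measurableType d) (m : set T -> \bar R) :
  m set0 = 0%E -> (forall A, (0 <= m A)%E) -> semi_sigma_additive m ->
  sigma_finite setT m ->
  exists mu : {sigma_finite_measure set T -> \bar R}, m = mu.
Proof.
move=> m0 m_ge0 m_sa m_sf.
pose mM := isMeasure.Build _ _ _ m m0 m_ge0 m_sa.
pose m' : {measure set T -> \bar R} := HB.pack m mM.
pose mS := @Measure_isSigmaFinite.Build _ _ _ m' m_sf.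
pose mu : {sigma_finite_measure set T -> \bar R} := HB.pack m mM mS.
by exists mu.
Qed.

Let lebesgue_rV_spec n :
  exists mu : {sigma_finite_measure set 'rV[R]_n -> \bar R},
    @lebesgue_rV n = mu.
Proof.
elim: n => [|n [mu muE]]; first by exists (\d_ (0 : 'rV[R]_0)).
pose leb : {sigma_finite_measure set (measurableTypeR R) -> \bar R} :=
  @lebesgue_measure R.
pose prod : {measure set (measurableTypeR R * 'rV[R]_n)%type -> \bar R} :=
  (leb \x mu)%E.
pose m := pushforward prod (@rV_cons n).
have m0 : m set0 = 0%E by rewrite /m /pushforward preimage_set0 measure0.
have m_ge0 A : (0 <= m A)%E by exact: (measure_ge0 prod).
have m_sigma_additive : semi_sigma_additive m.
  move=> F mF tF mUF; rewrite /m /pushforward preimage_bigcup.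
  apply: (@measure_semi_sigma_additive _ _ _ prod).
  - by move=> i; rewrite -[X in measurable X]setTI; exact: measurable_rV_cons.
  - apply/trivIsetP => /= i j _ _ ij; rewrite -preimage_setI.
    by move/trivIsetP : tF => /(_ _ _ _ _ ij) ->//; rewrite preimage_set0.
  - rewrite -preimage_bigcup -[X in measurable X]setTI.
    exact: measurable_rV_cons.
have m_sigma_finite : sigma_finite setT m.
  have /sigma_finiteP[F [TF ndF Foo]] := sigma_finiteT leb.
  have /sigma_finiteP[G [TG ndG Goo]] := sigma_finiteT mu.
  exists (fun i => @rV_uncons n @^-1` (F i `*` G i)).
    rewrite -preimage_bigcup (_ : \bigcup_i _ = setT) ?preimage_setT//.
    rewrite -setXTT TF TG predeqE => -[x y]; split.
      by move=> [i _ []/= ? ?]; split; exists i.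
    move=> [/= [i _ Fix] [j _ Gjy]]; exists (maxn i j) => //; split.
    - by move: x Fix; exact/subsetPset/ndF/leq_maxl.
    - by move: y Gjy; exact/subsetPset/ndG/leq_maxr.
  move=> i; have [mF Fi] := Foo i; have [mG Gi] := Goo i; split.
    rewrite -[X in measurable X]setTI; apply: measurable_rV_uncons => //.
    exact: measurableX.
  rewrite /m /pushforward -comp_preimage (_ : _ \o _ = id); last first.
    by apply/funext => tv; exact: rV_consK.
  rewrite preimage_id /= product_measure1E//.
  by rewrite lte_mul_pinfty// ge0_fin_numE.
have [mu' mE] := pack_measure m0 m_ge0 m_sigma_additive m_sigma_finite.
by exists mu'; rewrite -mE /= muE.
Qed.

Let lebesgue_rV0 n : @lebesgue_rV n set0 = 0%E.
Proof. by have [mu ->] := lebesgue_rV_spec n; exact: measure0. Qed.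

Let lebesgue_rV_ge0 n A : (0 <= @lebesgue_rV n A)%E.
Proof. by have [mu ->] := lebesgue_rV_spec n; exact: measure_ge0. Qed.

Let lebesgue_rV_sigma_additive n : semi_sigma_additive (@lebesgue_rV n).
Proof.
by have [mu ->] := lebesgue_rV_spec n; exact: measure_semi_sigma_additive.
Qed.

HB.instance Definition _ n := isMeasure.Build _ _ _ (@lebesgue_rV n)
  (lebesgue_rV0 n) (@lebesgue_rV_ge0 n) (@lebesgue_rV_sigma_additive n).

Let lebesgue_rV_sigma_finite n : sigma_finite setT (@lebesgue_rV n).
Proof. by have [mu ->] := lebesgue_rV_spec n; exact: sigma_finiteT. Qed.

HB.instance Definition _ n := Measure_isSigmaFinite.Build _ _ _
  (@lebesgue_rV n) (@lebesgue_rV_sigma_finite n).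

End lebesgue_measure_rV.
Arguments lebesgue_rV {R n}.

Section sobolev.
Variables (R : realType) (N : nat).
Implicit Types (Omega : set 'rV[R]_N) (phi u : 'rV[R]_N -> R)
  (G : 'rV[R]_N -> 'rV[R]_N).

Local Notation mu := (@lebesgue_rV R N).

Definition partial (i : 'I_N) phi : 'rV[R]_N -> R :=
  'D_(delta_mx ord0 i) phi.

Definition gradient phi (x : 'rV[R]_N) : 'rV[R]_N := \row_i partial i phi x.

(* The library norm of a row vector is the sup norm; this is the Euclidean
   one, used for |grad u|. *)
Definition euclid (v : 'rV[R]_N) : R :=
  Num.sqrt (\sum_(i < N) v ord0 i ^+ 2).

(* C^infinity: all iterated partial derivatives exist and are continuous. *)
Definition smooth phi := forall s : seq 'I_N,
  continuous (foldr partial phi s) /\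
  forall (x : 'rV[R]_N) (i : 'I_N),
    derivable (foldr partial phi s) x (delta_mx ord0 i).

(* C^infinity_0(Omega), its elements being extended by zero to R^N *)
Definition test_function Omega phi :=
  let supp := closure [set x | phi x != 0] in
  [/\ smooth phi, compact supp & supp `<=` Omega].

(* A function on Omega is represented by a total function of which only the
   values on Omega are used.  Extending by zero turns the norm of L^q(Omega)
   into that of L^q(R^N), also for q = +oo. *)
Definition Lnorm_on Omega (q : \bar R) u : \bar R :=
  Lnorm mu q (EFin \o (u \_ Omega)).

Definition L_on Omega (q : \bar R) u := u \_ Omega \in Lfun mu q.

(* \int_Omega |G|^p dx *)
Definition energy Omega (p : R) G : \bar R :=
  (\int[mu]_(x in Omega) (euclid (G x) `^ p)%:E)%E.

Definition weak_gradient Omega u G := forall (phi : 'rV[R]_N -> R) (i : 'I_N),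
  test_function Omega phi ->
  (\int[mu]_(x in Omega) (u x * partial i phi x)%:E =
   - \int[mu]_(x in Omega) (G x ord0 i * phi x)%:E)%E.

(* u is in W^{1,p}(Omega), with weak gradient G *)
Definition W1p Omega (p : R) u G :=
  [/\ L_on Omega p%:E u,
      forall i : 'I_N, L_on Omega p%:E (fun x => G x ord0 i) &
      weak_gradient Omega u G].

Definition W1p_norm Omega (p : R) u G : \bar R :=
  (Lnorm_on Omega p%:E u + Lnorm_on Omega p%:E (euclid \o G))%E.

(* u is in W^{1,p}_0(Omega), with weak gradient G: it is in the closure of
   the test functions for the norm of W^{1,p}(Omega) *)
Definition W1p0 Omega (p : R) u G :=
  W1p Omega p u G /\
  forall eps : R, 0 < eps -> exists2 phi, test_function Omega phi &
    (W1p_norm Omega p (u \- phi)%R (G \- gradient phi)%R < eps%:E)%E.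

Definition lambda Omega (p : R) (q : \bar R) : \bar R :=
  ereal_inf [set energy Omega p (gradient phi) | phi in
    [set phi | test_function Omega phi /\ Lnorm_on Omega q phi = 1%E]].

(* The equation is one between real numbers: the finiteness of the L^q norm
   rules out the convention 0 * +oo = 0. *)
Definition extremal Omega (p : R) (q : \bar R) u :=
  exists2 G, W1p0 Omega p u G &
  [/\ ~ {ae mu, forall x, Omega x -> u x = 0},
      (Lnorm_on Omega q u < +oo)%E &
      energy Omega p G = (lambda Omega p q * Lnorm_on Omega q u `^ p)%E].

End sobolev.

Lemma drop_ord_subproof (N k : nat) (j : 'I_(N - k)) : (k + j < N)%N.
Proof. by rewrite -ltn_subRL. Qed.

(* (x_1, ..., x_N) |-> (x_{k+1}, ..., x_N) *)
Definition rV_drop (R : realType) (N k : nat) (x : 'rV[R]_N) :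
    'rV[R]_(N - k) :=
  \row_j x ord0 (Ordinal (drop_ord_subproof j)).

(* R^k x omega, as a subset of R^N = R^k x R^(N - k) *)
Definition cylinder (R : realType) (N k : nat) (omega : set 'rV[R]_(N - k)) :
    set 'rV[R]_N :=
  [set x | omega (rV_drop k x)].

(* Main.v *)
Require Import Defs.
From mathcomp Require Import all_boot all_order all_algebra.
From mathcomp Require Import all_classical all_reals all_analysis.
From mathcomp Require Import ess_sup_inf measurable_realfun.
From mathcomp Require Import ring lra.

(** The extremal is a limit, strong in W^{1,p} and in L^q, of a minimizing
    sequence of test functions; three things have to be excluded or repaired:
    vanishing, escape to infinity along R^k, and oscillation.  Write s for 1/q
    (0 if q is infinite); the hypotheses on q say that p < q and that
    N (1/p - s) < 1.

    Compactness is measured with the averages of a function f over the dyadic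
    cubes of side 2^-m.  If the gradient of f is bounded by K in L^p, these
    averages are within a constant times 2^-m K of f in L^p.  The difference of
    two consecutive averages is constant on small cubes, and for such functions
    the passage from L^p to L^q costs a factor 2^{mN(1/p - s)}; the telescoping
    series is geometric, and f is within a constant times rho^m K of its averages
    in L^q, with rho < 1 ([avg_sobolev]).  As the cylinder is bounded in the
    directions of omega, the Poincare inequality holds, so the norms in L^p and
    L^q are controlled by the gradient alone ([sobolev]) and the infimum lambda
    is positive ([lambda_fin]).

    No vanishing: if the norm of f in L^q is 1, some average at a fixed scale is
    bounded below, since a function with small sup norm and bounded norm in L^p
    is small in L^q.  A translation along R^k brings the corresponding cube next
    to the origin ([centered_minimizing_sequence]).

    No escape: cut f at a position along a direction of R^k where the strip
    used for the cut carries little of |grad f|^p + |f|^p; one exists by the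
    pigeonhole principle.  If a and b are the norms in L^q of the two pieces,
    lambda (a^p + b^p) is at most about lambda, while
    1 <= max(a,b)^{1-ps} (a^p + b^p)^s.  As ps < 1 and a is bounded below by the
    previous step, b is small ([concentration_dichotomy], [tightness]).

    Convergence: the averages of the sequence are bounded, so along an
    ultrafilter they converge at every cube, and uniformly on the finitely many
    cubes that meet a box; with [tightness] and [avg_sobolev] the sequence is
    Cauchy in L^q along the ultrafilter ([ultra_Lnorm_cauchy]).  Midpoints of two
    late terms then have a norm in L^q close to 1, hence an energy almost at
    least lambda, and the uniform convexity of the p-th power of the Euclidean
    norm makes the gradients Cauchy in L^p ([near_minimizers]).  Along a fast
    subsequence the functions and their partial derivatives converge almost
    everywhere, and by the Fatou lemma also in norm; the limit is an extremal
    ([limit_extremal]). *)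

Set Implicit Arguments.
Unset Strict Implicit.
Unset Printing Implicit Defensive.

Import Order.TTheory GRing.Theory Num.Theory.
Import numFieldNormedType.Exports.

Local Open Scope classical_set_scope.
Local Open Scope ring_scope.

(** * Norms in L^q of real functions, including q = +oo *)

(** The exponent 1/q, with 1/q = 0 at q = +oo: it lets finite and infinite q be
    treated by the same formulas. *)
Definition einv (R : realType) (q : \bar R) : R :=
  if q is r%:E then r^-1 else 0.

(** Continuity of the power at every l >= 0.  The power is differentiable at l > 0 only,
    so l = 0 is a separate case. *)
Lemma cvg_powR (R : realType) (I : Type) (F : set_system I) (FF : ProperFilter F)
    (u : I -> R) (l r : R) :
  0 < r -> (forall i, 0 <= u i) ->
  u i @[i --> F] --> l -> u i `^ r @[i --> F] --> l `^ r.
Proof.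
move=> r0 u0 ul.
have l0 : 0 <= l.
  have -> : l = lim (u i @[i --> F]) by apply/esym/cvg_lim.
  apply: limr_ge; first by apply/cvg_ex; exists l.
  exact: nearW.
move: l0; rewrite le_eqVlt => /predU1P[l0|l0].
  rewrite -l0 powR0 ?gt_eqF//; move: ul; rewrite -l0 => ul.
  apply/cvgr0Pnorm_lt => e e0.
  have er0 : 0 < e `^ r^-1 by rewrite powR_gt0.
  move/cvgr0Pnorm_lt : ul => /(_ _ er0); apply: filterS => i.
  rewrite !ger0_norm ?powR_ge0// => ui.
  have -> : e = (e `^ r^-1) `^ r by rewrite -powRrM mulVf ?gt_eqF// powRr1// ltW.
  by rewrite gt0_ltr_powR ?nnegrE ?powR_ge0.
have dl : derivable ((@powR R) ^~ r) l 1.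
  by apply: derivable_powR; rewrite in_itv/= l0.
have cl : {for l, continuous ((@powR R) ^~ r)}.
  by apply/differentiable_continuous/derivable1_diffP.
exact: (continuous_cvg _ cl ul).
Qed.

Section Lnorm_facts.
Context d (T : measurableType d) (R : realType) (mu : {measure set T -> \bar R}).
Implicit Types (f g h : T -> R) (p r K M a b : R) (q : \bar R).
Local Notation "'N_ q [ f ]" := (Lnorm mu q (EFin \o f)).

Lemma measurable_powR_norm f r :
  measurable_fun setT f -> measurable_fun setT (fun x => (`|f x| `^ r)%:E : \bar R).
Proof.
move=> mf; apply/measurable_EFinP.
apply: (@measurableT_comp _ _ _ _ _ _ (@powR R ^~ r)) => //.
exact: measurableT_comp.
Qed.

Lemma Lnorm_EFinE r f :
  'N_r%:E[f] = ((\int[mu]_x (`|f x| `^ r)%:E) `^ r^-1)%E.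
Proof. by rewrite unlock. Qed.

Lemma Lnorm_leP r f K : 0 < r -> 0 <= K ->
  ('N_r%:E[f] <= K%:E)%E = (\int[mu]_x (`|f x| `^ r)%:E <= (K `^ r)%:E)%E.
Proof.
move=> r0 K0; rewrite Lnorm_EFinE.
have I0 : (0 <= \int[mu]_x (`|f x| `^ r)%:E)%E.
  by apply: integral_ge0 => x _; rewrite lee_fin powR_ge0.
apply/idP/idP => [le1|le1].
  have := gt0_ler_poweR (ltW r0) _ _ le1.
  rewrite -poweRrM mulVf ?gt_eqF// poweRe1//; apply.
    by rewrite in_itv/= poweR_ge0 leey.
  by rewrite in_itv/= lee_fin K0 leey.
have ri0 : 0 <= r^-1 by rewrite invr_ge0 ltW.
have := gt0_ler_poweR ri0 _ _ le1.
rewrite poweR_EFin -powRrM mulfV ?gt_eqF// powRr1//; apply.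
  by rewrite in_itv/= I0 leey.
by rewrite in_itv/= lee_fin powR_ge0 leey.
Qed.

Lemma Lnorm_yleP f K : 0 <= K ->
  (\forall x \ae mu, `|f x| <= K) -> ('N_+oo[f] <= K%:E)%E.
Proof.
move=> K0 fK; rewrite unlock; case: ifPn => _; last by rewrite lee_fin.
by apply/ess_supP; apply: filterS fK => x /=; rewrite lee_fin.
Qed.

Lemma Lnorm_yle f K : ('N_+oo[f] <= K%:E)%E -> \forall x \ae mu, `|f x| <= K.
Proof.
rewrite unlock; case: ifPn => [_ /ess_supP|].
  by apply: filterS => x /=; rewrite lee_fin.
rewrite -leNgt => mu0 _.
have muT : mu setT = 0%E by apply/eqP; rewrite eq_le mu0 measure_ge0.
by exists setT.
Qed.

Lemma le_Lnorm q f g : (0 < q)%E ->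
  measurable_fun setT f -> measurable_fun setT g ->
  (forall x, `|f x| <= `|g x|) -> ('N_q[f] <= 'N_q[g])%E.
Proof.
case: q => [r||//]; rewrite ?lte_fin => r0 mf mg fg.
  rewrite !Lnorm_EFinE; apply: gt0_ler_poweR.
  - by rewrite invr_ge0 ltW.
  - by rewrite in_itv/= leey andbT integral_ge0// => x _; rewrite lee_fin powR_ge0.
  - by rewrite in_itv/= leey andbT integral_ge0// => x _; rewrite lee_fin powR_ge0.
  apply: ge0_le_integral => //=.
  - exact: measurable_powR_norm.
  - exact: measurable_powR_norm.
  - by move=> x _; rewrite lee_fin ge0_ler_powR// ?nnegrE// ltW.
rewrite unlock; case: ifPn => // _.
by apply: le_ess_sup; apply: nearW => x /=; rewrite lee_fin.
Qed.

Lemma LnormN q f : 'N_q[(fun x => - f x)%R] = 'N_q[f].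
Proof. by rewrite -[RHS]oppe_Lnorm; apply: eq_Lnorm. Qed.

Lemma LnormB_le q f g a b : (1 <= q)%E ->
  measurable_fun setT f -> measurable_fun setT g ->
  ('N_q[f] <= a%:E)%E -> ('N_q[g] <= b%:E)%E ->
  ('N_q[(fun x => f x - g x)%R] <= (a + b)%:E)%E.
Proof.
move=> q1 mf mg fa gb.
have mg' : measurable_fun setT (fun x => - g x) by exact: measurableT_comp.
apply: (le_trans (eminkowski mu mf mg' q1)).
by rewrite LnormN EFinD leeD.
Qed.

Lemma LnormD_le q f g a b : (1 <= q)%E ->
  measurable_fun setT f -> measurable_fun setT g ->
  ('N_q[f] <= a%:E)%E -> ('N_q[g] <= b%:E)%E ->
  ('N_q[(fun x => f x + g x)%R] <= (a + b)%:E)%E.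
Proof.
move=> q1 mf mg fa gb.
apply: (le_trans (eminkowski mu mf mg q1)).
by rewrite EFinD leeD.
Qed.

Lemma LnormZl q f a : (1 <= q)%E -> measurable_fun setT f ->
  'N_q[(fun x => a * f x)%R] = (`|a|%:E * 'N_q[f])%E.
Proof.
case: q => [r||//] r1 mf; last first.
  rewrite unlock; case: ifPn => mu0; last by rewrite mule0.
  rewrite -ess_supZl//; apply/eq_ess_sup/nearW => t /=.
  by rewrite normrM EFinM.
have r0 : 0 < r by rewrite (lt_le_trans ltr01).
rewrite !Lnorm_EFinE.
under eq_integral do rewrite normrM powRM// EFinM.
rewrite ge0_integralZl//=; last exact: measurable_powR_norm.
rewrite poweRM ?lee_fin ?powR_ge0//.
  by rewrite poweR_EFin -powRrM mulfV ?gt_eqF// powRr1.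
by apply: integral_ge0 => x _; rewrite lee_fin powR_ge0.
Qed.

Lemma LnormZ_le q f a K : (1 <= q)%E -> measurable_fun setT f ->
  ('N_q[f] <= K%:E)%E -> ('N_q[(fun x => a * f x)%R] <= (`|a| * K)%:E)%E.
Proof. by move=> q1 mf fK; rewrite LnormZl// EFinM lee_wpmul2l// lee_fin. Qed.

(** Since |f| <= M, |f|^q <= M^{q-p} |f|^p.  A function of bounded norm in L^p that
    is uniformly small is therefore small in L^q. *)
Lemma Lnorm_interp p q f M K : 0 < p -> (p%:E < q)%E -> 0 <= M -> 0 <= K ->
  measurable_fun setT f -> (forall x, `|f x| <= M) ->
  ('N_p%:E[f] <= K%:E)%E ->
  ('N_q[f] <= (M `^ (1 - p * einv q) * K `^ (p * einv q))%:E)%E.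
Proof.
case: q => [r||//] p0 pq M0 K0 mf fM fK; last first.
  rewrite /= !(mulr0, subr0, powRr0, mulr1) powRr1//.
  by apply: Lnorm_yleP => //; exact: nearW.
rewrite lte_fin in pq; have r0 : 0 < r by exact: lt_trans pq.
rewrite Lnorm_leP//; last by rewrite mulr_ge0 ?powR_ge0.
move: fK; rewrite Lnorm_leP// => fK /=.
apply: (@le_trans _ _ ((M `^ (r - p))%:E * \int[mu]_x (`|f x| `^ p)%:E)%E).
  rewrite -ge0_integralZl//=; [|exact: measurable_powR_norm|
    by rewrite lee_fin powR_ge0].
  apply: ge0_le_integral => //=.
  - exact: measurable_powR_norm.
  - apply: measurable_funeM; exact: measurable_powR_norm.
  - move=> x _; rewrite -EFinM lee_fin.
    have -> : `|f x| `^ r = `|f x| `^ (r - p) * `|f x| `^ p.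
      by rewrite -powRD; [congr (_ `^ _); ring|rewrite subrK gt_eqF].
    by rewrite ler_wpM2r ?powR_ge0// ge0_ler_powR ?nnegrE// subr_ge0 ltW.
rewrite powRM ?powR_ge0// -!powRrM mulrBl mul1r mulfVK ?gt_eqF// EFinM.
by rewrite lee_wpmul2l ?lee_fin ?powR_ge0.
Qed.

(** Lower semicontinuity of the norm under almost everywhere convergence; for
    finite q this is the Fatou lemma. *)
Lemma Lnorm_fatou q (f_ : nat -> T -> R) f K : (0 < q)%E -> 0 <= K ->
  (forall n, measurable_fun setT (f_ n)) ->
  (\forall x \ae mu, f_ n x @[n --> \oo] --> f x) ->
  measurable_fun setT f ->
  (\forall n \near \oo, 'N_q[f_ n] <= K%:E)%E -> ('N_q[f] <= K%:E)%E.
Proof.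
move=> q0 K0 mf_ f_f mf fK.
case: q q0 fK => [r||//] r0 fK; last first.
  have [m _ fK'] := fK.
  apply: Lnorm_yleP => //.
  have : \forall x \ae mu, forall n, (m <= n)%N -> `|f_ n x| <= K.
    apply/ae_foralln => n.
    have [mn|mn] := boolP (m <= n)%N; last first.
      by apply: nearW => x /=.
    by apply: filterS (Lnorm_yle (fK' _ mn)) => x.
  move: f_f; apply: filterS2 => x fx fKx.
  have fx' : `|f_ n x| @[n --> \oo] --> `|f x| by exact: cvg_norm.
  rewrite -(cvg_lim _ fx')//.
  apply: limr_le; first by apply/cvg_ex; exists `|f x|.
  by exists m.
rewrite lte_fin in r0.
rewrite Lnorm_leP//.
pose g n x := (`|f_ n x| `^ r)%:E.
have : (\int[mu]_x limn_einf (g ^~ x) <= limn_einf (fun n => \int[mu]_x g n x))%E.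
  apply: fatou => //; first by move=> n; exact: measurable_powR_norm.
  by move=> n x _; rewrite lee_fin powR_ge0.
have -> : (\int[mu]_x limn_einf (g ^~ x) = \int[mu]_x (`|f x| `^ r)%:E)%E.
  apply: ae_eq_integral => //.
  - rewrite /limn_einf; apply: measurableT_comp => //.
    apply: measurable_fun_limn_esup => n; apply: measurableT_comp => //.
    exact: measurable_powR_norm.
  - exact: measurable_powR_norm.
  apply: filterS f_f => x fx _.
  have gx : g ^~ x @ \oo --> (`|f x| `^ r)%:E.
    apply: cvg_EFin; first exact: nearW.
    by apply: cvg_powR => //; exact: cvg_norm.
  by rewrite is_cvg_limn_einfE; [exact: cvg_lim|apply/cvg_ex; exists (`|f x| `^ r)%:E].
move=> /le_trans; apply.
rewrite limn_einf_lim.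
apply: lime_le; first exact: is_cvg_einfs.
have [m _ fK'] := fK.
exists m => //= n /= mn.
apply: (@le_trans _ _ (\int[mu]_x g n x)%E).
  by apply: ereal_inf_lbound; exists n => /=.
by have := fK' n mn; rewrite Lnorm_leP.
Qed.

End Lnorm_facts.

Section Lnorm_on_sets.
Context d (T : measurableType d) (R : realType) (mu : {measure set T -> \bar R}).
Implicit Types (f g h : T -> R) (p r K M a b : R) (q : \bar R).
Local Notation "'N_ q [ f ]" := (Lnorm mu q (EFin \o f)).

Lemma measurable_patch f (Q : set T) : measurable Q -> measurable_fun setT f ->
  measurable_fun setT (f \_ Q).
Proof.
by move=> mQ mf; apply/(measurable_restrictT _ _).1 => //; exact: measurable_funTS.
Qed.

(** The Hoelder inequality against the indicator function of Q. *)
Lemma int_le_Lnorm q f (Q : set T) m K : (1 <= q)%E -> measurable Q ->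
  0 < m -> mu Q = m%:E -> 0 <= K -> measurable_fun setT f ->
  ('N_q[f \_ Q] <= K%:E)%E ->
  (\int[mu]_(x in Q) `|f x|%:E <= (K * m `^ (1 - einv q))%:E)%E.
Proof.
move=> q1 mQ m0 muQ K0 mf fK.
have mfQ := measurable_patch mQ mf.
have -> : (\int[mu]_(x in Q) `|f x|%:E = \int[mu]_x `|(f \_ Q) x|%:E)%E.
  rewrite integral_mkcond; apply: eq_integral => x _.
  by rewrite !patchE; case: ifP => //; rewrite normr0.
case: q q1 fK => [r||//] r1 fK /=; last first.
  rewrite subr0 powRr1 ?(ltW m0)//.
  rewrite EFinM -muQ -[X in (K%:E * mu X)%E]setTI.
  rewrite -integral_cst//; last exact: measurableI.
  rewrite [leRHS]integral_mkcond.
  have := Lnorm_yle fK.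
  move=> fK'; apply: ae_ge0_le_integral => //.
  - by apply/measurable_EFinP; exact: measurableT_comp.
  - move=> x _; rewrite patchE; case: ifP => //; by rewrite lee_fin.
  - apply/(measurable_restrictT _ _).1 => //; first exact: measurableI.
  apply: filterS fK' => x /= fKx _; move: fKx.
  rewrite !patchE setTI; case: ifP => //; by rewrite normr0.
move: r1; rewrite lee_fin le_eqVlt => /predU1P[r1|r1].
  move: fK; rewrite -r1 invr1 subrr powRr0 mulr1 Lnorm1.
  by apply: le_trans; rewrite le_eqVlt; apply/orP; left; apply/eqP.
have r0 : 0 < r by exact: lt_trans r1.
pose r' := (1 - r^-1)^-1.
have r'0 : 0 < r' by rewrite invr_gt0 subr_gt0 invf_lt1.
have rr' : r^-1 + r'^-1 = 1 by rewrite /r' invrK subrKC.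
pose e : T -> R := (@cst T R 1) \_ Q.
have me : measurable_fun setT e by exact: measurable_patch.
have := hoelder mu mfQ me r0 r'0 rr'.
rewrite Lnorm1.
have -> : (\int[mu]_x `|(EFin \o ((f \_ Q) \* e)%R) x| = \int[mu]_x `|(f \_ Q) x|%:E)%E.
  apply: eq_integral => x _; rewrite /= /e !patchE; case: ifP => _; first by rewrite mulr1.
  by rewrite mulr0.
move=> /le_trans; apply; rewrite EFinM.
have -> : 'N_r'%:E[e] = (m `^ (1 - r^-1))%:E.
  rewrite Lnorm_EFinE /r' invrK -poweR_EFin -muQ; congr (_ `^ _)%E.
  rewrite -[RHS]mul1e -[X in (_ * mu X)%E]setTI -integral_cst//; last exact: measurableI.
  rewrite setTI [in RHS]integral_mkcond; apply: eq_integral => x _.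
  by rewrite /e !patchE; case: ifP => _ /=; rewrite ?normr1 ?powR1// normr0 powR0 ?gt_eqF.
by rewrite lee_wpmul2r// lee_fin powR_ge0.
Qed.

Lemma jensen_powR f (Q : set T) m p : 1 <= p -> measurable Q ->
  0 < m -> mu Q = m%:E -> measurable_fun setT f ->
  ((\int[mu]_(x in Q) `|f x|%:E) `^ p <=
   (m `^ (p - 1))%:E * \int[mu]_(x in Q) (`|f x| `^ p)%:E)%E.
Proof.
move=> p1 mQ m0 muQ mf.
have p0 : 0 < p by exact: lt_le_trans p1.
set I := (\int[mu]_(x in Q) (`|f x| `^ p)%:E)%E.
have I0 : (0 <= I)%E by apply: integral_ge0 => x _; rewrite lee_fin powR_ge0.
have [Ioo|] := eqVneq I +oo%E.
  by rewrite Ioo gt0_muley ?leey// lte_fin powR_gt0.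
rewrite -ltey -ge0_fin_numE// => Ifin.
rewrite -(fineK Ifin) -EFinM.
have fI0 : 0 <= fine I by exact: fine_ge0.
have := @int_le_Lnorm p%:E f Q m ((fine I) `^ p^-1) _ mQ m0 muQ _ mf.
rewrite lee_fin p1 powR_ge0 => /(_ isT isT); rewrite Lnorm_leP ?powR_ge0//.
rewrite -powRrM mulVf ?gt_eqF// powRr1// fineK//.
have -> : (\int[mu]_x (`|(f \_ Q) x| `^ p)%:E = I)%E.
  rewrite /I [in RHS]integral_mkcond; apply: eq_integral => x _.
  by rewrite !patchE; case: ifP => // _; rewrite normr0 powR0 ?gt_eqF.
move=> /(_ (lexx _)) le1.
have J0 : (0 <= \int[mu]_(x in Q) `|f x|%:E)%E by apply: integral_ge0 => x _.
have := gt0_ler_poweR (ltW p0) _ _ le1.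
rewrite poweR_EFin powRM ?powR_ge0// -!powRrM mulVf ?gt_eqF// powRr1//.
rewrite mulrBl mul1r /= mulVf ?gt_eqF// (mulrC (fine I)); apply.
  by rewrite in_itv/= J0 leey.
by rewrite in_itv/= leey andbT lee_fin mulr_ge0 ?powR_ge0.
Qed.

Section measure_preserving.
Variable phi : T -> T.
Hypothesis mphi : measurable_fun setT phi.
Hypothesis phi_mu : forall A, measurable A -> mu (phi @^-1` A) = mu A.

Lemma ge0_integral_comp (g : T -> \bar R) : measurable_fun setT g ->
  (forall x, 0 <= g x)%E -> (\int[mu]_x g (phi x) = \int[mu]_x g x)%E.
Proof.
move=> mg g0; have := @ge0_integral_pushforward _ _ _ _ _ _ mphi mu setT g measurableT mg.
rewrite preimage_setT => /(_ (fun x _ => g0 x)) <-.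
by apply: eq_measure_integral => A mA _; exact: phi_mu.
Qed.

Lemma ae_comp (P : T -> Prop) :
  (\forall x \ae mu, P x) -> \forall x \ae mu, P (phi x).
Proof.
move=> [A [mA A0 PA]]; exists (phi @^-1` A); split.
- by rewrite -[X in measurable X]setTI; exact: mphi.
- by rewrite phi_mu.
- by move=> x /= nP; apply: PA.
Qed.

Lemma Lnorm_comp_le q f : (0 < q)%E -> measurable_fun setT f ->
  ('N_q[f \o phi] <= 'N_q[f])%E.
Proof.
case: q => [r||//] r0 mf.
  rewrite !Lnorm_EFinE.
  have := @ge0_integral_comp (fun x => (`|f x| `^ r)%:E).
  by rewrite /= => -> //; exact: measurable_powR_norm.
rewrite unlock; case: ifPn => // _.
apply/ess_supP => /=.
have := ess_sup_ge mu (abse \o (EFin \o f)).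
by move=> /ae_comp.
Qed.

End measure_preserving.

(** Where |f| <= max(|g|,|h|), the q-th powers of the norms of g and h add up, and
    a^q + b^q <= max(a,b)^{q-p} (a^p + b^p).  The right-hand side is written so
    that it remains correct for q = +oo, where it is max(a,b). *)
Lemma Lnorm_split_le p q f g h a b : 0 < p -> (p%:E < q)%E ->
  0 <= a -> 0 <= b ->
  measurable_fun setT f -> measurable_fun setT g -> measurable_fun setT h ->
  (forall x, `|f x| <= Num.max `|g x| `|h x|) ->
  ('N_q[g] <= a%:E)%E -> ('N_q[h] <= b%:E)%E ->
  ('N_q[f] <= (Num.max a b `^ (1 - p * einv q) *
               (a `^ p + b `^ p) `^ (einv q))%:E)%E.
Proof.
move=> p0 pq a0 b0 mf mg mh fgh.
set M := Num.max a b.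
have M0 : 0 <= M by rewrite le_max a0.
have S0 : 0 <= a `^ p + b `^ p by rewrite addr_ge0 ?powR_ge0.
case: q pq => [r||//] pq ga hb; last first.
  rewrite /= mulr0 subr0 powRr1// powRr0 mulr1.
  apply: Lnorm_yleP => //.
  move: (Lnorm_yle ga) (Lnorm_yle hb); apply: filterS2 => x gx hx.
  apply: (le_trans (fgh x)); rewrite ge_max !le_max.
  by rewrite gx hx orbT.
rewrite lte_fin in pq; have r0 : 0 < r by exact: lt_trans pq.
move: ga hb; rewrite !Lnorm_leP ?mulr_ge0 ?powR_ge0// => ga hb.
apply: (@le_trans _ _ (\int[mu]_x ((`|g x| `^ r)%:E + (`|h x| `^ r)%:E))%E).
  apply: ge0_le_integral => //=.
  - exact: measurable_powR_norm.
  - apply: emeasurable_funD; exact: measurable_powR_norm.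
  move=> x _; rewrite -EFinD lee_fin.
  have := fgh x; rewrite le_max => /orP[fx|fx].
    by rewrite ler_wpDr ?powR_ge0// ge0_ler_powR ?nnegrE// ltW.
  by rewrite ler_wpDl ?powR_ge0// ge0_ler_powR ?nnegrE// ltW.
rewrite ge0_integralD//=; [|exact: measurable_powR_norm|exact: measurable_powR_norm].
apply: (le_trans (leeD ga hb)); rewrite -EFinD lee_fin.
rewrite powRM ?powR_ge0// -!powRrM mulrBl mul1r mulfVK ?gt_eqF//.
rewrite mulVf ?gt_eqF// powRr1// mulrDr.
have aux c : 0 <= c -> c <= M -> c `^ r <= M `^ (r - p) * c `^ p.
  move=> c0 cM.
  have -> : c `^ r = c `^ (r - p) * c `^ p.
    by rewrite -powRD; [congr (_ `^ _); ring|rewrite subrK gt_eqF].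
  by rewrite ler_wpM2r ?powR_ge0// ge0_ler_powR ?nnegrE// subr_ge0 ltW.
by apply: lerD; apply: aux => //; rewrite /M le_max lexx ?orbT.
Qed.

(** The p-th powers of 2^n |f_{n+1} - f_n| have a summable integral, so almost
    everywhere they tend to 0, and then f_n is a Cauchy sequence of geometric rate.
    The last clause, on points where all f_n vanish, keeps the limit supported
    where the sequence is. *)
Lemma Lnorm_fast_cauchy p (f_ : nat -> T -> R) : 0 < p ->
  (forall n, measurable_fun setT (f_ n)) ->
  (forall n, 'N_p%:E[(fun x => f_ n.+1 x - f_ n x)%R] <= ((4^-1) ^+ n)%:E)%E ->
  exists f, [/\ measurable_fun setT f,
    \forall x \ae mu, f_ n x @[n --> \oo] --> f x &
    forall x, (forall n, f_ n x = 0) -> f x = 0].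
Proof.
move=> p0 mf fC.
pose D n x := f_ n.+1 x - f_ n x.
have mD n : measurable_fun setT (D n) by exact: measurable_funB.
pose g n x := (`|2 ^+ n * D n x| `^ p)%:E : \bar R.
have mg n : measurable_fun setT (g n).
  by apply: measurable_powR_norm; exact: measurable_funM.
have g0 n x : (0 <= g n x)%E by rewrite lee_fin powR_ge0.
pose z : R := (2^-1) `^ p.
have z0 : 0 <= z by exact: powR_ge0.
have z1 : z < 1.
  have -> : 1 = 1 `^ p :> R by rewrite powR1.
  apply: gt0_ltr_powR; rewrite ?nnegrE//.
  by rewrite invf_lt1// ltr1n.
have intg n : (\int[mu]_x g n x <= (z ^+ n)%:E)%E.
  have := fC n; rewrite Lnorm_leP ?exprn_ge0// => h.
  rewrite /g; under eq_integral do rewrite normrM powRM// EFinM.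
  rewrite ge0_integralZl//=; last exact: measurable_powR_norm.
  apply: (le_trans (lee_wpmul2l _ h)); first by rewrite lee_fin powR_ge0.
  rewrite -EFinM lee_fin -powRM ?exprn_ge0// ger0_norm ?exprn_ge0//.
  rewrite -exprMn (_ : 2 * 4^-1 = 2^-1); last by field.
  rewrite /z -!powR_mulrn ?powR_ge0// -!powRrM mulrC.
  by [].
pose S x := (\sum_(n <oo) g n x)%E.
have mS : measurable_fun setT S.
  apply: ge0_emeasurable_sum => // n x _ _; exact: g0.
have intS : (\int[mu]_x S x < +oo)%E.
  rewrite /S integral_nneseries//.
  apply: (@le_lt_trans _ _ (\sum_(n <oo) (z ^+ n)%:E)%E).
    by apply: lee_nneseries => // n _ _; exact: integral_ge0.
  have -> : (\sum_(n <oo) (z ^+ n)%:E = (1 / (1 - z))%:E)%E.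
    apply/cvg_lim => //.
    have := @cvg_geometric_series _ 1 z; rewrite ger0_norm// => /(_ z1) h.
    have -> : (fun n => \sum_(0 <= i < n) (z ^+ i)%:E)%E =
        EFin \o series (geometric 1 z).
      apply/funext => n /=; rewrite /series /= sumEFin; congr EFin.
      by apply: eq_bigr => i _; rewrite mul1r.
    by apply: cvg_EFin => //; exact: nearW.
  exact: ltry.
have iS : mu.-integrable setT S.
  apply/integrableP; split => //.
  rewrite (eq_integral S)// => x _; rewrite gee0_abs//.
  by apply: nneseries_ge0 => n _ _; exact: g0.
pose A := S @^-1` [set y | (y < +oo)%E].
have mA : measurable A.
  rewrite -[A]setTI; apply: mS => //.
  have -> : [set y : \bar R | (y < +oo)%E] = `]-oo, (+oo)%E[%classic.
    by apply/seteqP; split => y /=; rewrite ?in_itv/=.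
  exact: emeasurable_itv.
have aeA : \forall x \ae mu, A x.
  have := integrable_ae measurableT iS; apply: filterS => x /(_ I).
  by rewrite /A /= => Sx; rewrite ltey_eq Sx.
have cvgA x : A x -> cvgn (f_ ^~ x).
  rewrite /A /= => Sx.
  have S0 : (0 <= S x)%E by apply: nneseries_ge0 => n _ _; exact: g0.
  have Sfin : S x \is a fin_num by rewrite ge0_fin_numE.
  pose C := (fine (S x)) `^ p^-1.
  have Dx n : `|D n x| <= C * (2^-1) ^+ n.
    have gS : (g n x <= S x)%E.
      apply: (@le_trans _ _ (\sum_(0 <= i < n.+1) g i x)%E).
        by rewrite big_nat_recr//= leeDr// sume_ge0.
      by apply: nneseries_lim_ge => k _ _; exact: g0.
    rewrite exprVn ler_pdivlMr ?exprn_gt0// mulrC.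
    have -> : 2 ^+ n * `|D n x| = (`|2 ^+ n * D n x| `^ p) `^ p^-1.
      by rewrite -powRrM mulfV ?gt_eqF// powRr1// normrM ger0_norm ?exprn_ge0.
    apply: ge0_ler_powR; rewrite ?nnegrE ?powR_ge0 ?invr_ge0 ?(ltW p0)//.
      exact: fine_ge0.
    by rewrite -lee_fin fineK.
  have cD : cvgn (series (telescope (f_ ^~ x))).
    apply: normed_cvg.
    apply: (@series_le_cvg _ _ (geometric C 2^-1)).
    - by move=> n; exact: normr_ge0.
    - by move=> n /=; rewrite mulr_ge0 ?powR_ge0 ?exprn_ge0.
    - by move=> n; exact: Dx.
    - apply: is_cvg_geometric_series; rewrite ger0_norm//.
      by rewrite invf_lt1// ltr1n.
  have -> : f_ ^~ x = (fun n => f_ 0%N x + series (telescope (f_ ^~ x)) n).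
    by apply/funext => n; rewrite [LHS](eq_sum_telescope (f_ ^~ x)).
  by apply: is_cvgD => //; exact: is_cvg_cst.
pose h n := (f_ n) \_ A.
have cvgh x : cvgn (h ^~ x).
  rewrite /h; have [xA|xA] := boolP (x \in A).
    rewrite (_ : (fun n => _) = f_ ^~ x); first by apply: cvgA; rewrite inE in xA.
    by apply/funext => n; rewrite patchE xA.
  rewrite (_ : (fun n => _) = fun=> 0); first exact: is_cvg_cst.
  by apply/funext => n; rewrite patchE (negbTE xA).
exists (fun x => limn (h ^~ x)); split.
- apply: (@measurable_fun_cvg _ _ _ _ h) => //.
  by move=> n; exact: measurable_patch.
- apply: filterS aeA => x Ax.
  have -> : f_ ^~ x = h ^~ x.
    by apply/funext => n; rewrite /h patchE mem_set.
  exact: cvgh.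
- move=> x f0; apply/cvg_lim => //.
  rewrite (_ : h ^~ x = fun=> 0); first exact: cvg_cst.
  by apply/funext => n; rewrite /h patchE f0 if_same.
Qed.

End Lnorm_on_sets.

(** * A dichotomy for splitting the mass *)

Section concentration.
Context (R : realType).

Lemma near1_powR_sub (g e : R) : 0 < e ->
  exists2 d : R, 0 < d & 1 + d - (1 + d) `^ (- g) < e.
Proof.
move=> e0.
have c1 : {for 1, continuous ((@powR R) ^~ (- g))}.
  apply/differentiable_continuous/derivable1_diffP.
  by apply: derivable_powR; rewrite in_itv/= ltr01.
have := c1; rewrite /prop_for /continuous_at powR1 => /cvgrPdist_lt/(_ (e / 2)).
rewrite divr_gt0// => /(_ isT) /nbhs_ballP[/= r r0 hr].
pose d := Num.min (r / 2) (e / 4).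
have d0 : 0 < d by rewrite lt_min !divr_gt0.
exists d => //.
have d1 : d < r.
  apply: (@le_lt_trans _ _ (r / 2)); first by rewrite ge_min lexx.
  by rewrite gtr_pMr// invf_lt1// ltr1n.
have d2 : d <= e / 4 by rewrite ge_min lexx orbT.
have := hr (1 + d); rewrite /ball/= opprD addrA subrr add0r normrN gtr0_norm//.
move=> /(_ d1); rewrite ltr_norml => /andP[h1 h2].
lra.
Qed.

(** The two bounds force max(a,b)^p to be within a small error of a^p + b^p, because
    the exponent 1 - ps is positive: sharing the mass is too expensive.  As a is bounded
    below, the mass sits in a. *)
Lemma concentration_dichotomy (p s c e : R) : 0 < p -> 0 <= s -> p * s < 1 ->
  0 < c -> 0 < e ->
  exists2 d : R, 0 < d & forall a b : R, 0 <= a -> 0 <= b -> c <= a ->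
    a `^ p + b `^ p <= 1 + d ->
    1 <= Num.max a b `^ (1 - p * s) * (a `^ p + b `^ p) `^ s ->
    b <= e.
Proof.
move=> p0 s0 ps c0 e0.
pose m := Num.min c e.
have m0 : 0 < m by rewrite lt_min c0.
have [d d0 hd] := near1_powR_sub (s * p / (1 - p * s)) (powR_gt0 p m0).
exists d => // a b a0 b0 ca ab1 ab2.
have ps1 : 0 < 1 - p * s by rewrite subr_gt0.
have S0 : 0 < a `^ p + b `^ p.
  by rewrite ltr_wpDr ?powR_ge0// powR_gt0// (lt_le_trans c0).
have M0 : 0 <= Num.max a b by rewrite le_max a0.
have h1 : (1 + d) `^ (- s) <= Num.max a b `^ (1 - p * s).
  rewrite powRN -div1r ler_pdivrMr ?powR_gt0 ?addr_gt0//.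
  apply: (le_trans ab2); rewrite ler_wpM2l ?powR_ge0//.
  by rewrite ge0_ler_powR ?nnegrE ?addr_ge0 ?powR_ge0// ltW.
have h2 : (1 + d) `^ (- (s * p / (1 - p * s))) <= Num.max a b `^ p.
  have := @ge0_ler_powR _ (p / (1 - p * s)) _ _ _ _ _ h1.
  have e1 : (1 - p * s) * (p / (1 - p * s)) = p by field; rewrite gt_eqF.
  rewrite -!powRrM e1 mulNr mulrA; apply.
  - by rewrite divr_ge0 ?ltW.
  - by rewrite nnegrE powR_ge0.
  - by rewrite nnegrE powR_ge0.
have h3 : a `^ p + b `^ p - Num.max a b `^ p < m `^ p.
  by apply: le_lt_trans hd; rewrite lerB.
have [ba|ab] := leP b a.
  move: h3; rewrite max_l// addrC addKr => h3.
  have bm : b < m.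
    rewrite ltNge; apply/negP => mb; move: h3; rewrite ltNge => /negP; apply.
    by apply: ge0_ler_powR => //; rewrite ?nnegrE ltW.
  by rewrite ltW// (lt_le_trans bm)// ge_min lexx orbT.
move: h3; rewrite max_r ?(ltW ab)// addrK => h3.
exfalso; move: h3; apply/negP; rewrite -leNgt.
by rewrite ge0_ler_powR ?nnegrE ?(ltW p0) ?(ltW m0)// (le_trans _ ca)// ge_min lexx.
Qed.

End concentration.

(** * Lebesgue measure on R^n and dyadic cubes *)

Section lebesgue_translation.
Variable R : realType.

Lemma lebesgue_measure_translation (a : R) (A : set R) : measurable A ->
  lebesgue_measure ((fun x => x + a) @^-1` A) = lebesgue_measure A.
Proof.
move=> mA; apply/esym.
have mf : measurable_fun setT ((fun x => x + a) : measurableTypeR R -> measurableTypeR R).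
  by apply: measurable_funD.
have := @lebesgue_measure_unique R (pushforward lebesgue_measure (fun x => x + a : measurableTypeR R)).
apply => // X [[x y] _ <-] /=; rewrite /pushforward.
have -> : (fun z => z + a) @^-1` `]x, y] = `]x - a, y - a]%classic.
  by apply/seteqP; split => z /=; rewrite !in_itv/= ltrBlDr lerBrDr.
rewrite !lebesgue_measure_itv/= !lte_fin ltrD2r.
by case: ifPn => // _; rewrite -!EFinB opprB addrA subrK.
Qed.

Lemma rV_cons_ord0 n (t : R) (w : 'rV[R]_n) : rV_cons (t, w) ord0 ord0 = t.
Proof.
have -> : (ord0 : 'I_n.+1) = lshift n (ord0 : 'I_1) by apply/val_inj.
by rewrite /rV_cons (@row_mxEl R 1 1 n) mxE.
Qed.

Lemma rV_cons_lift n (t : R) (w : 'rV[R]_n) (i : 'I_n) :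
  rV_cons (t, w) ord0 (lift ord0 i) = w ord0 i.
Proof.
have -> : lift ord0 i = rshift 1 i by apply/val_inj.
by rewrite /rV_cons (@row_mxEr R 1 1 n).
Qed.

Lemma measurable_rV_shift n (v : 'rV[R]_n) :
  measurable_fun setT (fun x : 'rV[R]_n => x + v).
Proof.
apply: measurable_fun_rV => i.
under eq_fun do rewrite mxE.
by apply: measurable_funD => //; exact: measurable_rV_coord.
Qed.

Lemma measurableT_preimage d1 d2 (T1 : sigmaRingType d1) (T2 : sigmaRingType d2)
  (f : T1 -> T2) (A : set T2) : measurable [set: T1] -> measurable_fun setT f ->
  measurable A -> measurable (f @^-1` A).
Proof. by move=> mT mf mA; rewrite -[X in measurable X]setTI; exact: mf. Qed.

(** By induction on the dimension: the measure is an iterated product, and each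
    factor is invariant. *)
Lemma lebesgue_rV_translation n (v : 'rV[R]_n) (A : set 'rV[R]_n) :
  measurable A -> lebesgue_rV ((fun x => x + v) @^-1` A) = lebesgue_rV A.
Proof.
elim: n v A => [|n IH] v A mA.
  by congr lebesgue_rV; apply/seteqP; split => x /=; rewrite (_ : x + v = x)//;
    apply/rowP => -[].
pose v' : 'rV[R]_n := \row_i v ord0 (lift ord0 i).
pose L : {sigma_finite_measure set (measurableTypeR R) -> \bar R} := lebesgue_measure.
pose tau (tw : measurableTypeR R * 'rV[R]_n) : measurableTypeR R * 'rV[R]_n :=
  (tw.1 + v ord0 ord0, tw.2 + v').
have mtau : measurable_fun setT tau.
  apply: measurable_fun_pair => /=.
    by apply: measurable_funD.
  exact: (measurableT_comp (measurable_rV_shift v')).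
rewrite /= /pushforward.
have mcA : measurable (@rV_cons R n @^-1` A).
  by apply: measurableT_preimage => //; exact: measurable_rV_cons.
pose M := (L \x @lebesgue_rV R n)%E.
have tauE tw : rV_cons tw + v = rV_cons (tau tw).
  case: tw => t w; apply/rowP => i; rewrite mxE.
  case: (unliftP ord0 i) => [j ->|->].
    by rewrite !rV_cons_lift mxE mxE.
  by rewrite !rV_cons_ord0.
have -> : @rV_cons R n @^-1` ((fun x => x + v) @^-1` A) =
    tau @^-1` (@rV_cons R n @^-1` A).
  by apply/seteqP; split => tw; rewrite /preimage /mkset tauE.
apply/esym.
apply: (@product_measure_unique _ _ _ _ _ L (@lebesgue_rV R n) (pushforward M tau)) => //.
move=> B C mB mC; 
transitivity (M (((fun x => x + v ord0 ord0) @^-1` B) `*` ((fun x => x + v') @^-1` C))).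
  by congr (M _); apply/seteqP; split => -[].
rewrite /M product_measure1E//.
- by congr (_ * _)%E; [exact: lebesgue_measure_translation|exact: IH].
- by apply: measurableT_preimage => //; exact: measurable_funD.
- by apply: measurableT_preimage => //; exact: measurable_rV_shift.
Qed.

Lemma measurable_box n (A : 'I_n -> set R) : (forall i, measurable (A i)) ->
  measurable [set x : 'rV[R]_n | forall i, A i (x ord0 i)].
Proof.
move=> mA.
have -> : [set x : 'rV[R]_n | forall i, A i (x ord0 i)] =
   \bigcap_(i in [set: 'I_n]) ((fun w : 'rV[R]_n => w ord0 i) @^-1` (A i)).
  by apply/seteqP; split => w /= h i; [move=> _; exact: h|exact: h].
apply: fin_bigcap_measurable => // i _.
by apply: measurableT_preimage => //; exact: measurable_rV_coord.
Qed.

Lemma lebesgue_rV_box n (A : 'I_n -> set R) :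
  (forall i, measurable (A i)) ->
  lebesgue_rV [set x : 'rV[R]_n | forall i, A i (x ord0 i)] =
  (\prod_(i < n) lebesgue_measure (A i))%E.
Proof.
elim: n A => [|n IH] A mA.
  by rewrite big_ord0 /= diracE mem_set//= => -[].
rewrite big_ord_recl /= /pushforward.
pose L : {sigma_finite_measure set (measurableTypeR R) -> \bar R} := lebesgue_measure.
have -> : @rV_cons R n @^-1` [set x | forall i, A i (x ord0 i)] =
    (A ord0 : set (measurableTypeR R)) `*` [set w : 'rV[R]_n | forall i, A (lift ord0 i) (w ord0 i)].
  apply/seteqP; split => -[t w] /=.
    move=> h; split; first by have := h ord0; rewrite rV_cons_ord0.
    by move=> i; have := h (lift ord0 i); rewrite rV_cons_lift.
  move=> [/= h0 h] i; case: (unliftP ord0 i) => [j ->|->].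
    by rewrite rV_cons_lift.
  by rewrite rV_cons_ord0.
rewrite (@product_measure1E _ _ _ _ _ L (@lebesgue_rV R n))//.
  by congr (_ * _)%E; apply: (IH (fun i => A (lift ord0 i))).
  exact: mA.
by apply: (@measurable_box n (fun i : 'I_n => A (lift ord0 i))).
Qed.

End lebesgue_translation.

Section row_norm.
Context (R : realType) (n : nat).
Implicit Types x y : 'rV[R]_n.

Lemma rV_norm_coord x i : `|x ord0 i| <= `|x|.
Proof.
rewrite [leRHS]/Num.Def.normr /= mx_normrE.
by apply/bigmax_geP; right => /=; exists (ord0, i).
Qed.

Lemma rV_norm_le x e : 0 <= e -> (forall i, `|x ord0 i| <= e) -> `|x| <= e.
Proof.
move=> e0 xe; rewrite /Num.Def.normr /= mx_normrE.
by apply/bigmax_leP; split => // -[i j] _ /=; rewrite (ord1 i).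
Qed.

End row_norm.

Section dyadic_cells.
Context (R : realType) (n : nat).
Implicit Types (x y : 'rV[R]_n) (c : 'rV[int]_n) (m : nat).

(** The index of the dyadic cube of side 2^-m that contains x.  Indexing cubes by
    integer vectors makes the functions that are constant on cubes exactly those
    that factor through [cell]. *)
Definition cell m x : 'rV[int]_n := \row_i Num.floor (2 ^+ m * x ord0 i).

Definition cube m c : set 'rV[R]_n := [set x | cell m x = c].

Lemma cubeE m c : cube m c =
  [set x | forall i, `[(c ord0 i)%:~R / 2 ^+ m, ((c ord0 i)%:~R + 1) / 2 ^+ m[%classic (x ord0 i)].
Proof.
apply/seteqP; split => x /=.
  move=> <- i; rewrite mxE in_itv/= ler_pdivrMr ?exprn_gt0// ltr_pdivlMr ?exprn_gt0//.
  by have := floor_itv (2 ^+ m * x ord0 i); rewrite intrD (mulrC (2 ^+ m)).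
move=> h; apply/rowP => i; rewrite mxE; apply: floor_def.
have := h i; rewrite in_itv/= ler_pdivrMr ?exprn_gt0// ltr_pdivlMr ?exprn_gt0//.
by rewrite intrD (mulrC (2 ^+ m)).
Qed.

Lemma measurable_cube m c : measurable (cube m c).
Proof.
rewrite cubeE.
pose A i := `[(c ord0 i)%:~R / 2 ^+ m, ((c ord0 i)%:~R + 1) / 2 ^+ m[%classic : set R.
by apply: (measurable_box (A := A)) => i; exact: measurable_itv.
Qed.

Lemma lebesgue_cube m c : lebesgue_rV (cube m c) = (((2 ^+ m)^-1) ^+ n)%:E.
Proof.
pose A i := `[(c ord0 i)%:~R / 2 ^+ m, ((c ord0 i)%:~R + 1) / 2 ^+ m[%classic : set R.
rewrite cubeE (@lebesgue_rV_box _ _ A); last by move=> i; exact: measurable_itv.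
transitivity (\prod_(i < n) ((2 ^+ m)^-1 : R)%:E)%E.
  apply: eq_bigr => i _; rewrite lebesgue_measure_itv/= lte_fin.
  rewrite ltr_pM2r ?invr_gt0 ?exprn_gt0// ltrDl ltr01 -EFinB; congr EFin.
  by rewrite -mulrBl addrAC subrr add0r mul1r.
by rewrite prodEFin prodr_const card_ord.
Qed.

Lemma measurable_cell m (D : set 'rV[int]_n) : measurable (cell m @^-1` D).
Proof.
have -> : cell m @^-1` D =
    \bigcup_(c in [set: 'rV[int]_n]) (if c \in D then cube m c else set0).
  apply/seteqP; split => x /=.
    by move=> Dx; exists (cell m x) => //; rewrite mem_set.
  by move=> [c _]; case: ifPn => // /set_mem Dc ->.
apply: countable_bigcupT_measurable; first exact: countableP.
by move=> c; case: ifP => // _; exact: measurable_cube.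
Qed.

(** Countably many cubes, each measurable: a function constant on cubes needs no
    further assumption. *)
Lemma measurable_fun_cell d (T : measurableType d) m (f : 'rV[R]_n -> T) :
  (forall x y, cell m x = cell m y -> f x = f y) -> measurable_fun setT f.
Proof.
move=> fc _ B mB; rewrite setTI.
have -> : f @^-1` B = cell m @^-1` [set c | exists2 x, cell m x = c & B (f x)].
  apply/seteqP; split => x /=; first by move=> Bx; exists x.
  by move=> [y yx]; rewrite (fc _ _ yx).
exact: measurable_cell.
Qed.

Lemma cell_dist m x y : cell m x = cell m y -> `|x - y| <= (2 ^+ m)^-1.
Proof.
move=> xy; apply: rV_norm_le; first by rewrite invr_ge0 exprn_ge0.
move=> i; rewrite !mxE.
have := congr1 (fun c : 'rV[int]_n => c ord0 i) xy; rewrite !mxE => xyi.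
have := floor_itv (2 ^+ m * x ord0 i); have := floor_itv (2 ^+ m * y ord0 i).
rewrite xyi intrD => /andP[y1 y2] /andP[x1 x2].
rewrite -[leRHS]mul1r ler_pdivlMr ?exprn_gt0//.
rewrite -(ger0_norm (exprn_ge0 m (ler0n R 2))) -normrM ler_norml.
by apply/andP; split; lra.
Qed.

Definition corner m c : 'rV[R]_n := \row_i ((c ord0 i)%:~R / 2 ^+ m).

Lemma cell_corner m c : cell m (corner m c) = c.
Proof.
apply/rowP => i; by rewrite !mxE mulrCA divff ?mulr1 ?intrKfloor// expf_neq0.
Qed.

Lemma cvg_exp2V : (2 ^+ m)^-1 @[m --> \oo] --> (0 : R).
Proof.
under eq_fun do rewrite -exprVn.
by apply: cvg_expr; rewrite ger0_norm// invf_lt1// ltr1n.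
Qed.

Lemma cvg_corner x : corner m (cell m x) @[m --> \oo] --> x.
Proof.
apply/cvgrPdist_le => e e0.
move/cvgrPdist_le : cvg_exp2V => /(_ e e0); apply: filterS => m.
rewrite sub0r normrN ger0_norm ?invr_ge0 ?exprn_ge0//; apply: le_trans.
by apply: cell_dist; rewrite cell_corner.
Qed.

(** A continuous function is the pointwise limit of its values at the corners of
    dyadic cubes, which are step functions. *)
Lemma continuous_measurable_rV (f : 'rV[R]_n -> R) : continuous f ->
  measurable_fun setT f.
Proof.
move=> cf.
apply: (@measurable_fun_cvg _ _ _ _ (fun m x => f (corner m (cell m x)))).
  by move=> m; apply: (@measurable_fun_cell _ _ m) => x y ->.
by move=> x _; apply: (continuous_cvg _ (cf x)); exact: cvg_corner.
Qed.

Lemma lebesgue_closed_box (L : R) : 0 <= L ->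
  lebesgue_rV [set x : 'rV[R]_n | forall i, `|x ord0 i| <= L] =
  ((L *+ 2) ^+ n)%:E.
Proof.
move=> L0.
have -> : [set x : 'rV[R]_n | forall i, `|x ord0 i| <= L] =
    [set x | forall i, `[- L, L]%classic (x ord0 i)].
  by apply/seteqP; split => x /= h i; have := h i; rewrite in_itv/= ler_norml.
rewrite (@lebesgue_rV_box _ _ (fun=> `[- L, L]%classic)); last first.
  by move=> i; exact: measurable_itv.
transitivity (\prod_(i < n) (L *+ 2)%:E)%E.
  apply: eq_bigr => i _; rewrite lebesgue_measure_itv/= lte_fin.
  move: L0; rewrite le_eqVlt => /predU1P[<-|L0]; first by rewrite oppr0 ltxx mul0rn.
  have -> : - L < L by lra.
  by rewrite -EFinB opprK -mulr2n.
by rewrite prodEFin prodr_const card_ord.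
Qed.

Lemma closed_boxE (L : R) : 0 <= L ->
  [set x : 'rV[R]_n | `|x| <= L] = [set x | forall i, `|x ord0 i| <= L].
Proof.
move=> L0; apply/seteqP; split => x /=.
  by move=> xL i; rewrite (le_trans (rV_norm_coord _ _)).
exact: rV_norm_le.
Qed.

Lemma lebesgue_ball (L : R) : 0 <= L ->
  lebesgue_rV [set x : 'rV[R]_n | `|x| <= L] = ((L *+ 2) ^+ n)%:E.
Proof. by move=> L0; rewrite closed_boxE// lebesgue_closed_box. Qed.

Lemma measurable_ball_le (L : R) : measurable [set x : 'rV[R]_n | `|x| <= L].
Proof.
have [L0|L0] := leP 0 L; last first.
  rewrite (_ : [set x | _] = set0)//; apply/seteqP; split => x //= xL.
  by have := le_lt_trans xL L0; rewrite ltNge normr_ge0.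
pose A := fun _ : 'I_n => `[- L, L]%classic : set R.
rewrite [X in measurable X](_ : _ = [set x : 'rV[R]_n | forall i, A i (x ord0 i)]).
  by apply: (measurable_box (A := A)) => i; exact: measurable_itv.
rewrite closed_boxE//.
by apply/seteqP; split => x /= h i; have := h i; rewrite /A /= in_itv/= ler_norml.
Qed.

End dyadic_cells.

(** * Functions of class C^1 with compact support *)

Section compact_support_C1.
Context (R : realType) (n : nat).
Local Notation V := 'rV[R]_n.
Local Notation mu := (@lebesgue_rV R n).
Implicit Types (f g : V -> R) (x y v : V) (L M K h t : R).
Local Notation "'N_ q [ f ]" := (Lnorm mu q (EFin \o f)).
Local Notation e_ i := (delta_mx ord0 i : V).

Definition supported L f := forall x, L < `|x| -> f x = 0.

Record C1c f : Prop := C1cMk {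
  C1c_cont : continuous f;
  C1c_der : forall i x, derivable f x (e_ i);
  C1c_cont_der : forall i, continuous (partial i f);
  C1c_supp : exists2 L, 0 <= L & supported L f }.

Lemma norm_delta_le i : `|e_ i| <= 1.
Proof.
apply: rV_norm_le => // j; rewrite mxE; case: (_ && _) => /=; first by rewrite normr1.
by rewrite normr0.
Qed.

Lemma open_norm_gt L : open [set x : V | L < `|x|].
Proof. by apply: open_comp (@open_gt _ L) => x _; exact: norm_continuous. Qed.

Lemma supported_partial L f i : supported L f -> supported L (partial i f).
Proof.
move=> fL x xL; rewrite /partial.
rewrite (@near_eq_derive _ _ _ _ (cst 0)) ?derive_cst//.
have : nbhs x [set y : V | L < `|y|] by apply: open_nbhs_nbhs; split => //; exact: open_norm_gt.
by apply: filterS => y /fL.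
Qed.

Lemma compact_ball_le L : compact [set x : V | `|x| <= L].
Proof.
apply: bounded_closed_compact.
  exists L; split; first exact: num_real.
  by move=> M LM x /= xL; rewrite (le_trans xL)// ltW.
apply: (@closed_comp _ _ (fun x : V => `|x|) [set y | y <= L]).
  by move=> x _; exact: norm_continuous.
exact: closed_le.
Qed.

Lemma supported_bounded f L : continuous f -> supported L f ->
  exists2 M, 0 <= M & forall x, `|f x| <= M.
Proof.
move=> cf fL.
have : compact (f @` [set x : V | `|x| <= L]).
  by apply: continuous_compact; [exact: continuous_subspaceT|exact: compact_ball_le].
move=> /compact_bounded[M0 [_ hM]].
exists (`|M0| + 1); first by rewrite addr_ge0.
move=> x; have [xL|xL] := leP `|x| L; last by rewrite fL// normr0 addr_ge0.
by apply: hM; [rewrite ltr_pwDr// ler_norm|exists x].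
Qed.

Lemma C1c_measurable f : C1c f -> measurable_fun setT f.
Proof. by move=> /C1c_cont; exact: continuous_measurable_rV. Qed.

Lemma C1c_measurable_partial f i : C1c f -> measurable_fun setT (partial i f).
Proof. by move=> /C1c_cont_der/(_ i); exact: continuous_measurable_rV. Qed.

Lemma C1c_bounded f : C1c f -> exists2 M, 0 <= M & forall x, `|f x| <= M.
Proof. by case=> cf _ _ [L _ fL]; exact: supported_bounded fL. Qed.

Lemma C1c_bounded_partial f i : C1c f ->
  exists2 M, 0 <= M & forall x, `|partial i f x| <= M.
Proof.
case=> _ _ cf [L _ fL].
exact: (supported_bounded (cf i) (supported_partial i fL)).
Qed.

Lemma integrable_ball L M : mu.-integrable setT
  (fun x => (if `|x| <= L then M else 0)%:E).
Proof.
have [L0|L0] := leP 0 L; last first.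
  apply: (eq_integrable measurableT (cst 0%E)); last exact: integrable0.
  move=> x _; rewrite (_ : (`|x| <= L) = false)//.
  by apply/negbTE; rewrite -ltNge (lt_le_trans L0).
have -> : (fun x : V => (if `|x| <= L then M else 0)%:E) =
    (cst M%:E) \_ [set x : V | `|x| <= L].
  apply/funext => x; rewrite patchE; case: leP => xL; first by rewrite mem_set.
  by rewrite memNset//= => /(lt_le_trans xL); rewrite ltxx.
apply/(integrable_mkcond _ _).1; first exact: measurable_ball_le.
apply/integrableP; split; first exact: measurable_cst.
rewrite /= integral_cst//; last exact: measurable_ball_le.
by rewrite [X in (_ * X)%E]lebesgue_ball// -EFinM ltry.
Qed.

Lemma supported_integrable f L M : measurable_fun setT f -> supported L f ->
  (forall x, `|f x| <= M) -> mu.-integrable setT (EFin \o f).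
Proof.
move=> mf fL fM; apply: le_integrable (integrable_ball L M) => //.
  exact/measurable_EFinP.
move=> x _ /=; rewrite lee_fin; have [xL|xL] := leP `|x| L.
  by rewrite (le_trans (fM x))// ler_norm.
by rewrite fL.
Qed.

Lemma supported_Lnorm p f L M : 0 < p -> measurable_fun setT f ->
  supported L f -> (forall x, `|f x| <= M) ->
  exists2 K, 0 <= K & ('N_p%:E[f] <= K%:E)%E.
Proof.
move=> p0 mf fL fM.
have : mu.-integrable setT (EFin \o (fun x => `|f x| `^ p)).
  apply: (@supported_integrable _ L (M `^ p)).
  - by have := measurable_powR_norm p mf => /measurable_EFinP.
  - by move=> x /fL ->; rewrite normr0 powR0 ?gt_eqF.
  - move=> x; rewrite ger0_norm ?powR_ge0//.
    have M0 : 0 <= M by exact: le_trans (fM x).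
    by rewrite ge0_ler_powR ?nnegrE ?(ltW p0).
move=> /integrableP[_].
under eq_integral do rewrite /= ger0_norm ?powR_ge0//.
set I := (\int[mu]_x _)%E => Ioo.
have I0 : (0 <= I)%E by apply: integral_ge0 => x _; rewrite lee_fin powR_ge0.
exists (fine I `^ p^-1); first exact: powR_ge0.
rewrite Lnorm_leP ?powR_ge0// -powRrM mulVf ?gt_eqF// powRr1 ?fine_ge0//.
by rewrite fineK// ge0_fin_numE.
Qed.

Lemma is_derive_line f x v t : derivable f (t *: v + x) v ->
  is_derive t 1 (fun s => f (s *: v + x)) ('D_v f (t *: v + x)).
Proof.
have E : (fun h : R => h^-1 *: (((fun s => f (s *: v + x)) \o shift t) (h *: 1) - f (t *: v + x)))
    = (fun h : R => h^-1 *: ((f \o shift (t *: v + x)) (h *: v) - f (t *: v + x))).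
  apply/funext => h /=; congr (_ *: (f _ - _)).
  by rewrite scalerDl addrA [h *: 1]mulr1.
by move=> df; apply: DeriveDef; rewrite /derivable /derive E.
Qed.

Lemma C1c_MVT f i x h M : C1c f -> (forall y, `|partial i f y| <= M) ->
  `|f (x + h *: e_ i) - f x| <= `|h| * M.
Proof.
move=> Cf fM.
pose g s := f (s *: e_ i + x).
have dg (s : R) : is_derive s 1 g (partial i f (s *: e_ i + x)).
  by apply: is_derive_line; exact: C1c_der.
have cg : continuous g.
  by move=> s; apply/differentiable_continuous/derivable1_diffP; have [] := dg s.
have -> : f (x + h *: e_ i) - f x = g h - g 0.
  by rewrite /g scale0r add0r (addrC x).
have key a b : a < b -> `|g b - g a| <= (b - a) * M.
  move=> ab; have [|c _ ->] := MVT ab (fun s _ => dg s).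
    exact: continuous_subspaceT.
  by rewrite normrM mulrC [`|b - a|]gtr0_norm ?subr_gt0// ler_pM2l ?subr_gt0.
have [h0|h0|->] := ltgtP h 0.
- by rewrite distrC; have := key _ _ h0; rewrite sub0r (ltr0_norm h0).
- by have := key _ _ h0; rewrite subr0 (gtr0_norm h0).
- by rewrite subrr !normr0 mul0r.
Qed.

(** The difference quotient (f(x + (h/(k+1)) e_i) - f x) (k+1), which approximates
    h times the partial derivative. *)
Definition diffq f i h (k : nat) x : R :=
  k.+1%:R * (f (x + (h / k.+1%:R) *: e_ i) - f x).

Lemma cvg_diffq f i h x : C1c f ->
  diffq f i h k x @[k --> \oo] --> h * partial i f x.
Proof.
move=> Cf; have [->|h0] := eqVneq h 0.
  rewrite mul0r (_ : (fun k => _) = cst 0); first exact: cvg_cst.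
  by apply/funext => k; rewrite /diffq mul0r scale0r addr0 subrr mulr0.
have := @C1c_der _ Cf i x; rewrite /derivable.
set F := (fun h : R => _) => cF.
have u0 : h / k.+1%:R @[k --> \oo] --> (0 : R).
  rewrite -[X in _ --> X](mulr0 h); apply: cvgM; first exact: cvg_cst.
  exact: cvg_harmonic.
have u0' : h / k.+1%:R @[k --> \oo] --> (0 : R)^'.
  move=> A; rewrite /dnbhs /within/= => nA.
  have h1 : \forall k \near \oo, h / k.+1%:R != 0 -> A (h / k.+1%:R) by exact: u0 _ nA.
  change (\forall k \near \oo, A (h / k.+1%:R)).
  apply: filterS h1 => k; apply.
  by rewrite mulf_neq0// invr_neq0.
have cFu : F (h / k.+1%:R) @[k --> \oo] --> partial i f x.
  exact: (cvg_comp _ _ u0' cF).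
have -> : (fun k => diffq f i h k x) = (fun k => h * F (h / k.+1%:R)).
  apply/funext => k; rewrite /diffq /F /= (addrC x) /GRing.scale /= mulrA.
  by congr (_ * _); rewrite invfM invrK mulrA divff// mul1r.
by apply: cvgM => //; exact: cvg_cst.
Qed.

Lemma diffq_le f i h k x M : C1c f -> (forall y, `|partial i f y| <= M) ->
  `|diffq f i h k x| <= `|h| * M.
Proof.
move=> Cf fM; rewrite /diffq normrM ger0_norm//.
apply: (le_trans (ler_wpM2l _ (C1c_MVT x (h / k.+1%:R) Cf fM))) => //.
by rewrite normrM mulrA mulrCA normfV [`|k.+1%:R|]ger0_norm// mulfV ?mulr1.
Qed.

Lemma diffq_supported f i h k L : supported L f ->
  supported (L + `|h|) (diffq f i h k).
Proof.
move=> fL x xL; rewrite /diffq.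
have hk : `|(h / k.+1%:R) *: e_ i| <= `|h|.
  rewrite normrZ -[leRHS]mulr1; apply: ler_pM => //; last exact: norm_delta_le.
  by rewrite normrM [`|k.+1%:R^-1|]ger0_norm ?invr_ge0// ler_piMr// invf_le1 ?ler1n.
have xL' : L < `|x + (h / k.+1%:R) *: e_ i|.
  have := ler_normB (x + (h / k.+1%:R) *: e_ i) ((h / k.+1%:R) *: e_ i).
  by rewrite addrK; lra.
by rewrite !fL ?subrr ?mulr0//; have := normr_ge0 h; lra.
Qed.

Lemma measurable_shift f v : measurable_fun setT f ->
  measurable_fun setT (fun x => f (x + v)).
Proof. by move=> mf; apply: (measurableT_comp mf); exact: measurable_rV_shift. Qed.

Lemma measurable_diffq f i h k : measurable_fun setT f ->
  measurable_fun setT (diffq f i h k).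
Proof.
move=> mf; apply: measurable_funM => //; apply: measurable_funB => //.
exact: measurable_shift.
Qed.

Lemma Lnorm_shift q f v : (0 < q)%E -> measurable_fun setT f ->
  'N_q[(fun x => f (x + v))%R] = 'N_q[f].
Proof.
move=> q0 mf; apply/eqP; rewrite eq_le; apply/andP; split.
  apply: (Lnorm_comp_le (measurable_rV_shift v)) => // A mA.
  exact: lebesgue_rV_translation.
pose g x := f (x + v).
have fE : f = g \o (fun x => x - v) by apply/funext => x; rewrite /g /= subrK.
rewrite [leLHS](_ : _ = 'N_q[g \o (fun x => x - v)]); last by rewrite -fE.
apply: (Lnorm_comp_le (measurable_rV_shift (- v))) => //.
- by move=> A mA; exact: lebesgue_rV_translation.
- exact: measurable_shift.
Qed.

Lemma ge0_integral_shift (g : V -> \bar R) v : measurable_fun setT g ->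
  (forall x, 0 <= g x)%E -> (\int[mu]_x g (x + v)%R = \int[mu]_x g x)%E.
Proof.
move=> mg g0; apply: (ge0_integral_comp (measurable_rV_shift v)) => // A mA.
exact: lebesgue_rV_translation.
Qed.

(** An increment by k v is a sum of k translates of the increment by v, all of the
    same norm. *)
Lemma Lnorm_increment_natmul p f v k K : (1 <= p%:E)%E -> measurable_fun setT f ->
  ('N_p%:E[(fun x => f (x + v) - f x)%R] <= K%:E)%E ->
  ('N_p%:E[(fun x => f (x + v *+ k) - f x)%R] <= (K *+ k)%:E)%E.
Proof.
move=> p1 mf fK; elim: k => [|k IH].
  rewrite (_ : EFin \o _ = cst 0%E); last first.
    by apply/funext => x /=; rewrite mulr0n addr0 subrr.
  by rewrite Lnorm0// gt_eqF// (lt_le_trans _ p1).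
have -> : (fun x => f (x + v *+ k.+1) - f x) =
    (fun x => (f (x + v + v *+ k) - f (x + v)) + (f (x + v) - f x)).
  by apply/funext => x; rewrite addrA subrK mulrS addrA.
have p0 : (0 < p%:E)%E by exact: lt_le_trans p1.
rewrite mulrSr; apply: LnormD_le => //.
- apply: (measurable_shift v (f := fun x => f (x + v *+ k) - f x)).
  by apply: measurable_funB => //; exact: measurable_shift.
- by apply: measurable_funB => //; exact: measurable_shift.
- rewrite (Lnorm_shift v (f := fun x => f (x + v *+ k) - f x))//.
  by apply: measurable_funB => //; exact: measurable_shift.
Qed.

(** Cutting h into k equal steps bounds the norm of the increment by that of the
    difference quotient, which tends to |h| times the norm of the partial
    derivative by dominated convergence. *)
Lemma Lnorm_increment_coord p f i h K : 1 <= p -> C1c f -> 0 <= K ->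
  ('N_p%:E[partial i f] <= K%:E)%E ->
  ('N_p%:E[(fun x => f (x + h *: e_ i) - f x)%R] <= (`|h| * K)%:E)%E.
Proof.
move=> p1 Cf K0 fK.
have p0 : 0 < p by exact: lt_le_trans p1.
have mf := C1c_measurable Cf.
have [M M0 fM] := C1c_bounded_partial i Cf.
have [L L0 fL] := C1c_supp Cf.
have le_k k : ('N_p%:E[(fun x => f (x + h *: e_ i) - f x)%R] <= 'N_p%:E[diffq f i h k])%E.
  pose v := (h / k.+1%:R) *: e_ i.
  have hv : h *: e_ i = v *+ k.+1.
    by rewrite /v -scaler_nat scalerA mulrCA divff ?mulr1// pnatr_eq0.
  have mv : measurable_fun setT (fun x => f (x + v) - f x).
    by apply: measurable_funB => //; exact: measurable_shift.
  have -> : 'N_p%:E[diffq f i h k] = (k.+1%:R%:E * 'N_p%:E[(fun x => f (x + v) - f x)%R])%E.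
    by rewrite LnormZl// ger0_norm.
  rewrite hv.
  have [K' K'0 fK'] : exists2 K, 0 <= K & ('N_p%:E[(fun x => f (x + v) - f x)%R] <= K%:E)%E.
    apply: (@supported_Lnorm _ _ (L + `|h|) (`|h / k.+1%:R| * M)) => //.
    - move=> x /(diffq_supported i k fL)/eqP; rewrite /diffq mulf_eq0 pnatr_eq0/=.
      by move=> /eqP.
    - by move=> x; exact: C1c_MVT.
  have Nfin : 'N_p%:E[(fun x => f (x + v) - f x)%R] \is a fin_num.
    by rewrite ge0_fin_numE ?Lnorm_ge0// (le_lt_trans fK')// ltry.
  have := @Lnorm_increment_natmul p f v k.+1 (fine 'N_p%:E[(fun x => f (x + v) - f x)%R]).
  rewrite lee_fin p1 fineK// => /(_ isT mf (lexx _)) /le_trans; apply.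
  by rewrite -[fine _ *+ _]mulr_natl EFinM fineK.
rewrite Lnorm_leP ?mulr_ge0//.
set I := (\int[mu]_x _)%E.
have cv : (\int[mu]_x (`|diffq f i h k x| `^ p)%:E @[k --> \oo] -->
    \int[mu]_x (`|h * partial i f x| `^ p)%:E)%E.
  have mh : measurable_fun setT (fun x => h * partial i f x).
    by apply: measurable_funM => //; exact: C1c_measurable_partial.
  have [] // := @dominated_convergence _ _ _ mu _ measurableT
    (fun k x => (`|diffq f i h k x| `^ p)%:E)
    (fun x => (`|h * partial i f x| `^ p)%:E)
    (fun x => (if `|x| <= L + `|h| then (`|h| * M) `^ p else 0)%:E).
  - by move=> k; apply: measurable_powR_norm; exact: measurable_diffq.
  - exact: measurable_powR_norm.
  - apply: nearW => x _; apply: cvg_EFin; first exact: nearW.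
    apply: cvg_powR => //; apply: cvg_norm; exact: cvg_diffq.
  - exact: integrable_ball.
  - apply: nearW => x k _; rewrite lee_fin ger0_norm ?powR_ge0//.
    have [xL|xL] := leP `|x| (L + `|h|).
      rewrite ge0_ler_powR ?nnegrE ?mulr_ge0// ?(ltW p0)//; exact: diffq_le.
    by rewrite (diffq_supported _ _ fL)// normr0 powR0 ?gt_eqF.
have hI : (\int[mu]_x (`|h * partial i f x| `^ p)%:E <= ((`|h| * K) `^ p)%:E)%E.
  rewrite -Lnorm_leP ?mulr_ge0//; apply: LnormZ_le => //.
  exact: C1c_measurable_partial.
apply: le_trans hI; rewrite -(cvg_lim _ cv)//.
apply: lime_ge; first by apply/cvg_ex; eexists; exact: cv.
apply: nearW => k.
have := le_k k.
have [J0 J0' hJ] : exists2 K, 0 <= K & ('N_p%:E[diffq f i h k] <= K%:E)%E.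
  apply: (@supported_Lnorm _ _ (L + `|h|) (`|h| * M)) => //.
  - exact: measurable_diffq.
  - exact: diffq_supported.
  - by move=> x; exact: diffq_le.
have Nfin : 'N_p%:E[diffq f i h k] \is a fin_num.
  by rewrite ge0_fin_numE ?Lnorm_ge0// (le_lt_trans hJ)// ltry.
rewrite -(fineK Nfin) Lnorm_leP ?fine_ge0 ?Lnorm_ge0// => /le_trans; apply.
have -> : ((fine 'N_p%:E[diffq f i h k] `^ p)%:E = 'N_p%:E[diffq f i h k] `^ p)%E.
  by rewrite -poweR_EFin fineK.
by rewrite poweR_Lnorm ?gt_eqF.
Qed.

(** By translation invariance the difference quotients have integral 0; pass to
    the limit by dominated convergence. *)
Lemma integral_partial f i : C1c f -> (\int[mu]_x (partial i f x)%:E = 0)%E.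
Proof.
move=> Cf.
have mf := C1c_measurable Cf.
have [M M0 fM] := C1c_bounded_partial i Cf.
have [M' M'0 fM'] := C1c_bounded Cf.
have [L L0 fL] := C1c_supp Cf.
have cv : (\int[mu]_x (diffq f i 1 k x)%:E @[k --> \oo] -->
    \int[mu]_x (1 * partial i f x)%:E)%E.
  have [] // := @dominated_convergence _ _ _ mu _ measurableT
    (fun k x => (diffq f i 1 k x)%:E)
    (fun x => (1 * partial i f x)%:E)
    (fun x => (if `|x| <= L + `|1| then (`|1| * M) else 0)%:E).
  - by move=> k; apply/measurable_EFinP; exact: measurable_diffq.
  - by apply/measurable_EFinP; apply: measurable_funM => //; exact: C1c_measurable_partial.
  - apply: nearW => x _; apply: cvg_EFin; first exact: nearW.
    exact: cvg_diffq.
  - exact: integrable_ball.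
  - apply: nearW => x k _; rewrite lee_fin.
    have [xL|xL] := leP `|x| (L + `|1|); first exact: diffq_le.
    by rewrite (diffq_supported _ _ fL)// normr0.
under eq_integral do rewrite -[X in X%:E]mul1r.
rewrite -(cvg_lim _ cv)// (_ : (fun k => _) = cst 0%E); first exact: lim_cst.
apply/funext => k; rewrite /diffq.
have iS v : mu.-integrable setT (EFin \o (fun x => f (x + v))).
  apply: (@supported_integrable _ (L + `|v|) M') => //.
  - exact: measurable_shift.
  - move=> x xL; apply: fL; have := ler_normB (x + v) v; rewrite addrK; lra.
have iS0 : mu.-integrable setT (EFin \o f) by exact: (supported_integrable mf fL fM').
under eq_integral do rewrite EFinM.
rewrite integralZl//; last first.
  have := integrableB measurableT (iS ((1 / k.+1%:R) *: e_ i)) iS0.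
  exact: eq_integrable.
rewrite (_ : (\int[mu]_x _ = 0)%E) ?mule0//.
under eq_integral do rewrite EFinB.
rewrite integralB//; last exact: iS.
have -> : (\int[mu]_x (f (x + (1 / k.+1%:R) *: e_ i)%R)%:E = \int[mu]_x (f x)%:E)%E.
  set v := _ *: _.
  rewrite [LHS]integralE [RHS]integralE; congr (_ - _)%E.
  transitivity (\int[mu]_x ((fun x => (f x)%:E)^\+%E (x + v)%R))%E.
    by apply: eq_integral => x _; rewrite !funeposE.
  rewrite (ge0_integral_shift v (g := (fun x => (f x)%:E)^\+%E))//.
    by apply: measurable_funepos; apply/measurable_EFinP.
  transitivity (\int[mu]_x ((fun x => (f x)%:E)^\-%E (x + v)%R))%E.
    by apply: eq_integral => x _; rewrite !funenegE.
  rewrite (ge0_integral_shift v (g := (fun x => (f x)%:E)^\-%E))//.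
  by apply: measurable_funeneg; apply/measurable_EFinP.
by rewrite subee// integrable_fin_num.
Qed.

End compact_support_C1.

(** * Averages over dyadic cubes *)

Section cube_averages.
Context (R : realType) (n : nat).
Local Notation V := 'rV[R]_n.
Local Notation mu := (@lebesgue_rV R n).
Implicit Types (f g : V -> R) (x y v : V) (L M K h t : R) (m : nat).
Local Notation "'N_ q [ f ]" := (Lnorm mu q (EFin \o f)).
Local Notation e_ i := (delta_mx ord0 i : V).

(** Reach v by moving along one coordinate after the other. *)
Lemma Lnorm_increment p f v K : 1 <= p -> C1c f -> 0 <= K ->
  (forall i, 'N_p%:E[partial i f] <= K%:E)%E ->
  ('N_p%:E[(fun x => f (x + v) - f x)%R] <= (n%:R * `|v| * K)%:E)%E.
Proof.
move=> p1 Cf K0 fK.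
have mf := C1c_measurable Cf.
have p0 : (0 < p%:E)%E by rewrite lte_fin (lt_le_trans ltr01).
have key (r : seq 'I_n) : ('N_p%:E[(fun x => f (x + \sum_(i <- r) v ord0 i *: e_ i) - f x)%R]
    <= (\sum_(i <- r) `|v ord0 i| * K)%:E)%E.
  elim: r => [|i r IH].
    rewrite !big_nil (_ : EFin \o _ = cst 0%E); last first.
      by apply/funext => x /=; rewrite addr0 subrr.
    by rewrite Lnorm0// gt_eqF.
  rewrite !big_cons; set w := \sum_(j <- r) _ in IH *.
  pose g x := f (x + w) - f x.
  have mg : measurable_fun setT g by apply: measurable_funB => //; exact: measurable_shift.
  have -> : (fun x => f (x + (v ord0 i *: e_ i + w)) - f x) =
      (fun x => g (x + v ord0 i *: e_ i) + (f (x + v ord0 i *: e_ i) - f x)).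
    by apply/funext => x; rewrite /g addrA addrA subrK.
  rewrite addrC; apply: LnormD_le => //.
  - exact: measurable_shift.
  - by apply: measurable_funB => //; exact: measurable_shift.
  - by rewrite (Lnorm_shift _ p0 mg).
  - exact: Lnorm_increment_coord.
have := key (index_enum 'I_n).
rewrite -row_sum_delta => /le_trans; apply; rewrite lee_fin.
apply: (@le_trans _ _ (\sum_(i < n) `|v| * K)).
  by apply: ler_sum => i _; rewrite ler_wpM2r// rV_norm_coord.
by rewrite sumr_const card_ord -[leLHS]mulr_natl mulrA.
Qed.

Definition vol m : R := ((2 ^+ m)^-1) ^+ n.

Lemma vol_gt0 m : 0 < vol m.
Proof. by rewrite exprn_gt0// invr_gt0 exprn_gt0. Qed.

Lemma lebesgue_cell m c : mu (cube m c) = (vol m)%:E.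
Proof. exact: lebesgue_cube. Qed.

Definition avg m f x : R :=
  (vol m)^-1 * fine (\int[mu]_(y in cube m (cell m x)) (f y)%:E)%E.

Lemma avg_cell m f x y : cell m x = cell m y -> avg m f x = avg m f y.
Proof. by rewrite /avg => ->. Qed.

Lemma measurable_avg m f : measurable_fun setT (avg m f).
Proof. by apply: (@measurable_fun_cell _ _ _ _ m); exact: avg_cell. Qed.

Lemma C1c_integrable f : C1c f -> mu.-integrable setT (EFin \o f).
Proof.
move=> Cf; have [M M0 fM] := C1c_bounded Cf; have [L L0 fL] := C1c_supp Cf.
exact: (supported_integrable (C1c_measurable Cf) fL fM).
Qed.

Lemma integrable_cube f m c : C1c f -> mu.-integrable (cube m c) (EFin \o f).
Proof.
move=> Cf; apply: integrableS (C1c_integrable Cf) => //; exact: measurable_cube.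
Qed.

Lemma integrable_cst_cube m c (a : R) : mu.-integrable (cube m c) (cst a%:E).
Proof.
apply/integrableP; split; first exact: measurable_cst.
rewrite /= integral_cst//; last exact: measurable_cube.
by rewrite [X in (_ * X)%E]lebesgue_cell -EFinM ltry.
Qed.

Lemma avgB m f g x : C1c f -> C1c g ->
  avg m (fun y => f y - g y) x = avg m f x - avg m g x.
Proof.
move=> Cf Cg; rewrite /avg -mulrBr; congr (_ * _).
have mc := @measurable_cube R n m (cell m x).
under eq_integral do rewrite EFinB.
have iF := integrable_cube m (cell m x) Cf.
have iG := integrable_cube m (cell m x) Cg.
rewrite integralB// fineB//.
  exact: (integrable_fin_num mc iF).
exact: (integrable_fin_num mc iG).
Qed.

Lemma avg_dist_le m f x : C1c f ->
  (`|f x - avg m f x|%:E <=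
   (vol m)^-1%:E * \int[mu]_(y in cube m (cell m x)) `|f x - f y|%:E)%E.
Proof.
move=> Cf.
have mc := @measurable_cube R n m (cell m x).
have v0 := vol_gt0 m.
have iF := integrable_cube m (cell m x) Cf.
have iC := integrable_cst_cube m (cell m x) (f x).
have iB : mu.-integrable (cube m (cell m x)) (fun y => (f x - f y)%:E).
  apply: (eq_integrable mc ((cst (f x)%:E) \- (EFin \o f))%E) => //.
  by apply: integrableB.
have -> : f x - avg m f x =
    (vol m)^-1 * fine (\int[mu]_(y in cube m (cell m x)) (f x - f y)%:E)%E.
  under eq_integral do rewrite EFinB.
  rewrite integralB//.
  rewrite integral_cst// [X in (_ * X)%E]lebesgue_cell -EFinM.
  rewrite fineB//; last exact: (integrable_fin_num mc iF).
  by rewrite mulrBr /= mulrCA mulVf ?gt_eqF// mulr1.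
have vi0 : 0 <= (vol m)^-1 by rewrite invr_ge0 ltW.
rewrite normrM (ger0_norm vi0) EFinM lee_wpmul2l ?lee_fin//.
apply: le_trans (le_abse_integral mu mc (measurable_int _ iB)).
rewrite -[X in (_ <= `|X|)%E](fineK (integrable_fin_num mc iB)).
by rewrite abse_EFin.
Qed.

(** The Jensen inequality on the cube of x. *)
Lemma avg_dist_powR_le m f x p : 1 <= p -> C1c f ->
  ((`|f x - avg m f x| `^ p)%:E <=
   (vol m)^-1%:E * \int[mu]_(y in cube m (cell m x)) (`|f x - f y| `^ p)%:E)%E.
Proof.
move=> p1 Cf.
have p0 : 0 < p by exact: lt_le_trans p1.
have v0 := vol_gt0 m.
have mf := C1c_measurable Cf.
have h1 := avg_dist_le m x Cf.
have mfx : measurable_fun setT (fun y => f x - f y) by exact: measurable_funB.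
have h2 := jensen_powR p1 (@measurable_cube R n m (cell m x)) v0 (lebesgue_cell _ _) mfx.
have J0 : (0 <= \int[mu]_(y in cube m (cell m x)) `|f x - f y|%:E)%E.
  by apply: integral_ge0 => y _.
have := gt0_ler_poweR (ltW p0) _ _ h1.
rewrite in_itv/= leey lee_fin normr_ge0 in_itv/= leey andbT.
rewrite mule_ge0 ?lee_fin ?invr_ge0 ?(ltW v0)// => /(_ isT isT).
move=> /le_trans; apply.
rewrite poweRM ?lee_fin ?invr_ge0 ?(ltW v0)//.
apply: (le_trans (lee_wpmul2l _ h2)); first by rewrite lee_fin powR_ge0.
rewrite muleA -EFinM -powR_inv1 ?(ltW v0)// -powRrM -powRD; last first.
  by rewrite (gt_eqF v0) implybT.
by rewrite (_ : -1 * p + (p - 1) = -1)//; ring.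
Qed.

(** The factor 2^n compares a cube of side l with the ball of radius l for the sup
    norm, of side 2l. *)
Definition Cavg : R := 2 ^+ n * n%:R.

Lemma Cavg_ge0 : 0 <= Cavg. Proof. by rewrite mulr_ge0. Qed.

Lemma measurable_rV_add :
  measurable_fun setT (fun z : V * V => z.1 + z.2).
Proof.
apply: measurable_fun_rV => i; under eq_fun do rewrite mxE.
by apply: measurable_funD;
  apply: (measurableT_comp (measurable_rV_coord i)).
Qed.

(** The cube of x lies in the sup norm ball of radius 2^-m about x.  By Tonelli,
    the p-th power of the distance is at most the mean, over the vectors h of this
    ball, of the p-th power of the norm of f(. + h) - f, up to the factor 2^n. *)
Lemma Lnorm_avg_dist p f m K : 1 <= p -> C1c f -> 0 <= K ->
  (forall i, 'N_p%:E[partial i f] <= K%:E)%E ->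
  ('N_p%:E[(fun x => f x - avg m f x)%R] <= (Cavg * (2 ^+ m)^-1 * K)%:E)%E.
Proof.
move=> p1 Cf K0 fK.
have p0 : 0 < p by exact: lt_le_trans p1.
have v0 := vol_gt0 m.
have mf := C1c_measurable Cf.
set l := (2 ^+ m)^-1.
have l0 : 0 <= l by rewrite invr_ge0 exprn_ge0.
rewrite Lnorm_leP ?mulr_ge0//.
pose B : set V := [set h | `|h| <= l].
have mB : measurable B by exact: measurable_ball_le.
pose F (z : V * V) : \bar R :=
  (((fun z : V * V => `|f (z.1 + z.2) - f z.1| `^ p) \_ (snd @^-1` B)) z)%:E.
have mF : measurable_fun setT F.
  apply/measurable_EFinP; apply: measurable_patch.
    by apply: measurableT_preimage => //; exact: measurable_snd.
  apply: (@measurableT_comp _ _ _ _ _ _ (@powR R ^~ p)) => //.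
  apply: measurableT_comp => //; apply: measurable_funB.
    exact: (measurableT_comp mf measurable_rV_add).
  exact: (measurableT_comp mf).
have F0 z : (0 <= F z)%E.
  by rewrite lee_fin patchE; case: ifP => // _; exact: powR_ge0.
have mFF : measurable_fun setT (fun x => \int[mu]_y F (x, y))%E.
  exact: (@measurable_fun_fubini_tonelli_F _ _ _ _ _ mu F mF F0).
have mFG : measurable_fun setT (fun y => \int[mu]_x F (x, y))%E.
  exact: (@measurable_fun_fubini_tonelli_G _ _ _ _ _ mu F mF F0).
have FE x y : F (x, y) = ((fun y => (`|f (x + y) - f x| `^ p)%:E) \_ B) y.
  rewrite /F !patchE /=; have [yB|yB] := boolP (y \in B).
    by rewrite mem_set//=; rewrite inE in yB.
  by rewrite memNset//= => ?; move: yB; rewrite notin_setE; apply.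
apply: (@le_trans _ _ (\int[mu]_x ((vol m)^-1%:E * \int[mu]_y F (x, y)))%E).
  apply: ge0_le_integral => //=.
  - apply: measurable_powR_norm; apply: measurable_funB => //; exact: measurable_avg.
  - apply: measurable_funeM.
    exact: mFF.
  - move=> x _; apply: (le_trans (avg_dist_powR_le m x p1 Cf)).
    rewrite lee_wpmul2l ?lee_fin ?invr_ge0 ?(ltW v0)//.
    rewrite integral_mkcond.
    have mfx : measurable_fun setT (fun y => (`|f x - f y| `^ p)%:E : \bar R).
      by apply: measurable_powR_norm; exact: measurable_funB.
    pose G : V -> \bar R := (fun y => (`|f x - f y| `^ p)%:E) \_ [set y | B (y - x)].
    have mBx : measurable [set y | B (y - x)].
      by apply: (measurableT_preimage _ (measurable_rV_shift (- x)) mB).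
    have mG : measurable_fun setT G.
      by apply/(measurable_restrictT _ _).1 => //; exact: measurable_funTS.
    have G0 y : (0 <= G y)%E.
      by rewrite /G patchE; case: ifP => // _; rewrite lee_fin powR_ge0.
    apply: (@le_trans _ _ (\int[mu]_y G y)%E).
      apply: ge0_le_integral => //=.
      - by move=> y _; rewrite patchE; case: ifP => // _; rewrite lee_fin powR_ge0.
      - by apply/(measurable_restrictT _ _).1 => //; [exact: measurable_cube|exact: measurable_funTS].
      - move=> y _; rewrite /G !patchE.
        have [yc|yc] := boolP (y \in cube m (cell m x)); last first.
          by case: ifP => // _; rewrite lee_fin powR_ge0.
        rewrite inE in yc; rewrite mem_set//= /B /=; exact: cell_dist.
    rewrite -(ge0_integral_shift x mG G0).
    rewrite le_eqVlt; apply/orP; left; apply/eqP; apply: eq_integral => y _.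
    rewrite FE /G !patchE /=.
    have -> : (y + x \in [set y0 | B (y0 - x)]) = (y \in B).
      by rewrite /in_mem /= /mem_set; apply/idP/idP; rewrite !inE /= addrK.
    by case: ifP => // _; rewrite distrC (addrC y).
rewrite ge0_integralZl//=; [|by move=> x _; exact: integral_ge0|
  by rewrite lee_fin invr_ge0 ltW].
rewrite (@fubini_tonelli _ _ _ _ _ mu mu F mF F0).
apply: (@le_trans _ _ ((vol m)^-1%:E *
  \int[mu]_y ((cst ((n%:R * l * K) `^ p)%:E) \_ B) y)%E).
  rewrite lee_wpmul2l ?lee_fin ?invr_ge0 ?(ltW v0)//.
  apply: ge0_le_integral => //=.
  - by move=> y _; exact: integral_ge0.
  - by apply/(measurable_restrictT _ _).1.
  - move=> y _; rewrite patchE; have [yB|yB] := boolP (y \in B); last first.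
      under eq_integral => x _ do rewrite FE patchE (negbTE yB).
      by rewrite integral0.
    under eq_integral => x _ do rewrite FE patchE yB.
    rewrite /= -Lnorm_leP ?mulr_ge0//.
    apply: (le_trans (Lnorm_increment y p1 Cf K0 fK)).
    rewrite lee_fin ler_wpM2r// ler_wpM2l//.
    by rewrite inE in yB.
have -> : (\int[mu]_y ((cst ((n%:R * l * K) `^ p)%:E) \_ B) y =
    ((n%:R * l * K) `^ p)%:E * ((l *+ 2) ^+ n)%:E)%E.
  by rewrite -integral_mkcond integral_cst//; congr (_ * _)%E; exact: lebesgue_ball.
rewrite -!EFinM lee_fin /Cavg.
have -> : (vol m)^-1 * ((n%:R * l * K) `^ p * (l *+ 2) ^+ n) = 2 ^+ n * (n%:R * l * K) `^ p.
  rewrite -[l *+ 2]mulr_natr exprMn /vol -/l.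
  have [l_0|l_0] := eqVneq l 0.
    by move: l_0; rewrite /l => /eqP; rewrite invr_eq0 expf_eq0 andbC pnatr_eq0.
  rewrite mulrCA (mulrA (_ ^- n)) mulVf ?mul1r 1?mulrC// expf_neq0//.
have -> : 2 ^+ n * n%:R * l * K = 2 ^+ n * (n%:R * l * K) by ring.
rewrite [in leRHS]powRM ?exprn_ge0 ?mulr_ge0// ler_wpM2r ?powR_ge0//.
by rewrite le1r_powR// exprn_ege1// ler1n.
Qed.

(** Dyadic cubes are nested. *)
Lemma avg_step m f x y : cell m.+1 x = cell m.+1 y -> avg m f x = avg m f y.
Proof.
move=> xy; apply: avg_cell; apply/rowP => i; rewrite !mxE.
have := congr1 (fun c : 'rV[int]_n => c ord0 i) xy; rewrite !mxE.
set a := x ord0 i; set b := y ord0 i; rewrite !exprS -!mulrA => ab.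
apply/esym/floor_def.
have /andP[a1 a2] := floor_itv (2 ^+ m * a).
have h1 : Num.floor (2 ^+ m * a) * 2 <= Num.floor (2 * (2 ^+ m * b)).
  rewrite -ab floor_ge_int intrM; lra.
have h2 : Num.floor (2 * (2 ^+ m * b)) < (Num.floor (2 ^+ m * a) + 1) * 2.
  rewrite -ab floor_lt_int intrM; lra.
move: h1 h2; rewrite floor_ge_int floor_lt_int !intrM => h1 h2.
apply/andP; split; lra.
Qed.

(** A value taken at x is taken on the whole cube of x, of measure [vol m]. *)
Lemma step_sup p g m K : 0 < p -> 0 <= K ->
  (forall x y, cell m x = cell m y -> g x = g y) ->
  ('N_p%:E[g] <= K%:E)%E -> forall x, `|g x| <= ((vol m)^-1 `^ p^-1) * K.
Proof.
move=> p0 K0 gc gK x.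
have v0 := vol_gt0 m.
have mg : measurable_fun setT g by exact: (measurable_fun_cell gc).
move: gK; rewrite Lnorm_leP// => gK.
have mc := @measurable_cube R n m (cell m x).
have : ((`|g x| `^ p * vol m)%:E <= (K `^ p)%:E)%E.
  apply: le_trans gK.
  rewrite EFinM -(lebesgue_cell m (cell m x)) -integral_cst//.
  rewrite [leLHS]integral_mkcond.
  apply: ge0_le_integral => //=.
  - by move=> y _; rewrite patchE; case: ifP => // _; rewrite lee_fin powR_ge0.
  - by apply/(measurable_restrictT _ _).1.
  - exact: measurable_powR_norm.
  - move=> y _; rewrite patchE; case: ifPn => [|_]; last by rewrite lee_fin powR_ge0.
    by rewrite inE => yc; rewrite (gc _ _ yc).
rewrite lee_fin -ler_pdivlMr// mulrC => h.
have := ge0_ler_powR (r := p^-1) _ _ _ h.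
rewrite !nnegrE !mulr_ge0 ?powR_ge0 ?invr_ge0 ?(ltW p0) ?(ltW v0)// => /(_ isT isT isT).
by rewrite -powRrM mulfV ?gt_eqF// powRr1// powRM ?powR_ge0 ?invr_ge0 ?(ltW v0)// -powRrM mulfV ?gt_eqF// powRr1.
Qed.

(** A reverse inequality between L^p and L^q for functions constant on cubes:
    combine [step_sup] with [Lnorm_interp]. *)
Lemma step_Lnorm p q g m K : 1 <= p -> (p%:E < q)%E -> 0 <= K ->
  (forall x y, cell m x = cell m y -> g x = g y) ->
  ('N_p%:E[g] <= K%:E)%E ->
  ('N_q[g] <= ((vol m)^-1 `^ (p^-1 - einv q) * K)%:E)%E.
Proof.
move=> p1 pq K0 gc gK.
have p0 : 0 < p by exact: lt_le_trans p1.
have v0 := vol_gt0 m.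
have c0 : 0 <= (vol m)^-1 by rewrite invr_ge0 ltW.
have mg : measurable_fun setT g by exact: (measurable_fun_cell gc).
have sup := step_sup p0 K0 gc gK.
have := Lnorm_interp p0 pq _ K0 mg sup gK.
rewrite mulr_ge0 ?powR_ge0// => /(_ isT).
have e1 : p^-1 * (1 - p * einv q) = p^-1 - einv q by field; rewrite gt_eqF.
rewrite powRM ?powR_ge0// -mulrA -powRrM e1.
move=> /le_trans; apply; rewrite lee_fin ler_wpM2l ?powR_ge0//.
rewrite -powRD; first by rewrite subrK powRr1.
by rewrite subrK oner_eq0.
Qed.

Lemma avg_cvg f x : C1c f -> avg m f x @[m --> \oo] --> f x.
Proof.
move=> Cf; apply/cvgrPdist_le => e e0.
have := @C1c_cont _ _ _ Cf x => /cvgrPdist_le/(_ e e0) /nbhs_ballP[d/= d0 hd].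
have : \forall m \near \oo, (2 ^+ m)^-1 < d.
  move/cvgrPdist_lt : (@cvg_exp2V R) => /(_ d d0); apply: filterS => m.
  by rewrite sub0r normrN ger0_norm// invr_ge0 exprn_ge0.
apply: filterS => m md.
have v0 := vol_gt0 m.
rewrite -lee_fin; apply: (le_trans (avg_dist_le m x Cf)).
have mc := @measurable_cube R n m (cell m x).
apply: (@le_trans _ _ ((vol m)^-1%:E * (e%:E * (vol m)%:E))%E); last first.
  by rewrite -!EFinM mulrCA mulVf ?gt_eqF// mulr1.
rewrite lee_wpmul2l ?lee_fin ?invr_ge0 ?(ltW v0)//.
rewrite -(lebesgue_cell m (cell m x)) -integral_cst//.
have mfx : measurable_fun setT (fun y => `|f x - f y|%:E : \bar R).
  apply/measurable_EFinP; apply: measurableT_comp => //; apply: measurable_funB => //.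
  exact: C1c_measurable.
apply: ge0_le_integral => //=.
- exact: measurable_funTS.
- move=> y yc; rewrite lee_fin; apply: hd.
  rewrite -ball_normE /=; apply: le_lt_trans md; apply: cell_dist.
  by rewrite yc.
Qed.

End cube_averages.

(** * Sobolev and Poincare inequalities *)

Section sobolev_inequality.
Context (R : realType) (n : nat).
Local Notation V := 'rV[R]_n.
Local Notation mu := (@lebesgue_rV R n).
Implicit Types (f g : V -> R) (x y v : V) (L M K h t : R) (m : nat).
Local Notation "'N_ q [ f ]" := (Lnorm mu q (EFin \o f)).
Local Notation e_ i := (delta_mx ord0 i : V).

Lemma volV_powR m (e : R) : (vol R n m)^-1 `^ e = (2 `^ (n%:R * e)) ^+ m.
Proof.
rewrite /vol exprVn invrK -exprM -powR_mulrn// -powRrM.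
by rewrite -powR_mulrn ?powR_ge0// -powRrM natrM; congr (_ `^ _); ring.
Qed.

Lemma Lnorm_avg_le p f m A K : 1 <= p -> C1c f -> 0 <= K ->
  ('N_p%:E[f] <= A%:E)%E ->
  (forall i, 'N_p%:E[partial i f] <= K%:E)%E ->
  ('N_p%:E[avg m f] <= (A + Cavg R n * (2 ^+ m)^-1 * K)%:E)%E.
Proof.
move=> p1 Cf K0 fA fK.
have -> : avg m f = (fun x => f x - (f x - avg m f x)).
  by apply/funext => x; rewrite subKr.
have mf := C1c_measurable Cf.
apply: LnormB_le => //; last exact: Lnorm_avg_dist.
by apply: measurable_funB => //; exact: measurable_avg.
Qed.

Lemma geometric_sum_le (r : R) k : 0 <= r -> r < 1 ->
  \sum_(i < k) r ^+ i <= (1 - r)^-1.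
Proof.
move=> r0 r1; have r1' : 0 < 1 - r by rewrite subr_gt0.
rewrite -[leRHS]mul1r ler_pdivlMr// mulrC -opprB mulNr -subrX1 opprB.
by rewrite gerBl exprn_ge0.
Qed.

(** The difference of the averages at scales j and j+1 has norm of order 2^-j K in
    L^p and is constant on cubes of side 2^-(j+1), so by [step_Lnorm] its norm in
    L^q is of order (2^{n(1/p - 1/q)} / 2)^j K: the condition on the exponents is
    the convergence of this geometric series. *)
Lemma avg_sobolev p q : 1 <= p -> (p%:E < q)%E ->
  n%:R * (p^-1 - einv q) < 1 ->
  exists C rho : R, [/\ 0 <= C, 0 <= rho, rho < 1 &
    forall f K m, C1c f -> 0 <= K ->
      (forall i, 'N_p%:E[partial i f] <= K%:E)%E ->
      ('N_q[(fun x => f x - avg m f x)%R] <= (C * rho ^+ m * K)%:E)%E].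
Proof.
move=> p1 pq th.
have p0 : 0 < p by exact: lt_le_trans p1.
have q1 : (1 <= q)%E by apply: (le_trans _ (ltW pq)).
have q0 : (0 < q)%E by exact: lt_le_trans q1.
pose a : R := 2 `^ (n%:R * (p^-1 - einv q)).
have a0 : 0 <= a by exact: powR_ge0.
pose rho := a / 2.
have rho0 : 0 <= rho by rewrite divr_ge0.
have rho1 : rho < 1.
  rewrite ltr_pdivrMr// mul1r /a -ltr_ln ?posrE ?powR_gt0// ln_powR.
  by rewrite gtr_pMl// ln_gt0// ltr1n.
pose C0 := 3 * Cavg R n.
have C00 : 0 <= C0 by rewrite mulr_ge0 ?Cavg_ge0.
exists (C0 * rho / (1 - rho)), rho; split => //.
  by rewrite !mulr_ge0// invr_ge0 subr_ge0 ltW.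
move=> f K m Cf K0 fK.
have mf := C1c_measurable Cf.
have ma j : measurable_fun setT (avg j f) by exact: measurable_avg.
have step j : ('N_q[(fun x => avg j.+1 f x - avg j f x)%R] <=
    (C0 * K * rho ^+ j.+1)%:E)%E.
  have K'0 : 0 <= C0 * (2 ^+ j.+1)^-1 * K by rewrite !mulr_ge0// invr_ge0 exprn_ge0.
  apply: (@le_trans _ _ (((vol R n j.+1)^-1 `^ (p^-1 - einv q) * (C0 * (2 ^+ j.+1)^-1 * K))%:E)).
    apply: (step_Lnorm (m := j.+1) p1 pq K'0).
      by move=> x y xy; rewrite (avg_cell f xy) (avg_step f xy).
    have -> : (fun x => avg j.+1 f x - avg j f x) =
        (fun x => (f x - avg j f x) - (f x - avg j.+1 f x)).
      by apply/funext => x; ring.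
    have -> : C0 * (2 ^+ j.+1)^-1 * K =
        Cavg R n * (2 ^+ j)^-1 * K + Cavg R n * (2 ^+ j.+1)^-1 * K.
      by rewrite /C0 exprS invfM; field; rewrite expf_neq0.
    by apply: LnormB_le => //; [exact: measurable_funB|exact: measurable_funB|
      exact: Lnorm_avg_dist|exact: Lnorm_avg_dist].
  rewrite volV_powR -/a lee_fin /rho expr_div_n le_eqVlt; apply/orP; left; apply/eqP.
  by ring.
have tele k : ('N_q[(fun x => avg (m + k) f x - avg m f x)%R] <=
    (\sum_(i < k) C0 * K * rho ^+ (m + i).+1)%:E)%E.
  elim: k => [|k IH].
    rewrite big_ord0 addn0 (_ : EFin \o _ = cst 0%E); last first.
      by apply/funext => x /=; rewrite subrr.
    by rewrite Lnorm0// gt_eqF.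
  rewrite big_ord_recr/= addnS.
  have -> : (fun x => avg (m + k).+1 f x - avg m f x) =
     (fun x => (avg (m + k) f x - avg m f x) + (avg (m + k).+1 f x - avg (m + k) f x)).
    by apply/funext => x; ring.
  by apply: LnormD_le => //; exact: measurable_funB.
have tele2 k : ('N_q[(fun x => avg (m + k) f x - avg m f x)%R] <=
    (C0 * rho / (1 - rho) * rho ^+ m * K)%:E)%E.
  apply: (le_trans (tele k)); rewrite lee_fin.
  under eq_bigr do rewrite -addSn exprD mulrA.
  rewrite -mulr_sumr.
  apply: (le_trans (ler_wpM2l _ (geometric_sum_le k rho0 rho1))).
    by rewrite !mulr_ge0// exprn_ge0.
  rewrite exprS le_eqVlt; apply/orP; left; apply/eqP; ring.
apply: (@Lnorm_fatou _ _ _ mu q (fun k x => avg (m + k) f x - avg m f x)) => //.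
- by rewrite !mulr_ge0// ?exprn_ge0// invr_ge0 subr_ge0 ltW.
- by move=> k; exact: measurable_funB.
- apply: nearW => x; apply: cvgB; last exact: cvg_cst.
  under eq_fun do rewrite addnC.
  have := @avg_cvg _ _ f x Cf.
  by rewrite -(cvg_shiftn m).
- exact: measurable_funB.
- exact: nearW.
Qed.

(** A translation by more than the width 2L of the support in direction i makes the
    supports of f and of its translate disjoint, so |f| is bounded by the
    increment. *)
Lemma poincare p f i L K : 1 <= p -> C1c f -> 0 <= L -> 0 <= K ->
  (forall x, f x != 0 -> `|x ord0 i| <= L) ->
  ('N_p%:E[partial i f] <= K%:E)%E ->
  ('N_p%:E[f] <= ((2 * L + 1) * K)%:E)%E.
Proof.
move=> p1 Cf L0 K0 fL fK.
have mf := C1c_measurable Cf.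
(* Strictly more than 2L, so that f x and f (x + h e_i) never both differ from 0. *)
pose h := 2 * L + 1.
have h0 : 0 <= h by rewrite /h; lra.
apply: le_trans (_ : 'N_p%:E[(fun x => f (x + h *: e_ i) - f x)%R] <= _)%E.
  apply: le_Lnorm => //.
  - by rewrite lte_fin (lt_le_trans ltr01).
  - by apply: measurable_funB => //; exact: measurable_shift.
  move=> x; have [->|fx] := eqVneq (f x) 0; first by rewrite normr0.
  have [fy|fy] := eqVneq (f (x + h *: e_ i)) 0.
    by rewrite fy sub0r normrN.
  have := fL _ fx; have := fL _ fy; rewrite !mxE !eqxx mulr1 /h !ler_norml.
  move=> /andP[a1 a2] /andP[b1 b2]; exfalso; lra.
apply: (le_trans (Lnorm_increment_coord h p1 Cf K0 fK)).
by rewrite ger0_norm.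
Qed.

(** [int_le_Lnorm] on the cube of x, read from right to left. *)
Lemma avg_lower q f m x c : (1 <= q)%E -> C1c f -> 0 <= c -> c <= `|avg m f x| ->
  (((vol R n m) * (vol R n m) `^ (einv q - 1) * c)%:E <=
   'N_q[f \_ (cube m (cell m x))])%E.
Proof.
move=> q1 Cf c0 cf.
have v0 := vol_gt0 R n m.
have mf := C1c_measurable Cf.
have mc := @measurable_cube R n m (cell m x).
set N := 'N_q[_].
have [Noo|] := eqVneq N +oo%E; first by rewrite Noo leey.
rewrite -ltey -ge0_fin_numE ?Lnorm_ge0// => Nfin.
have N0 : 0 <= fine N by rewrite fine_ge0// Lnorm_ge0.
have Nle : (N <= (fine N)%:E)%E by rewrite fineK.
have h1 := int_le_Lnorm q1 mc v0 (lebesgue_cell R m (cell m x)) N0 mf Nle.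
have iF := integrable_cube m (cell m x) Cf.
have h2 : ((c * vol R n m)%:E <= (fine N * (vol R n m) `^ (1 - einv q))%:E)%E.
  apply: le_trans h1; apply: le_trans (le_abse_integral mu mc (measurable_int _ iF)).
  rewrite -[X in (_ <= `|X|)%E](fineK (integrable_fin_num mc iF)) abse_EFin lee_fin.
  move: cf; rewrite /avg normrM ger0_norm ?invr_ge0 ?(ltW v0)//.
  by rewrite mulrC ler_pdivlMr.
rewrite -(fineK Nfin) lee_fin; move: h2; rewrite lee_fin.
rewrite -ler_pdivrMr ?powR_gt0//; apply: le_trans.
rewrite -powRN opprB le_eqVlt; apply/orP; left; apply/eqP; ring.
Qed.

End sobolev_inequality.

(** * Smooth cutoff functions *)

Section flat_functions.
Context (R : realType).
Implicit Types (t : R) (k : nat).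

(** The functions t^-k exp(-1/t), extended by 0 to t <= 0.  The whole family is
    needed because it is stable under differentiation, up to linear combinations:
    see [is_derive_flat]. *)
Definition flat k t : R := if 0 < t then t^-1 ^+ k * expR (- t^-1) else 0.

Lemma flat_le0 k t : t <= 0 -> flat k t = 0.
Proof. by rewrite /flat ltNge => ->. Qed.

Lemma flat_ge0 k t : 0 <= flat k t.
Proof.
rewrite /flat; case: ifPn => // t0.
by rewrite mulr_ge0 ?expR_ge0// exprn_ge0// invr_ge0 ltW.
Qed.

Lemma flat_gt0 k t : 0 < t -> 0 < flat k t.
Proof. by move=> t0; rewrite /flat t0 mulr_gt0 ?expR_gt0// exprn_gt0// invr_gt0. Qed.

Lemma expr_expRN_le k (y : R) : 0 <= y -> y ^+ k * expR (- y) <= k`!%:R.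
Proof.
move=> y0; rewrite expRN ler_pdivrMr ?expR_gt0//.
case: k => [|k]; first by rewrite expr0 fact0 mul1r -expR0 ler_expR.
have := expR_ge1Dxn k y0; rewrite -ler_pdivrMl ?ltr0n ?fact_gt0// mulrC; lra.
Qed.

Lemma flat_le k t : flat k t <= k`!%:R.
Proof.
rewrite /flat; case: ifPn => [t0|_]; last by rewrite ler0n.
by apply: expr_expRN_le; rewrite invr_ge0 ltW.
Qed.

Lemma flat_le_sqr k t : `|flat k t| <= (k.+2)`!%:R * t ^+ 2.
Proof.
rewrite ger0_norm ?flat_ge0// /flat; case: ifPn => [t0|_].
  have -> : t^-1 ^+ k * expR (- t^-1) = t^-1 ^+ k.+2 * expR (- t^-1) * t ^+ 2.
    transitivity (t^-1 ^+ k * expR (- t^-1) * (t^-1 * t) ^+ 2).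
      by rewrite mulVf ?gt_eqF// expr1n mulr1.
    by rewrite !exprS expr0; ring.
  rewrite ler_wpM2r ?sqr_ge0//; apply: expr_expRN_le.
  by rewrite invr_ge0 ltW.
by rewrite mulr_ge0 ?sqr_ge0.
Qed.

(** At 0 the quadratic bound [flat_le_sqr] gives the derivative 0. *)
Lemma is_derive_flat k t :
  is_derive t 1 (flat k) (flat k.+2 t - k%:R * flat k.+1 t).
Proof.
have [t0|t0|t0] := ltgtP t 0.
- rewrite !flat_le0 ?(ltW t0)// mulr0 subr0.
  apply: (@near_eq_is_derive _ _ _ (cst 0)).
  have : \forall s \near t, s < 0 by exact: lt_nbhsl.
  by apply: filterS => s s0; rewrite flat_le0 ?ltW.
-   have dV : is_derive t 1 (fun s : R => s^-1) (- t ^- 2).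
    have := @is_deriveV R id t 1 1 _ _; rewrite gt_eqF// => /(_ isT (is_derive_id _ _)).
    by rewrite /GRing.scale /= mulr1.
  have dN : is_derive t 1 (fun s : R => - s^-1) (t ^- 2).
    by rewrite -[t ^- 2]opprK; exact: is_deriveN.
  have dE : is_derive t 1 (fun s : R => expR (- s^-1)) (expR (- t^-1) * t ^- 2).
    exact: (is_derive1_comp (is_derive_expR _) dN).
  have near0 : \forall s \near t, s^-1 ^+ k * expR (- s^-1) = flat k s.
    have : \forall s \near t, 0 < s by exact: lt_nbhsr.
    by apply: filterS => s s0; rewrite /flat s0.
  apply: (near_eq_is_derive near0) => {near0}.
  case: k => [|k].
    have E : (fun s : R => s^-1 ^+ 0 * expR (- s^-1)) = (fun s => expR (- s^-1)).
      by apply/funext => s; rewrite expr0 mul1r.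
    by rewrite E mul0r subr0 /flat t0 exprVn mulrC.
  have dX := is_deriveX k.+1 dV.
  rewrite exprfctE in dX.
  have dM : is_derive t 1 (fun s => s^-1 ^+ k.+1 * expR (- s^-1)) _ := is_deriveM dX dE.
  apply: (@is_derive_eq _ _ _ _ _ _ _ _ dM).
  rewrite /flat t0 /GRing.scale /= !exprVn !exprS; field.
  by rewrite expf_neq0 ?gt_eqF.
rewrite t0 !flat_le0// mulr0 subr0.
have cv : h^-1 *: ((flat k \o shift 0) (h *: 1) - flat k 0) @[h --> (0 : R)^'] --> (0 : R).
  apply/cvgr0Pnorm_le => e e0.
  have c0 : 0 < (k.+2)`!%:R :> R by rewrite ltr0n fact_gt0.
  have : \forall h \near (0 : R)^', `|h| <= e / (k.+2)`!%:R.
    apply: dnbhs0_le; exact: divr_gt0.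
  have : \forall h \near (0 : R)^', h != 0 by exact: nbhs_dnbhs_neq.
  apply: filterS2 => h h0 he /=.
  rewrite addr0 [h *: 1]mulr1 (flat_le0 _ (lexx 0)) subr0 normrZ normfV.
  rewrite ler_pdivrMl ?normr_gt0//.
  apply: (le_trans (flat_le_sqr _ _)).
  rewrite -real_normK ?num_real// expr2 mulrCA ler_wpM2l//.
  by rewrite mulrC -ler_pdivlMr.
apply: DeriveDef; first by apply/cvg_ex; exists 0.
exact/cvg_lim.
Qed.

Lemma continuous_flat k : continuous (flat k).
Proof.
move=> t; apply/differentiable_continuous/derivable1_diffP.
by have [] := is_derive_flat k t.
Qed.

End flat_functions.

Section smooth_functions.
Context (R : realType) (n : nat).
Local Notation V := 'rV[R]_n.
Implicit Types (f g : V -> R) (x y v : V) (k N : nat) (t s sg : R).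
Local Notation e_ i := (delta_mx ord0 i : V).

(** Smoothness is stated with iterated partial derivatives in any order; the
    recursive form allows proofs by induction on the order of differentiation. *)
Fixpoint Ck k f : Prop := continuous f /\
  match k with
  | 0 => True
  | k'.+1 => forall i, (forall x, derivable f x (e_ i)) /\ Ck k' (partial i f)
  end.

Lemma Ck_continuous k f : Ck k f -> continuous f.
Proof. by case: k => [|k] []. Qed.

Lemma CkS k f : Ck k.+1 f -> Ck k f.
Proof.
elim: k f => [|k IH] f; first by case.
move=> [cf h]; split => // i; have [df Cf] := h i; split => //; exact: IH.
Qed.

Lemma smoothP f : smooth f <-> forall k, Ck k f.
Proof.
split=> [sf k|Cf s].
  elim: k f sf => [|k IH] f sf; first by split => //; have [] := sf [::].
  split; first by have [] := sf [::].
  move=> i; split; first by move=> x; have [_] := sf [::]; exact.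
  by apply: IH => s; have := sf (rcons s i); rewrite foldr_rcons.
suff H : forall k, Ck k (foldr (@partial R n) f s).
  split; first exact: (Ck_continuous (H 0%N)).
  by move=> x i; have [_ /(_ i) []] := H 1%N.
elim/last_ind: s f Cf => [|s i IH] f Cf //.
rewrite foldr_rcons; apply: IH => k.
by have [_ /(_ i) []] := Cf k.+1.
Qed.

Lemma Ck_intro k f (df : 'I_n -> V -> R) : continuous f ->
  (forall i x, is_derive x (e_ i) f (df i x)) -> (forall i, Ck k (df i)) ->
  Ck k.+1 f.
Proof.
move=> cf dfE Cdf; split => // i; split=> [x|]; first by have [] := dfE i x.
rewrite (_ : partial i f = df i); first exact: Cdf.
by apply/funext => x; rewrite /partial; have [_ ->] := dfE i x.
Qed.

Lemma Ck_is_derive k f i x : Ck k.+1 f -> is_derive x (e_ i) f (partial i f x).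
Proof. by move=> [_ /(_ i) [df _]]; exact: derivableP. Qed.

Lemma Ck_partial k f i : Ck k.+1 f -> Ck k (partial i f).
Proof. by move=> [_ /(_ i) []]. Qed.

Lemma Ck_cst k (a : R) : Ck k (fun=> a).
Proof.
elim: k a => [|k IH] a; first by split => //; exact: cst_continuous.
apply: (@Ck_intro _ _ (fun _ _ => 0)) => [|i]; first exact: cst_continuous.
exact: IH.
Qed.

Lemma Ck_add k f g : Ck k f -> Ck k g -> Ck k (fun x => f x + g x).
Proof.
elim: k f g => [|k IH] f g Cf Cg.
  by split => // x; apply: continuousD; [exact: (Ck_continuous Cf)|exact: (Ck_continuous Cg)].
apply: (@Ck_intro _ _ (fun i x => partial i f x + partial i g x)).
- by move=> x; apply: continuousD; [exact: (Ck_continuous Cf)|exact: (Ck_continuous Cg)].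
- by move=> i x; apply: (is_deriveD (Ck_is_derive i x Cf) (Ck_is_derive i x Cg)).
- by move=> i; apply: IH; [exact: (Ck_partial i Cf)|exact: (Ck_partial i Cg)].
Qed.

Lemma Ck_mul k f g : Ck k f -> Ck k g -> Ck k (fun x => f x * g x).
Proof.
elim: k f g => [|k IH] f g Cf Cg.
  by split => // x; apply: continuousM; [exact: (Ck_continuous Cf)|exact: (Ck_continuous Cg)].
apply: (@Ck_intro _ _ (fun i x => f x * partial i g x + g x * partial i f x)).
- by move=> x; apply: continuousM; [exact: (Ck_continuous Cf)|exact: (Ck_continuous Cg)].
- by move=> i x; apply: (is_deriveM (Ck_is_derive i x Cf) (Ck_is_derive i x Cg)).
- move=> i; apply: Ck_add; apply: IH.
  + exact: CkS.
  + exact: (Ck_partial i Cg).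
  + exact: CkS.
  + exact: (Ck_partial i Cf).
Qed.

Lemma Ck_prod k (I : Type) (r : seq I) (F : I -> V -> R) :
  (forall i, Ck k (F i)) -> Ck k (fun x => \prod_(i <- r) F i x).
Proof.
move=> CF; elim: r => [|i r IH].
  rewrite (_ : (fun x => _) = fun=> 1); first exact: Ck_cst.
  by apply/funext => x; rewrite big_nil.
rewrite (_ : (fun x => _) = fun x => F i x * \prod_(j <- r) F j x); first exact: Ck_mul.
by apply/funext => x; rewrite big_cons.
Qed.

(** The derivative -f^-2 df of f^-1 involves f^-1 itself, only to the order that the
    induction hypothesis covers. *)
Lemma Ck_inv k f : (forall x, f x != 0) -> Ck k f -> Ck k (fun x => (f x)^-1).
Proof.
move=> f0; elim: k => [|k IH] Cf.
  by split => // x; apply: continuousV; [exact: f0|exact: (Ck_continuous Cf)].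
have CV := IH (CkS Cf).
apply: (@Ck_intro _ _ (fun i x => -1 * ((f x)^-1 * (f x)^-1 * partial i f x))).
- by move=> x; apply: continuousV; [exact: f0|exact: (Ck_continuous Cf)].
- move=> i x; have dfx := Ck_is_derive i x Cf.
  apply: DeriveDef; first by apply: derivableV; [exact: f0|case: dfx].
  rewrite deriveV; [|exact: f0|by case: dfx].
  by rewrite mulN1r /GRing.scale /= mulNr expr2 invfM; have [_ ->] := dfx.
- move=> i; apply: Ck_mul; first exact: Ck_cst.
  by apply: Ck_mul; [exact: Ck_mul|exact: (Ck_partial i Cf)].
Qed.

Lemma is_derive_comp_affine (h : R -> R) (dh c : R) (l : V -> R) x v :
  (forall s : R, l (s *: v + x) = s * c + l x) ->
  is_derive (l x) 1 h dh -> is_derive x v (fun y => h (l y)) (c * dh).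
Proof.
move=> lE hd.
have d1 : is_derive (0 : R) 1 (fun s : R => h (s * c + l x)) (dh * c).
  apply: is_derive1_comp; first by rewrite mul0r add0r.
  have dl : is_derive (0 : R) 1 (fun s : R => s * c + l x) (1 * c + 0).
    apply: is_deriveD.
    have dm : is_derive (0 : R) 1 (fun s : R => s * c) _ :=
      is_deriveM (is_derive_id (0 : R) (1 : R)) (is_derive_cst c (0 : R) (1 : R)).
    apply: (@is_derive_eq _ _ _ _ _ _ _ _ dm).
    by rewrite scaler0 add0r /GRing.scale /= mulrC.
  by rewrite mul1r addr0 in dl.
have E : (fun s : R => s^-1 *: (((fun y => h (l y)) \o shift x) (s *: v) - h (l x))) =
  (fun s : R => s^-1 *: (((fun s : R => h (s * c + l x)) \o shift (0 : R)) (s *: 1) -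
     h (0 * c + l x))).
  apply/funext => s /=; rewrite lE mul0r add0r addr0.
  by rewrite [s *: 1]mulr1.
case: d1 => d1 d2; apply: DeriveDef; rewrite /derivable /derive E//.
by rewrite (mulrC c); exact: d2.
Qed.

(** With sg = 1 or sg = -1 this is a coordinate read from the left or from the
    right, so that each cutoff is defined once. *)
Definition ramp (sg s : R) (i : 'I_n) x : R := sg * x ord0 i - s.

Lemma continuous_ramp sg s i : continuous (ramp sg s i).
Proof.
move=> x; apply: (@continuousB _ _ _ (fun x : V => sg * x ord0 i) (cst s)); last exact: cst_continuous.
apply: (@continuousM _ _ (cst sg) (fun x : V => x ord0 i)); first exact: cst_continuous.
exact: coord_continuous.
Qed.

Lemma is_derive_ramp_comp (h : R -> R) (dh sg s : R) i j x :
  is_derive (ramp sg s i x) 1 h dh ->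
  is_derive x (e_ j) (fun y => h (ramp sg s i y)) ((i == j)%:R * sg * dh).
Proof.
apply: is_derive_comp_affine => t.
by rewrite /ramp !mxE eqxx /=; ring.
Qed.

Lemma Ck_flat N k sg s i : Ck N (fun x => flat k (ramp sg s i x)).
Proof.
elim: N k => [|N IH] k.
  split => // x; exact: (@continuous_comp _ _ _ (ramp sg s i) (flat k) x (@continuous_ramp sg s i x) (@continuous_flat R k _)).
apply: (@Ck_intro _ _ (fun j x => (i == j)%:R * sg *
   (flat k.+2 (ramp sg s i x) + (- k%:R) * flat k.+1 (ramp sg s i x)))).
- move=> x; exact: (@continuous_comp _ _ _ (ramp sg s i) (flat k) x (@continuous_ramp sg s i x) (@continuous_flat R k _)).
- by move=> j x; apply: is_derive_ramp_comp; rewrite mulNr; exact: is_derive_flat.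
- move=> j; apply: Ck_mul; first exact: Ck_cst.
  by apply: Ck_add => //; apply: Ck_mul => //; exact: Ck_cst.
Qed.

(** The standard smooth step from 0 at t <= 0 to 1 at t >= 1. *)
Definition step1 (t : R) : R := flat 0 t / (flat 0 t + flat 0 (1 - t)).

(** One of t and 1 - t is at least 1/2. *)
Lemma step1_den_ge t : expR (- 2) <= flat 0 t + flat 0 (1 - t).
Proof.
have key (u : R) : 2^-1 <= u -> expR (- 2) <= flat 0 u.
  move=> hu; have u0 : 0 < u by lra.
  rewrite /flat u0 expr0 mul1r ler_expR lerN2.
  by rewrite -[leRHS]invrK lef_pV2 ?posrE// invr_gt0.
have [h|h] := leP 2^-1 t.
  by rewrite (le_trans (key _ h))// lerDl flat_ge0.
have h' : 2^-1 <= 1 - t by lra.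
by rewrite (le_trans (key _ h'))// lerDr flat_ge0.
Qed.

Lemma step1_den_gt0 t : 0 < flat 0 t + flat 0 (1 - t).
Proof. by apply: lt_le_trans (step1_den_ge t); exact: expR_gt0. Qed.

Lemma step1_ge0 t : 0 <= step1 t.
Proof. by rewrite divr_ge0 ?flat_ge0// ltW// step1_den_gt0. Qed.

Lemma step1_le1 t : step1 t <= 1.
Proof. by rewrite ler_pdivrMr ?step1_den_gt0// mul1r lerDl flat_ge0. Qed.

Lemma step1_le0 t : t <= 0 -> step1 t = 0.
Proof. by move=> t0; rewrite /step1 flat_le0// mul0r. Qed.

Lemma step1_ge1 t : 1 <= t -> step1 t = 1.
Proof.
move=> t1; have := step1_den_gt0 t; rewrite /step1 (@flat_le0 _ _ (1 - t)) ?subr_le0//.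
by rewrite addr0 => h; rewrite divff// gt_eqF.
Qed.

Definition cutoff (sg s : R) (i : 'I_n) x : R := step1 (ramp sg s i x).

Lemma cutoffE sg s i x : cutoff sg s i x = flat 0 (ramp sg s i x) *
  (flat 0 (ramp sg s i x) + flat 0 (ramp (- sg) (- (1 + s)) i x))^-1.
Proof.
by rewrite /cutoff /step1 (_ : ramp (- sg) _ i x = 1 - ramp sg s i x)// /ramp; ring.
Qed.

Lemma Ck_cutoff N sg s i : Ck N (cutoff sg s i).
Proof.
rewrite (_ : cutoff sg s i = fun x => flat 0 (ramp sg s i x) *
  (flat 0 (ramp sg s i x) + flat 0 (ramp (- sg) (- (1 + s)) i x))^-1); last first.
  by apply/funext => x; exact: cutoffE.
apply: Ck_mul; first exact: Ck_flat.
apply: Ck_inv; last by apply: Ck_add; exact: Ck_flat.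
move=> x; rewrite gt_eqF// (_ : ramp (- sg) _ i x = 1 - ramp sg s i x).
  exact: step1_den_gt0.
by rewrite /ramp; ring.
Qed.

(** Not optimal: 4 bounds the numerator of the derivative of [step1], and exp(4)
    bounds the inverse square of its denominator by [step1_den_ge]. *)
Definition Ccut : R := 8 * expR 4.

Lemma Ccut_ge0 : 0 <= Ccut. Proof. by rewrite mulr_ge0// expR_ge0. Qed.

Lemma partial_cutoff sg s i j x : `|sg| <= 1 ->
  [/\ `|partial j (cutoff sg s i) x| <= Ccut,
    ramp sg s i x <= 0 -> partial j (cutoff sg s i) x = 0 &
    1 <= ramp sg s i x -> partial j (cutoff sg s i) x = 0].
Proof.
move=> sg1; set t := ramp sg s i x.
pose D := flat 0 t + flat 0 (1 - t).
have D0 : 0 < D := step1_den_gt0 t.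
have d0 (u : R) : is_derive u 1 (flat 0 : R -> R) (flat 2 u).
  by have := is_derive_flat 0 u; rewrite mul0r subr0.
have d1 : is_derive t 1 (fun u : R => flat 0 (1 - u)) (- flat 2 (1 - t)).
  have dl : is_derive t 1 (fun u : R => 1 - u) (0 - 1).
    apply: is_deriveB.
  have := @is_derive1_comp R (flat 0) (fun u : R => 1 - u) t _ _ (d0 (1 - t)) dl.
  by rewrite sub0r mulrN1.
have dD : is_derive t 1 (fun u : R => flat 0 u + flat 0 (1 - u)) (flat 2 t - flat 2 (1 - t)).
  exact: is_deriveD.
have D0' : flat 0 t + flat 0 (1 - t) != 0 by rewrite gt_eqF.
have dV := is_deriveV (f := fun u : R => flat 0 u + flat 0 (1 - u)) D0' dD.
have dS : is_derive t 1 step1 _ := is_deriveM (d0 t) dV.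
have := is_derive_ramp_comp j dS => -[_ E].
have -> : partial j (cutoff sg s i) x =
   (i == j)%:R * sg * ((flat 2 t * flat 0 (1 - t) + flat 0 t * flat 2 (1 - t)) / D ^+ 2).
  rewrite /partial /cutoff E /GRing.scale /= -/D; congr (_ * _).
  rewrite (_ : flat 0 t = D - flat 0 (1 - t)); last by rewrite /D addrK.
  by field; rewrite gt_eqF.
split.
- have e4 : expR (- 2) ^+ 2 = (expR 4)^-1 :> R.
    by rewrite -expRM_natl -expRN; congr expR; ring.
  have De : (D ^+ 2)^-1 <= expR 4.
    rewrite -[leRHS]invrK lef_pV2 ?posrE ?invr_gt0 ?expR_gt0 ?exprn_gt0//.
    rewrite -e4 ler_pXn2r ?nnegrE ?expR_ge0 ?(ltW D0)//; exact: step1_den_ge.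
  rewrite !normrM -[leRHS]mul1r.
  apply: ler_pM; rewrite ?mulr_ge0//.
    rewrite -[leRHS]mulr1; apply: ler_pM => //.
    by case: (i == j); rewrite ?normr1 ?normr0.
  apply: ler_pM => //; last by rewrite ger0_norm// invr_ge0 sqr_ge0.
  rewrite ger0_norm ?addr_ge0 ?mulr_ge0 ?flat_ge0//.
  have f2 u : flat 2 u <= 2 :> R by have := flat_le 2 u.
  have f0 u : flat 0 u <= 1 :> R by have := flat_le 0 u; rewrite fact0.
  have a1 := ler_pM (flat_ge0 2 t) (flat_ge0 0 (1 - t)) (f2 t) (f0 (1 - t)).
  have a2 := ler_pM (flat_ge0 0 t) (flat_ge0 2 (1 - t)) (f0 t) (f2 (1 - t)).
  lra.
- by move=> t0; rewrite !(@flat_le0 _ _ t)// !mul0r addr0 mul0r mulr0.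
- move=> t1; rewrite !(@flat_le0 _ _ (1 - t)) ?subr_le0//.
  by rewrite !mulr0 addr0 mul0r mulr0.
Qed.

End smooth_functions.

(** * The Euclidean norm and test functions *)

Section euclidean_norm.
Context (R : realType) (n : nat).
Implicit Types (v w : 'rV[R]_n) (a : R).

Lemma euclid_ge0 v : 0 <= euclid v. Proof. exact: sqrtr_ge0. Qed.

Lemma sqr_euclid v : euclid v ^+ 2 = \sum_(i < n) v ord0 i ^+ 2.
Proof. by rewrite sqr_sqrtr// sumr_ge0// => i _; exact: sqr_ge0. Qed.

Lemma euclid_coord v i : `|v ord0 i| <= euclid v.
Proof.
rewrite -sqrtr_sqr ler_wsqrtr// (bigD1 i)//= lerDl.
by rewrite sumr_ge0// => j _; exact: sqr_ge0.
Qed.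

Lemma euclidZ a v : euclid (a *: v) = `|a| * euclid v.
Proof.
rewrite /euclid -sqrtr_sqr -sqrtrM ?sqr_ge0//; congr Num.sqrt.
by rewrite mulr_sumr; apply: eq_bigr => i _; rewrite mxE exprMn.
Qed.

Lemma euclidN v : euclid (- v) = euclid v.
Proof. by rewrite -scaleN1r euclidZ normrN1 mul1r. Qed.

Lemma euclid0 : euclid (0 : 'rV[R]_n) = 0.
Proof. by rewrite -(scale0r 0) euclidZ normr0 mul0r. Qed.

Lemma cauchy_schwarz v w : \sum_(i < n) v ord0 i * w ord0 i <= euclid v * euclid w.
Proof.
set A := euclid v; set B := euclid w; set S := \sum_(i < n) _.
have A0 : 0 <= A := euclid_ge0 v; have B0 : 0 <= B := euclid_ge0 w.
have : 0 <= \sum_(i < n) (B * v ord0 i - A * w ord0 i) ^+ 2.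
  by rewrite sumr_ge0// => i _; exact: sqr_ge0.
have -> : \sum_(i < n) (B * v ord0 i - A * w ord0 i) ^+ 2 =
    B ^+ 2 * (\sum_(i < n) v ord0 i ^+ 2) + A ^+ 2 * (\sum_(i < n) w ord0 i ^+ 2)
      - 2 * (A * B) * S.
  rewrite /S !mulr_sumr -big_split -sumrB /=.
  by apply: eq_bigr => i _; ring.
rewrite -!sqr_euclid -/A -/B => h.
have [AB|AB] := ltP 0 (A * B).
  by rewrite -(ler_pM2l AB); lra.
have /eqP : A * B = 0 by apply/eqP; rewrite eq_le AB mulr_ge0.
have z0 (u : 'rV[R]_n) : euclid u = 0 -> forall i, u ord0 i = 0.
  by move=> u0 i; have := euclid_coord u i; rewrite u0 normr_le0 => /eqP.
rewrite mulf_eq0 => /orP[/eqP/z0 v0|/eqP/z0 w0].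
  by rewrite /S big1 ?mulr_ge0// => i _; rewrite v0 mul0r.
by rewrite /S big1 ?mulr_ge0// => i _; rewrite w0 mulr0.
Qed.

Lemma parallelogram v w :
  euclid (v + w) ^+ 2 + euclid (v - w) ^+ 2 = 2 * euclid v ^+ 2 + 2 * euclid w ^+ 2.
Proof.
rewrite !sqr_euclid !mulr_sumr -!big_split /=; apply: eq_bigr => i _.
by rewrite !mxE; ring.
Qed.

Lemma ler_euclidD v w : euclid (v + w) <= euclid v + euclid w.
Proof.
rewrite -ler_sqr ?nnegrE ?addr_ge0 ?euclid_ge0//.
have -> : (euclid v + euclid w) ^+ 2 =
   euclid v ^+ 2 + euclid w ^+ 2 + 2 * (euclid v * euclid w) by ring.
have -> : euclid (v + w) ^+ 2 =
   euclid v ^+ 2 + euclid w ^+ 2 + 2 * (\sum_(i < n) v ord0 i * w ord0 i).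
  rewrite !sqr_euclid mulr_sumr -!big_split /=; apply: eq_bigr => i _.
  by rewrite mxE; ring.
by rewrite lerD2l ler_wpM2l// cauchy_schwarz.
Qed.

Lemma euclid_le_sum v a : 0 <= a -> (forall i, `|v ord0 i| <= a) ->
  euclid v <= n%:R * a.
Proof.
move=> a0 va; rewrite -ler_sqr ?nnegrE ?mulr_ge0 ?euclid_ge0// sqr_euclid.
have [n0|n0] := posnP n.
  rewrite big1 ?sqr_ge0// => i _; have := ltn_ord i; rewrite {2}n0//.
apply: (@le_trans _ _ (\sum_(i < n) a ^+ 2)).
  by apply: ler_sum => i _; rewrite -real_normK ?num_real// ler_pXn2r ?nnegrE.
rewrite sumr_const card_ord exprMn -[leLHS]mulr_natl ler_wpM2r ?sqr_ge0//.
by rewrite expr2 ler_peMl// ler1n.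
Qed.

End euclidean_norm.

Section test_functions.
Context (R : realType) (n : nat) (Omega : set 'rV[R]_n).
Local Notation V := 'rV[R]_n.
Local Notation mu := (@lebesgue_rV R n).
Implicit Types (f g u : V -> R) (x y v : V) (K a p : R) (k : nat).
Local Notation "'N_ q [ f ]" := (Lnorm mu q (EFin \o f)).
Local Notation e_ i := (delta_mx ord0 i : V).

(** The support is often only known to be inside some compact set; this form
    avoids computing the closure. *)
Lemma testP f : test_function Omega f <-> (forall k, Ck k f) /\ exists K : set V, [/\ compact K, K `<=` Omega & forall x, f x != 0 -> K x].
Proof.
split=> [[/smoothP sf cf fO]|[Cf [K [cK KO fK]]]].
  split => //; exists (closure [set x | f x != 0]); split => //.
  by move=> x fx; exact: subset_closure.
have sub : closure [set x | f x != 0] `<=` K.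
  have := compact_closed (@norm_hausdorff _ _) cK.
  by move=> /closure_id ->; exact: closure_subset.
split; first by apply/smoothP.
  by apply: subclosed_compact cK sub; exact: closed_closure.
exact: subset_trans KO.
Qed.

Lemma test_C1c f : test_function Omega f -> C1c f.
Proof.
move=> /testP[Cf [K [cK _ fK]]]; have [cf /= df] := Cf 1%N; split => //.
- by move=> i x; have [] := df i.
- by move=> i; have [_ []] := df i.
have [M [_ hM]] := compact_bounded cK.
exists (`|M| + 1); first by rewrite addr_ge0.
move=> x xM; apply/eqP/negPn/negP => /fK/hM h.
have : `|x| <= `|M| + 1 by apply: h; rewrite ltr_pwDr// ler_norm.
by rewrite leNgt xM.
Qed.

(** Outside Omega the function vanishes in a neighbourhood, because its support is
    closed. *)
Lemma test_out f x : test_function Omega f -> ~ Omega x ->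
  f x = 0 /\ forall i, partial i f x = 0.
Proof.
move=> /testP[Cf [K [cK KO fK]]] nO.
have cKc := compact_closed (@norm_hausdorff _ _) cK.
have f0 y : ~ K y -> f y = 0 by move=> nK; apply/eqP/negPn/negP => /fK.
split; first by apply: f0 => /KO.
move=> i; rewrite /partial (@near_eq_derive _ _ _ _ (cst 0)) ?derive_cst//.
have : nbhs x (~` K).
  by apply: open_nbhs_nbhs; split; [exact: closed_openC|move=> /KO].
by apply: filterS => y /f0.
Qed.

Lemma test_mul f g : test_function Omega f -> (forall k, Ck k g) ->
  test_function Omega (fun x => g x * f x).
Proof.
move=> /testP[Cf [K [cK KO fK]]] Cg; apply/testP; split.
  by move=> k; exact: Ck_mul.
exists K; split => // x; rewrite mulf_eq0 negb_or => /andP[_]; exact: fK.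
Qed.

Lemma test_scale f a : test_function Omega f -> test_function Omega (fun x => a * f x).
Proof. by move=> tf; apply: (@test_mul f (fun=> a)) => // k; exact: Ck_cst. Qed.

Lemma test_add f g : test_function Omega f -> test_function Omega g ->
  test_function Omega (fun x => f x + g x).
Proof.
move=> /testP[Cf [K [cK KO fK]]] /testP[Cg [L [cL LO gL]]]; apply/testP; split.
  by move=> k; exact: Ck_add.
exists (K `|` L); split; first exact: compactU.
  by rewrite subUset.
move=> x; have [->|fx _] := eqVneq (f x) 0; last by left; exact: fK.
by rewrite add0r => gx; right; exact: gL.
Qed.

Lemma test_sub f g : test_function Omega f -> test_function Omega g ->
  test_function Omega (fun x => f x - g x).
Proof.
move=> tf tg; rewrite (_ : (fun x => _) = fun x => f x + (-1) * g x).
  by apply: test_add => //; exact: test_scale.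
by apply/funext => x; rewrite mulN1r.
Qed.

Lemma partial_shift f i v x : partial i (fun y => f (y + v)) x = partial i f (x + v).
Proof.
rewrite /partial /derive; congr (lim _).
suff -> : (fun h : R => h^-1 *: (((fun y => f (y + v)) \o shift x) (h *: e_ i) - f (x + v)))
   = (fun h : R => h^-1 *: ((f \o shift (x + v)) (h *: e_ i) - f (x + v))) by [].
by apply/funext => h /=; rewrite addrA.
Qed.

Lemma Ck_shift k f v : Ck k f -> Ck k (fun x => f (x + v)).
Proof.
elim: k f => [|k IH] f Cf.
  split => // x; apply: (@continuous_comp _ _ _ (fun x => x + v) f).
    by apply: continuousD; [exact: cvg_id|exact: cst_continuous].
  exact: (Ck_continuous Cf).
apply: (@Ck_intro _ _ _ _ (fun i x => partial i f (x + v))).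
- move=> x; apply: (@continuous_comp _ _ _ (fun x => x + v) f).
    by apply: continuousD; [exact: cvg_id|exact: cst_continuous].
  exact: (Ck_continuous Cf).
- move=> i x; have [d _] := Ck_is_derive i (x + v) Cf.
  have E : (fun h : R => h^-1 *: (((fun y => f (y + v)) \o shift x) (h *: e_ i) - f (x + v)))
   = (fun h : R => h^-1 *: ((f \o shift (x + v)) (h *: e_ i) - f (x + v))).
    by apply/funext => h /=; rewrite addrA.
  apply: DeriveDef; last exact: partial_shift.
  by rewrite /derivable E.
- by move=> i; apply: IH; exact: (Ck_partial i Cf).
Qed.

Lemma test_shift f v : (forall x, Omega (x + v) -> Omega x) ->
  test_function Omega f -> test_function Omega (fun x => f (x + v)).
Proof.
move=> Ov /testP[Cf [K [cK KO fK]]]; apply/testP; split.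
  by move=> k; exact: Ck_shift.
exists ((fun x => x - v) @` K); split.
- apply: continuous_compact => //; apply: continuous_subspaceT => x.

  by apply: continuousB => //; exact: cst_continuous.
- by move=> _ [x Kx <-]; apply: Ov; rewrite subrK; exact: KO.
- by move=> x /fK Kx; exists (x + v) => //; rewrite addrK.
Qed.

Lemma test_restrict f : test_function Omega f -> f \_ Omega = f.
Proof.
move=> tf; apply/funext => x; rewrite patchE; case: ifPn => // /negP xO.
have nO : ~ Omega x by move=> Ox; apply: xO; rewrite inE.
by have [-> _] := test_out tf nO.
Qed.

Lemma Lnorm_on_test q f : test_function Omega f -> Lnorm_on Omega q f = 'N_q[f].
Proof. by move=> tf; rewrite /Lnorm_on test_restrict. Qed.

Lemma gradient_out f x : test_function Omega f -> ~ Omega x -> gradient f x = 0.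
Proof.
move=> tf nO; apply/rowP => i; rewrite !mxE.
by have [_ ->] := test_out tf nO.
Qed.

Lemma gradient_coord f i x : (gradient f x) ord0 i = partial i f x.
Proof. by rewrite mxE. Qed.

Lemma measurable_euclid (G : V -> V) :
  (forall i, measurable_fun setT (fun x => G x ord0 i)) ->
  measurable_fun setT (fun x => euclid (G x)).
Proof.
move=> mG; rewrite /euclid.
apply: (@measurableT_comp _ _ _ _ _ _ (@Num.sqrt R) _ (fun x => \sum_(i < n) G x ord0 i ^+ 2)).
  by apply: continuous_measurable_fun; exact: sqrt_continuous.
by apply: measurable_sum => i; exact: measurable_funX.
Qed.

(** A field that vanishes outside Omega may be integrated over the whole space,
    where translations act. *)
Lemma energyE p (G : V -> V) : 0 < p -> (forall x, ~ Omega x -> G x = 0) ->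
  energy Omega p G = (\int[mu]_x (`|euclid (G x)| `^ p)%:E)%E.
Proof.
move=> p0 G0; rewrite /energy integral_mkcond; apply: eq_integral => x _.
rewrite patchE ger0_norm ?euclid_ge0//; case: ifPn => // /negP xO.
rewrite G0 ?euclid0 ?powR0 ?gt_eqF// => Ox; apply: xO; by rewrite inE.
Qed.

Lemma measurable_gradient_euclid f : C1c f ->
  measurable_fun setT (fun x => euclid (gradient f x)).
Proof.
move=> Cf; apply: measurable_euclid => i.
under eq_fun do rewrite mxE; exact: C1c_measurable_partial.
Qed.

Lemma Lnorm_partial_le p f i K : 0 < p -> C1c f ->
  ('N_p%:E[(fun x => euclid (gradient f x))] <= K%:E)%E ->
  ('N_p%:E[partial i f] <= K%:E)%E.
Proof.
move=> p0 Cf; apply: le_trans; apply: le_Lnorm; rewrite ?lte_fin//.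
- exact: C1c_measurable_partial.
- exact: measurable_gradient_euclid.
by move=> x; rewrite (ger0_norm (euclid_ge0 _)) -gradient_coord euclid_coord.
Qed.

Lemma C1c_energy_fin p f : 0 < p -> C1c f ->
  exists2 K, 0 <= K & ('N_p%:E[(fun x => euclid (gradient f x))] <= K%:E)%E.
Proof.
move=> p0 Cf; have [L L0 fL] := C1c_supp Cf.
have /choice[M hM] : forall i, exists M, 0 <= M /\ forall x, `|partial i f x| <= M.
  by move=> i; have [M M0 fM] := C1c_bounded_partial i Cf; exists M.
pose S := \sum_(i < n) M i.
have S0 : 0 <= S by rewrite sumr_ge0// => i _; have [] := hM i.
apply: (@supported_Lnorm _ _ _ _ L (n%:R * S)) => //.
- exact: measurable_gradient_euclid.
- move=> x xL; rewrite (_ : gradient f x = 0) ?euclid0//.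
  by apply/rowP => i; rewrite !mxE (supported_partial i fL).
- move=> x; rewrite ger0_norm ?euclid_ge0//; apply: euclid_le_sum => // i.
  rewrite mxE; have [_ h] := hM i; apply: (le_trans (h x)).
  rewrite /S (bigD1 i)//= lerDl sumr_ge0// => j _; by have [] := hM j.
Qed.

Lemma C1c_Lnorm_fin p f : 0 < p -> C1c f ->
  exists2 K, 0 <= K & ('N_p%:E[f] <= K%:E)%E.
Proof.
move=> p0 Cf; have [L L0 fL] := C1c_supp Cf; have [M M0 fM] := C1c_bounded Cf.
exact: (supported_Lnorm p0 (C1c_measurable Cf) fL fM).
Qed.

End test_functions.

(** * The minimization problem *)

Section einv_facts.
Context (R : realType).

Lemma einv_ge0 (q : \bar R) : (0 <= q)%E -> 0 <= einv q.
Proof. by case: q => [r||]//= r0; rewrite invr_ge0. Qed.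

Lemma mul_einv_lt1 (p : R) (q : \bar R) : 0 < p -> (p%:E < q)%E -> p * einv q < 1.
Proof.
case: q => [r||]//= p0; last by rewrite mulr0.
rewrite lte_fin => pr; rewrite ltr_pdivrMr ?mul1r//; exact: lt_trans pr.
Qed.

End einv_facts.

(** The domain enters only through these facts: it is invariant under
    translations in the directions selected by T, and bounded by B in the others,
    of which there is at least one, i0.  For a cylinder, T selects the first k
    coordinates. *)
Section minimization.
Context (R : realType) (n : nat) (Omega : set 'rV[R]_n) (T : pred 'I_n).
Context (p : R) (q : \bar R) (B : R) (i0 : 'I_n).
Local Notation V := 'rV[R]_n.
Local Notation mu := (@lebesgue_rV R n).
Implicit Types (f g u : V -> R) (x y v : V) (K a : R).
Local Notation "'N_ q [ f ]" := (Lnorm mu q (EFin \o f)).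
Local Notation test := (test_function Omega).

Hypothesis p1 : 1 < p.
Hypothesis pq : (p%:E < q)%E.
Hypothesis subcritical : n%:R * (p^-1 - einv q) < 1.
Hypothesis B0 : 0 <= B.
Hypothesis Ti0 : ~~ T i0.
Hypothesis OB : forall x i, Omega x -> ~~ T i -> `|x ord0 i| <= B.
Hypothesis OT : forall x v, (forall i, ~~ T i -> v ord0 i = 0) -> Omega (x + v) -> Omega x.

Let p0 : 0 < p. Proof. exact: lt_trans p1. Qed.
Let p1' : 1 <= p. Proof. exact: ltW. Qed.
Let q1 : (1 <= q)%E. Proof. by apply: (le_trans _ (ltW pq)). Qed.
Let q0 : (0 < q)%E. Proof. exact: lt_le_trans q1. Qed.
Let s0 : 0 <= einv q. Proof. exact/einv_ge0/ltW. Qed.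
Let ps1 : p * einv q < 1. Proof. exact: mul_einv_lt1. Qed.

Definition grad_norm f : \bar R := 'N_p%:E[(fun x => euclid (gradient f x))].

Lemma energy_test f : test f ->
  energy Omega p (gradient f) = (\int[mu]_x (`|euclid (gradient f x)| `^ p)%:E)%E.
Proof. by move=> tf; rewrite energyE// => x; exact: gradient_out. Qed.

Lemma energy_test_leP f K : test f -> 0 <= K ->
  (energy Omega p (gradient f) <= (K `^ p)%:E)%E = (grad_norm f <= K%:E)%E.
Proof. by move=> tf K0; rewrite energy_test// -Lnorm_leP. Qed.

(** The norm in L^p is bounded by [poincare] in the direction i0.  In L^q, f is close
    to its averages over cubes of side 1 by [avg_sobolev], and these averages pass
    from L^p to L^q by [step_Lnorm]. *)
Lemma sobolev : exists2 C : R, 0 < C & forall f K, test f -> 0 <= K ->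
  (grad_norm f <= K%:E)%E ->
  ('N_p%:E[f] <= (C * K)%:E)%E /\ ('N_q[f] <= (C * K)%:E)%E.
Proof.
have [C1 [rho [C10 rho0 rho1 hC1]]] := avg_sobolev p1' pq subcritical.
pose C2 := 2 * B + 1.
have C20 : 0 < C2 by rewrite /C2; have := B0; lra.
pose C3 := (vol R n 0)^-1 `^ (p^-1 - einv q).
have C30 : 0 <= C3 by exact: powR_ge0.
have Ca0 := Cavg_ge0 R n.
exists (C2 + (C1 + C3 * (C2 + Cavg R n))).
  by rewrite ltr_pwDl// addr_ge0// mulr_ge0// addr_ge0// ltW.
move=> f K tf K0 fK.
have Cf := test_C1c tf.
have fiK i : ('N_p%:E[partial i f] <= K%:E)%E by exact: Lnorm_partial_le.
have fp : ('N_p%:E[f] <= (C2 * K)%:E)%E.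
  apply: (poincare (i := i0)) => //.
  move=> x fx; apply: OB => //; apply: contrapT => nO.
  by move/eqP : fx; apply; have [] := test_out tf nO.
split.
  apply: (le_trans fp); rewrite lee_fin ler_wpM2r// lerDl.
  by rewrite addr_ge0// mulr_ge0// addr_ge0// ltW.
have h1 := hC1 f K 0%N Cf K0 fiK.
have h2 : ('N_q[avg 0 f] <= (C3 * (C2 * K + Cavg R n * (2 ^+ 0)^-1 * K))%:E)%E.
  apply: step_Lnorm => //.
  - by rewrite addr_ge0// mulr_ge0// ?(ltW C20)// mulr_ge0// invr_ge0 exprn_ge0.
  - by move=> x y; exact: avg_cell.
  - exact: Lnorm_avg_le.
have mf := C1c_measurable Cf.
have := LnormD_le q1 _ _ h1 h2.
rewrite (_ : (fun x => f x - avg 0 f x + avg 0 f x) = f); last by apply/funext => x; rewrite subrK.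
move=> /(_ _ _)/le_trans; apply.
- by apply: measurable_funB => //; exact: measurable_avg.
- exact: measurable_avg.
rewrite lee_fin expr0 invr1 !mulr1; have := mulr_ge0 (ltW C20) K0; lra.
Qed.

Hypothesis nontrivial : exists2 f, test f & 'N_q[f] != 0%E.

Lemma test_Lnorm_fin f : test f -> 'N_q[f] \is a fin_num.
Proof.
move=> tf; have [C C0 hC] := sobolev.
have [K K0 fK] := C1c_energy_fin p0 (test_C1c tf).
have [_ h] := hC f K tf K0 fK.
by rewrite ge0_fin_numE ?Lnorm_ge0// (le_lt_trans h)// ltry.
Qed.

Lemma partial_scale f a i x : test f -> partial i (fun x => a * f x) x = a * partial i f x.
Proof.
move=> tf; have Cf := test_C1c tf.
by rewrite /partial deriveZ//; exact: C1c_der.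
Qed.

Lemma gradient_scale f a x : test f ->
  gradient (fun x => a * f x) x = a *: gradient f x.
Proof. by move=> tf; apply/rowP => i; rewrite !mxE partial_scale. Qed.

Lemma grad_norm_scale f a : test f ->
  grad_norm (fun x => a * f x) = (`|a|%:E * grad_norm f)%E.
Proof.
move=> tf; rewrite /grad_norm.
have -> : 'N_p%:E[(fun x => euclid (gradient (fun x => a * f x) x))] =
  'N_p%:E[(fun x => `|a| * euclid (gradient f x))%R].
  by congr Lnorm; apply/funext => x /=; rewrite gradient_scale// euclidZ.
have mg : measurable_fun setT (fun x => euclid (gradient f x)).
  by apply: measurable_gradient_euclid; exact: (test_C1c tf).
by rewrite LnormZl// normr_id.
Qed.

Lemma normalize f : test f -> 'N_q[f] != 0%E ->
  exists b : R, [/\ 0 < b, 'N_q[f] = b%:E & Lnorm_on Omega q (fun x => b^-1 * f x) = 1%E].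
Proof.
move=> tf f0; have fin := test_Lnorm_fin tf.
pose b := fine 'N_q[f].
have bE : 'N_q[f] = b%:E by rewrite fineK.
have b0 : 0 < b by rewrite -lte_fin -bE lt0e f0 Lnorm_ge0.
exists b; split => //.
rewrite Lnorm_on_test; last exact: test_scale.
have mf : measurable_fun setT f by exact: (C1c_measurable (test_C1c tf)).
rewrite LnormZl//.
by rewrite bE ger0_norm ?invr_ge0 ?ltW// -EFinM mulVf ?gt_eqF.
Qed.

(** The lower bound is [sobolev] applied with norm 1 in L^q; the upper bound is the
    energy of one normalized test function. *)
Lemma lambda_fin : exists2 lam : R, 0 < lam & lambda Omega p q = lam%:E.
Proof.
have [C C0 hC] := sobolev.
have lb : ((C^-1 `^ p)%:E <= lambda Omega p q)%E.
  apply: le_ereal_inf_tmp => _ [f /= [tf f1] <-].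
  rewrite leNgt; apply/negP => lt1.
  pose e := energy Omega p (gradient f).
  have e0 : (0 <= e)%E by apply: integral_ge0 => x _; rewrite lee_fin powR_ge0.
  have efin : e \is a fin_num by rewrite ge0_fin_numE// (lt_trans lt1)// ltry.
  pose K := fine e `^ p^-1.
  have K0 : 0 <= K by exact: powR_ge0.
  have Kp : K `^ p = fine e by rewrite /K -powRrM mulVf ?gt_eqF// powRr1// fine_ge0.
  have : (grad_norm f <= K%:E)%E by rewrite -energy_test_leP// Kp fineK.
  move=> /(hC f K tf K0)[_]; rewrite -(Lnorm_on_test _ tf) f1 lee_fin => CK.
  have KC : C^-1 <= K by rewrite -[leLHS]mul1r ler_pdivrMr// mulrC.
  have : C^-1 `^ p <= K `^ p.
    by apply: ge0_ler_powR; rewrite ?nnegrE ?(ltW p0)// invr_ge0 ltW.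
  move: lt1; rewrite Kp -/e -(fineK efin) lte_fin => lt1.
  by rewrite leNgt lt1.
have [f tf f0] := nontrivial.
have [b [b0 bE b1]] := normalize tf f0.
have tg : test (fun x => b^-1 * f x) by exact: test_scale.
have [K K0 gK] := C1c_energy_fin p0 (test_C1c tg).
have ub : (lambda Omega p q <= (K `^ p)%:E)%E.
  apply: (@le_trans _ _ (energy Omega p (gradient (fun x => b^-1 * f x)))).
    by apply: ereal_inf_lbound; exists (fun x => b^-1 * f x).
  by rewrite energy_test_leP.
have Cp : 0 < C^-1 `^ p by rewrite powR_gt0// invr_gt0.
have fin : lambda Omega p q \is a fin_num.
  rewrite ge0_fin_numE; first by rewrite (le_lt_trans ub)// ltry.
  by apply: le_trans lb; rewrite lee_fin ltW.
exists (fine (lambda Omega p q)); last by rewrite fineK.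
by rewrite -lte_fin fineK// (lt_le_trans _ lb)// lte_fin.
Qed.

(** The definition of lambda for functions of norm 1, extended by homogeneity. *)
Lemma lambda_le lam f a : lambda Omega p q = lam%:E -> test f -> 0 <= a ->
  (a%:E <= 'N_q[f])%E -> ((lam * a `^ p)%:E <= energy Omega p (gradient f))%E.
Proof.
move=> lamE tf a0 af.
have [f0|f0] := eqVneq 'N_q[f] 0%E.
  have : (a%:E <= 0)%E by rewrite -f0.
  rewrite lee_fin => a0'; have -> : a = 0 by apply/eqP; rewrite eq_le a0 a0'.
  rewrite powR0 ?gt_eqF// mulr0.
  by apply: integral_ge0 => x _; rewrite lee_fin powR_ge0.
have [b [b0 bE b1]] := normalize tf f0.
have [K K0 fK] := C1c_energy_fin p0 (test_C1c tf).
have gfin : grad_norm f \is a fin_num.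
  by rewrite ge0_fin_numE ?Lnorm_ge0// (le_lt_trans fK)// ltry.
pose D := fine (grad_norm f).
have D0 : 0 <= D by rewrite fine_ge0// Lnorm_ge0.
have DE : grad_norm f = D%:E by rewrite fineK.
have eE : energy Omega p (gradient f) = (D `^ p)%:E.
  rewrite energy_test// -poweR_EFin -DE /grad_norm poweR_Lnorm ?gt_eqF//.
have tg : test (fun x => b^-1 * f x) by exact: test_scale.
have : (lambda Omega p q <= energy Omega p (gradient (fun x => b^-1 * f x)%R))%E.
  by apply: ereal_inf_lbound; exists (fun x => b^-1 * f x).
have bi0 : 0 <= b^-1 by rewrite invr_ge0 ltW.
have -> : energy Omega p (gradient (fun x => b^-1 * f x)) = ((b^-1 * D) `^ p)%:E.
  rewrite energy_test// -poweR_EFin EFinM -DE -[X in (X%:E * _)%E](ger0_norm bi0).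
  by rewrite -grad_norm_scale// /grad_norm poweR_Lnorm ?gt_eqF.
rewrite lamE lee_fin powRM// => h.
rewrite eE lee_fin.
have ab : a <= b by rewrite -lee_fin -bE.
have abp : a `^ p <= b `^ p.
  by apply: ge0_ler_powR; rewrite ?nnegrE ?(ltW p0)// ltW.
have bp : 0 < b `^ p by exact: powR_gt0.
have lam0 : 0 <= lam.
  have [l l0 lE] := lambda_fin; move: lE; rewrite lamE => -[->]; exact: ltW.
apply: (le_trans (ler_wpM2l lam0 abp)).
rewrite -ler_pdivlMr//; apply: (le_trans h).
by rewrite mulrC ler_wpM2l ?powR_ge0// -powR_inv1 ?(ltW b0)// powRAC powR_inv1 ?powR_ge0.
Qed.

Lemma minimizing_sequence lam : lambda Omega p q = lam%:E ->
  exists phi : nat -> V -> R, forall j, [/\ test (phi j), 'N_q[phi j] = 1%E &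
    (energy Omega p (gradient (phi j)) <= (lam + j.+1%:R^-1)%:E)%E].
Proof.
move=> lamE.
have h (j : nat) : exists f, [/\ test f, 'N_q[f] = 1%E &
    (energy Omega p (gradient f) <= (lam + j.+1%:R^-1)%:E)%E].
  have e0 : 0 < j.+1%:R^-1 :> R by [].
  have fin : lambda Omega p q \is a fin_num by rewrite lamE.
  have [_ [f /= [tf f1] <-] lt1] := lb_ereal_inf_adherent e0 fin.
  exists f; split => //; first by rewrite -(Lnorm_on_test _ tf).
  by rewrite EFinD -lamE ltW.
by have /choice[phi hphi] := h; exists phi.
Qed.

(** A set that contains the cube brought back to the origin and that is bounded in
    every direction selected by T. *)
Definition near0 : set V := [set x | forall i, T i -> `|x ord0 i| <= 1].

Lemma gradient_shift f v x : gradient (fun y => f (y + v)) x = gradient f (x + v).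
Proof. by apply/rowP => i; rewrite !mxE partial_shift. Qed.

Lemma measurable_near0 : measurable near0.
Proof.
pose A i : set R := if T i then [set t | `|t| <= 1] else setT.
rewrite (_ : near0 = [set x | forall i, A i (x ord0 i)]).
  apply: (measurable_box (A := A)) => i; rewrite /A; case: ifP => _ //.
  rewrite (_ : [set t : R | _] = `[-1, 1]%classic); first exact: measurable_itv.
  by apply/seteqP; split => t /=; rewrite in_itv/= ler_norml.
by apply/seteqP; split => x /= h i; have := h i; rewrite /A; case: ifP => // _; exact.
Qed.

(** If all averages at scale m were below c1, [Lnorm_interp] would make the averaged
    function smaller than 1/4 in L^q, while m is chosen so that the function is
    within 1/2 of it: this contradicts the norm 1.  The cube of a large average is
    translated to the origin in the directions selected by T. *)
Lemma centered_minimizing_sequence lam : lambda Omega p q = lam%:E -> 0 < lam ->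
  exists2 c : R, 0 < c & exists psi : nat -> V -> R, forall j,
    [/\ test (psi j), 'N_q[psi j] = 1%E,
        (energy Omega p (gradient (psi j)) <= (lam + j.+1%:R^-1)%:E)%E &
        (c%:E <= 'N_q[psi j \_ near0])%E].
Proof.
move=> lamE lam0.
have [phi hphi] := minimizing_sequence lamE.
have [C C0 hC] := sobolev.
have [C1 [rho [C10 rho0 rho1 hC1]]] := avg_sobolev p1' pq subcritical.
pose K := (lam + 1) `^ p^-1.
have K0 : 0 < K by rewrite powR_gt0// addr_gt0.
have phiK j : (grad_norm (phi j) <= K%:E)%E.
  have [tj _ ej] := hphi j.
  rewrite -energy_test_leP// ?(ltW K0)// /K -powRrM mulVf ?gt_eqF// powRr1 ?addr_ge0 ?(ltW lam0)//.
  apply: (le_trans ej); rewrite lee_fin lerD2l invf_le1//.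
  by rewrite ler1n.
have [m hm] : exists m, C1 * rho ^+ m * K <= 2^-1.
  have : C1 * rho ^+ m * K @[m --> \oo] --> C1 * 0 * K.
    apply: cvgM; last exact: cvg_cst.
    apply: cvgM; first exact: cvg_cst.
    by apply: cvg_expr; rewrite ger0_norm.
  have h2 : 0 < 2^-1 :> R by [].
  rewrite mulr0 mul0r => /cvgr0Pnorm_le/(_ _ h2)[m _ /(_ m (leqnn m))/= h].
  by exists m; rewrite (le_trans (ler_norm _)).
pose A := C * K + Cavg R n * (2 ^+ m)^-1 * K + 1.
have A0 : 0 < A.
  have h1 : 0 <= Cavg R n * (2 ^+ m)^-1 by rewrite mulr_ge0 ?Cavg_ge0// invr_ge0 exprn_ge0.
  by rewrite ltr_wpDl// addr_ge0// mulr_ge0// ltW.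
have av j : ('N_p%:E[avg m (phi j)] <= A%:E)%E.
  have [tj _ _] := hphi j.
  have [fp _] := hC _ _ tj (ltW K0) (phiK j).
  have := @Lnorm_avg_le R n p (phi j) m _ K p1' (test_C1c tj) (ltW K0) fp.
  move=> /(_ _)/le_trans; apply.
    by move=> i; exact: (Lnorm_partial_le i p0 (test_C1c tj) (phiK j)).
  by rewrite lee_fin /A lerDl.
pose e := 1 - p * einv q.
have e0 : 0 < e by rewrite subr_gt0.
(* The solution of c1^(1-ps) A^(ps) = 1/4. *)
pose c1 := (4^-1 / A `^ (p * einv q)) `^ e^-1.
have c10 : 0 < c1 by rewrite powR_gt0// divr_gt0// ?powR_gt0.
have big j : exists x, c1 <= `|avg m (phi j) x|.
  apply: contrapT => /forallNP nx.
  have le_c1 x : `|avg m (phi j) x| <= c1 by rewrite leNgt; apply/negP => /ltW /nx.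
  have [tj nj _] := hphi j.
  have Cj := test_C1c tj; have mj := C1c_measurable Cj.
  have h1 := Lnorm_interp p0 pq (ltW c10) (ltW A0) (measurable_avg m (phi j)) le_c1 (av j).
  have h2 : ('N_q[(fun x => phi j x - avg m (phi j) x)%R] <= (2^-1)%:E)%E.
    apply: (@le_trans _ _ (C1 * rho ^+ m * K)%:E); last by rewrite lee_fin.
    apply: hC1 => //; first exact: ltW.
    by move=> i; exact: (Lnorm_partial_le i p0 Cj (phiK j)).
  have := LnormD_le q1 _ _ h2 h1.
  rewrite (_ : (fun x => phi j x - avg m (phi j) x + avg m (phi j) x) = phi j); last by apply/funext => x; rewrite subrK.
  rewrite nj => /(_ _ _).
  have -> : c1 `^ (1 - p * einv q) * A `^ (p * einv q) = 4^-1.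
    rewrite /c1 -/e -powRrM mulVf ?gt_eqF// powRr1 ?divr_ge0 ?powR_ge0//.
    by rewrite divfK// gt_eqF// powR_gt0.
  rewrite lee_fin => h; have : (1 : R) <= 2^-1 + 4^-1.
    apply: h; last exact: measurable_avg.
    by apply: measurable_funB => //; exact: measurable_avg.
  by lra.
pose c := (vol R n m) * (vol R n m) `^ (einv q - 1) * c1.
have v0 : 0 < vol R n m := vol_gt0 R n m.
have c0 : 0 < c by rewrite /c mulr_gt0// mulr_gt0// powR_gt0.
exists c => //.
have h j : exists f, [/\ test f, 'N_q[f] = 1%E,
        (energy Omega p (gradient f) <= (lam + j.+1%:R^-1)%:E)%E &
        (c%:E <= 'N_q[f \_ near0])%E].
  have [x cx] := big j; have [tj nj ej] := hphi j.
  have Cj := test_C1c tj; have mj := C1c_measurable Cj.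
  pose z : V := \row_i (if T i then x ord0 i else 0).
  have tz : test (fun y => phi j (y + z)).
    apply: test_shift => // y; apply: OT => i Ti; by rewrite mxE (negbTE Ti).
  exists (fun y => phi j (y + z)); split; first exact: tz.
  - by rewrite (Lnorm_shift z q0 mj).
  - apply: le_trans ej; rewrite (energy_test tz) (energy_test tj).
    pose G y : \bar R := (`|euclid (gradient (phi j) y)| `^ p)%:E.
    have mG : measurable_fun setT G.
      by apply: measurable_powR_norm; exact: measurable_gradient_euclid.
    have G0 y : (0 <= G y)%E by rewrite lee_fin powR_ge0.
    have E := ge0_integral_shift z mG G0.
    suff E2 : (\int[mu]_x (`|euclid (gradient (fun y => phi j (y + z)%R) x)| `^ p)%:E
        = \int[mu]_x G (x + z)%R)%E.
      by rewrite le_eqVlt; apply/orP; left; apply/eqP; exact: (etrans E2 E).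
    apply: eq_integral => y _.
    by rewrite gradient_shift.
  have low := avg_lower q1 Cj (ltW c10) cx.
  apply: (le_trans low).
  have mc := @measurable_cube R n m (cell m x).
  have mpc : measurable_fun setT (phi j \_ (cube m (cell m x))) by exact: measurable_patch.
  rewrite -(Lnorm_shift z q0 mpc).
  apply: le_Lnorm => //.
  - exact: measurable_shift.
  - apply: measurable_patch; first exact: measurable_near0.
    exact: measurable_shift.
  move=> y; rewrite !patchE; case: ifPn => [|_]; last by rewrite normr0.
  rewrite inE => yc; rewrite mem_set//= /near0 /= => i Ti.
  have := rV_norm_coord (y + z - x) i; rewrite !mxE Ti addrK => /le_trans; apply.
  apply: le_trans (cell_dist yc) _.
  by rewrite invf_le1 ?exprn_gt0// exprn_ege1// ler1n.
by have /choice[psi hpsi] := h; exists psi.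
Qed.

End minimization.

(** * No mass escapes to infinity *)

Section tightness.
Context (R : realType) (n : nat) (Omega : set 'rV[R]_n).
Local Notation V := 'rV[R]_n.
Local Notation mu := (@lebesgue_rV R n).
Implicit Types (f g u : V -> R) (x y v : V) (K a b p sg s L : R) (q : \bar R) (i : 'I_n).
Local Notation "'N_ q [ f ]" := (Lnorm mu q (EFin \o f)).
Local Notation test := (test_function Omega).

Lemma gradient_mul f g x : (forall k, Ck k f) -> (forall k, Ck k g) ->
  gradient (fun y => f y * g y) x = f x *: gradient g x + g x *: gradient f x.
Proof.
move=> Cf Cg; apply/rowP => i; rewrite !mxE.
have [df _] := Ck_is_derive i x (Cf 1%N).
have [dg _] := Ck_is_derive i x (Cg 1%N).
exact: (deriveM df dg).
Qed.

Lemma powR_addr_le (p a b : R) : 0 < p -> 0 <= a -> 0 <= b ->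
  (a + b) `^ p <= 2 `^ p * (a `^ p + b `^ p).
Proof.
move=> p0 a0 b0.
wlog ab : a b a0 b0 / a <= b.
  move=> H; have [|/ltW] := leP a b; first exact: H.
  by move=> ba; rewrite addrC [X in _ * X]addrC; exact: H.
apply: (@le_trans _ _ ((2 * b) `^ p)).
  by apply: ge0_ler_powR; rewrite ?nnegrE ?(ltW p0) ?addr_ge0 ?mulr_ge0//; lra.
by rewrite powRM// ler_wpM2l ?powR_ge0// lerDr powR_ge0.
Qed.

(** The width 2 leaves room for two cutoffs of width 1: one piece is cut off between
    s + 1 and s + 2, the other between s and s + 1, so that each point is seen
    entirely by one of them. *)
Definition strip (sg : R) (i : 'I_n) (s : R) : set V :=
  [set x | s <= sg * x ord0 i < s + 2].

Lemma measurable_coord_set (sg : R) (i : 'I_n) (A : set R) : measurable A ->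
  measurable [set x : V | A (sg * x ord0 i)].
Proof.
move=> mA.
have mf : measurable_fun setT (fun x : V => sg * x ord0 i).
  by apply: measurable_funM => //; exact: measurable_rV_coord.
exact: (measurableT_preimage _ mf mA).
Qed.

Lemma measurable_strip sg i s : measurable (strip sg i s).
Proof.
rewrite (_ : strip sg i s = [set x | `[s, s + 2[%classic (sg * x ord0 i)]).
  by apply: measurable_coord_set; exact: measurable_itv.
by apply/seteqP; split => x /=; rewrite /strip /= in_itv.
Qed.

Lemma measurable_halfspace sg i L : measurable [set x : V | L <= sg * x ord0 i].
Proof.
rewrite (_ : [set x | _] = [set x : V | `[L, +oo[%classic (sg * x ord0 i)]).
  by apply: measurable_coord_set; exact: measurable_itv.
by apply/seteqP; split => x /=; rewrite in_itv/= andbT.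
Qed.

Let two_lines a b : a <= b -> 1 + 2 * a + 1 <= 2 * b + 2.
Proof. by lra. Qed.

Lemma cutoff_left sg s i x : sg * x ord0 i <= s + 1 ->
  cutoff (- sg) (- (s + 2)) i x = 1.
Proof. by move=> h; apply: step1_ge1; rewrite /ramp; lra. Qed.

Lemma cutoff_right sg s i x : s + 1 <= sg * x ord0 i -> cutoff sg s i x = 1.
Proof. by move=> h; apply: step1_ge1; rewrite /ramp; lra. Qed.

(** The factor 2 counts the two pieces; the rest is the constant of
    (a + C b)^p <= 2^p (1 + C^p) (a^p + b^p). *)
Definition Dcut (p : R) : R := 2 * (2 `^ p * (1 + (n%:R * Ccut R) `^ p)).

Lemma Dcut_ge0 p : 0 <= Dcut p.
Proof. by rewrite mulr_ge0// mulr_ge0 ?powR_ge0// addr_ge0// powR_ge0. Qed.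

(** Outside the strip one of the cutoffs is 1, the other is 0, and both have zero
    gradient; inside, the product rule gives a bound without any smallness. *)
Lemma gradient_cut_split p f sg i s x : 0 < p -> `|sg| <= 1 -> (forall k, Ck k f) ->
  (euclid (gradient (fun y => cutoff (- sg) (- (s + 2)) i y * f y) x) `^ p +
   euclid (gradient (fun y => cutoff sg s i y * f y) x) `^ p <=
   euclid (gradient f x) `^ p + (\1_(strip sg i s) x : R) *
     (Dcut p * (euclid (gradient f x) `^ p + `|f x| `^ p))).
Proof.
move=> p0 sg1 Cf.
have Cc sg' s' k : Ck k (cutoff sg' s' i) by exact: Ck_cutoff.
rewrite (gradient_mul x (Cc (- sg) (- (s + 2))) Cf) (gradient_mul x (Cc sg s) Cf).
set h1 := cutoff (- sg) (- (s + 2)) i x; set h2 := cutoff sg s i x.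
set G1 := gradient (cutoff (- sg) (- (s + 2)) i) x; set G2 := gradient (cutoff sg s i) x.
set t := sg * x ord0 i.
have r1 : ramp (- sg) (- (s + 2)) i x = s + 2 - t by rewrite /ramp /t; ring.
have r2 : ramp sg s i x = t - s by [].
have sgN : `|- sg| <= 1 by rewrite normrN.
have P1 j := partial_cutoff (- (s + 2)) i j x sgN.
have P2 j := partial_cutoff s i j x sg1.
have [ts|ts] := ltP t s.
  have -> : G1 = 0.
    apply/rowP => j; rewrite !mxE; have [_ _ ->//] := P1 j.
    by rewrite r1; lra.
  have -> : G2 = 0.
    apply/rowP => j; rewrite !mxE; have [_ ->//] := P2 j.
    by rewrite r2; lra.
  have -> : h1 = 1 by rewrite /h1 /cutoff step1_ge1// r1; lra.
  have -> : h2 = 0 by rewrite /h2 /cutoff step1_le0// r2; lra.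
  rewrite !scaler0 !addr0 scale1r scale0r euclid0 powR0 ?gt_eqF// addr0 lerDl.
  by rewrite mulr_ge0 ?mulr_ge0 ?Dcut_ge0 ?addr_ge0 ?powR_ge0.
have [ts2|ts2] := leP (s + 2) t.
  have -> : G1 = 0.
    apply/rowP => j; rewrite !mxE; have [_ ->//] := P1 j.
    by rewrite r1; lra.
  have -> : G2 = 0.
    apply/rowP => j; rewrite !mxE; have [_ _ ->//] := P2 j.
    by rewrite r2; lra.
  have -> : h1 = 0 by rewrite /h1 /cutoff step1_le0// r1; lra.
  have -> : h2 = 1 by rewrite /h2 /cutoff step1_ge1// r2; lra.
  rewrite !scaler0 !addr0 scale1r scale0r euclid0 powR0 ?gt_eqF// add0r lerDl.
  by rewrite mulr_ge0 ?mulr_ge0 ?Dcut_ge0 ?addr_ge0 ?powR_ge0.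
have -> : \1_(strip sg i s) x = 1 :> R.
  by rewrite indicE mem_set//= /strip /= -/t ts ts2.
rewrite mul1r.
have key (h : R) (G : V) : 0 <= h -> h <= 1 -> (forall j, `|G ord0 j| <= Ccut R) ->
    euclid (h *: gradient f x + f x *: G) `^ p <=
    2 `^ p * (1 + (n%:R * Ccut R) `^ p) * (euclid (gradient f x) `^ p + `|f x| `^ p).
  move=> h0 hle GC.
  have e1 : euclid (h *: gradient f x + f x *: G) <=
      euclid (gradient f x) + (n%:R * Ccut R) * `|f x|.
    apply: (le_trans (ler_euclidD _ _)); rewrite !euclidZ (ger0_norm h0); apply: lerD.
      by rewrite ler_piMl// euclid_ge0.
    rewrite mulrC ler_wpM2r//; apply: euclid_le_sum => //; exact: Ccut_ge0.
  have C0 : 0 <= n%:R * Ccut R by rewrite mulr_ge0// Ccut_ge0.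
  have E0 := euclid_ge0 (gradient f x).
  apply: (@le_trans _ _ ((euclid (gradient f x) + (n%:R * Ccut R) * `|f x|) `^ p)).
    by apply: ge0_ler_powR; rewrite ?nnegrE ?(ltW p0) ?euclid_ge0// addr_ge0// mulr_ge0.
  apply: (le_trans (powR_addr_le p0 E0 (mulr_ge0 C0 (normr_ge0 _)))).
  rewrite -[leRHS]mulrA ler_wpM2l ?powR_ge0// (powRM p C0 (normr_ge0 (f x))).
  have a0 : 0 <= euclid (gradient f x) `^ p by exact: powR_ge0.
  have b0 : 0 <= `|f x| `^ p by exact: powR_ge0.
  have c0 : 0 <= (n%:R * Ccut R) `^ p by exact: powR_ge0.
  have := mulr_ge0 c0 a0.
  by lra.
apply: (@le_trans _ _ (Dcut p * (euclid (gradient f x) `^ p + `|f x| `^ p))).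
  have k1 := key h1 G1 (step1_ge0 _) (step1_le1 _).
  have k2 := key h2 G2 (step1_ge0 _) (step1_le1 _).
  rewrite /Dcut mulr2n mulrDl mul1r mulrDl; apply: lerD.
    by apply: k1 => j; rewrite mxE; have [] := P1 j.
  by apply: k2 => j; rewrite mxE; have [] := P2 j.
by rewrite lerDr powR_ge0.
Qed.

Lemma gradient_cut_split_norm p f sg i s x : 0 < p -> `|sg| <= 1 -> (forall k, Ck k f) ->
  `|euclid (gradient (fun y => cutoff (- sg) (- (s + 2)) i y * f y) x)| `^ p +
   `|euclid (gradient (fun y => cutoff sg s i y * f y) x)| `^ p <=
   `|euclid (gradient f x)| `^ p + Dcut p * ((\1_(strip sg i s) x : R) *
     (`|euclid (gradient f x)| `^ p + `|f x| `^ p)).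
Proof.
move=> p0 sg1 Cf.
have nE (v : V) : `|euclid v| = euclid v := ger0_norm (euclid_ge0 v).
apply: le_trans (le_trans (gradient_cut_split i s x p0 sg1 Cf) _).
  by apply: lerD; rewrite nE.
by apply: lerD; rewrite nE// mulrCA.
Qed.

(** The M strips are disjoint.  The bound has K + 1 in place of K because the
    argument by contradiction needs a strict inequality. *)
Lemma strip_pigeonhole (F : V -> R) sg i K (M : nat) :
  measurable_fun setT F -> (forall x, 0 <= F x) ->
  (\int[mu]_x (F x)%:E <= K%:E)%E -> (0 < M)%N ->
  exists2 k, (k < M)%N &
  (\int[mu]_x ((\1_(strip sg i (1 + 2 * k%:R)) x : R) * F x)%:E <= ((K + 1) / M%:R)%:E)%E.
Proof.
move=> mF F0 FK M0.
pose S (k : nat) := strip sg i (1 + 2 * k%:R).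
pose I (k : nat) := (\int[mu]_x ((\1_(S k) x : R) * F x)%:E)%E.
have mI k : measurable_fun setT (fun x => ((\1_(S k) x : R) * F x)%:E : \bar R).
  apply/measurable_EFinP; apply: measurable_funM => //.
  by apply: measurable_indic; exact: measurable_strip.
have I0 k x : (0 <= ((\1_(S k) x : R) * F x)%:E)%E by rewrite lee_fin mulr_ge0.
apply: contrapT => h.
have hI k : (k < M)%N -> (((K + 1) / M%:R)%:E <= I k)%E.
  move=> kM; rewrite leNgt; apply/negP => lt1; apply: h; exists k => //; exact: ltW.
have sumI : (\sum_(k < M) I k <= K%:E)%E.
  rewrite /I -ge0_integral_sum//.
  apply: le_trans FK; apply: ge0_le_integral => //=.
  - by move=> x _; apply: sume_ge0 => k _; exact: I0.
  - by apply: emeasurable_sum => k; exact: mI.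
  - by apply/measurable_EFinP.
  - move=> x _; rewrite sumEFin lee_fin -mulr_suml ler_piMl//.
    have [k0|nk] := pselect (exists k : 'I_M, S k x).
      have [k kx] := k0.
      rewrite (bigD1 k)//= big1 ?addr0; first by rewrite indicE; case: (_ \in _).
      move=> j jk; rewrite indicE memNset// => jx.
      move: kx jx; rewrite /S /strip /= => /andP[k1 k2] /andP[j1 j2].
      have kj : ((k : nat) <= j)%N.
        rewrite -ltnS -(ltr_nat R) -addn1 natrD; lra.
      have jk' : ((j : nat) <= k)%N.
        rewrite -ltnS -(ltr_nat R) -addn1 natrD; lra.
      move/eqP : jk; apply; apply/val_inj/eqP; by rewrite eqn_leq jk' kj.
    rewrite big1// => k _; rewrite indicE memNset// => kx; apply: nk; by exists k.
have : (\sum_(k < M) ((K + 1) / M%:R)%:E <= \sum_(k < M) I k)%E.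
  by apply: lee_sum => k _; exact: hI.
move=> /le_trans/(_ sumI).
rewrite sumEFin lee_fin sumr_const card_ord -[leLHS]mulr_natr divfK ?pnatr_eq0 -?lt0n//.
lra.
Qed.

(** Cut f along a strip of small mass into f1, on the side of A, and f2, on the
    other side.  Their energies add up to at most lam (1 + d), so the p-th powers
    of their norms in L^q add up to at most 1 + d; [Lnorm_split_le] and
    [concentration_dichotomy] give that f2 is small. *)
Lemma tightness p q (lam c Kp : R) (psi : nat -> V -> R) (A : set V) sg i :
  0 < p -> (p%:E < q)%E -> 0 < lam -> 0 < c -> `|sg| <= 1 ->
  (forall f a, test f -> 0 <= a -> (a%:E <= 'N_q[f])%E ->
     ((lam * a `^ p)%:E <= \int[mu]_x (`|euclid (gradient f x)| `^ p)%:E)%E) ->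
  (forall f, test f -> 'N_q[f] \is a fin_num) ->
  (forall j, test (psi j)) -> (forall j, 'N_q[psi j] = 1%E) ->
  (forall j, (\int[mu]_x (`|euclid (gradient (psi j) x)| `^ p)%:E <=
     (lam + j.+1%:R^-1)%:E)%E) ->
  0 <= Kp -> (forall j, ('N_p%:E[psi j] <= Kp%:E)%E) ->
  measurable A -> A `<=` [set x : V | sg * x ord0 i <= 1] ->
  (forall j, (c%:E <= 'N_q[psi j \_ A])%E) ->
  forall e, 0 < e -> exists (L : R) (J : nat), forall j, (J <= j)%N ->
    ('N_q[psi j \_ [set x : V | (L <= sg * x ord0 i)%R]] <= e%:E)%E.
Proof.
move=> p0 pq lam0 c0 sg1 lamle Nfin tpsi N1 eng Kp0 pK mA AS cA e e0.
have q0 : (0 < q)%E by apply: lt_trans pq; rewrite lte_fin.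
have s0 : 0 <= einv q by exact/einv_ge0/ltW.
have [d d0 hd] := concentration_dichotomy p0 s0 (mul_einv_lt1 p0 pq) c0 e0.
pose K := lam + 1 + Kp `^ p.
have D0 := Dcut_ge0 p.
pose d' := lam * d / 2.
have d'0 : 0 < d' by rewrite divr_gt0// mulr_gt0.
have K0 : 0 <= K + 1 by rewrite /K; have := powR_ge0 Kp p; have := lam0; lra.
(* With M strips available, the best one costs at most Dcut (K + 1) / M <= d'. *)
pose M := (Num.truncn (Dcut p * (K + 1) / d')).+1.
have M0 : 0 < M%:R :> R by rewrite ltr0n.
have hM : Dcut p * ((K + 1) / M%:R) <= d'.
  rewrite mulrA ler_pdivrMr// [leRHS]mulrC -ler_pdivrMr//; apply: ltW.
  by rewrite /M truncnS_gt.
pose J := (Num.truncn d'^-1).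
have hJ j : (J <= j)%N -> j.+1%:R^-1 <= d'.
  move=> Jj; rewrite -[leRHS]invrK lef_pV2 ?posrE ?invr_gt0 ?ltr0n//.
  apply: ltW; apply: lt_le_trans (truncnS_gt _) _.
  by rewrite ler_nat ltnS.
exists (2 * M%:R + 2), J => j Jj.
set f := psi j; have tf : test f := tpsi j.
have Cf k : Ck k f by have /testP[] := tf.
have C1f := test_C1c tf; have mf := C1c_measurable C1f.
pose gp x := `|euclid (gradient f x)| `^ p.
pose fp x := `|f x| `^ p.
have mgE : measurable_fun setT (fun x => euclid (gradient f x)) by exact: measurable_gradient_euclid.
have mg : measurable_fun setT gp by have /measurable_EFinP := measurable_powR_norm p mgE.
have mfp : measurable_fun setT fp by have /measurable_EFinP := measurable_powR_norm p mf.
have gp0 x : 0 <= gp x by exact: powR_ge0.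
have fp0 x : 0 <= fp x by exact: powR_ge0.
pose F x := gp x + fp x.
have mF : measurable_fun setT F by exact: measurable_funD.
have F0 x : 0 <= F x by rewrite addr_ge0.
have FK : (\int[mu]_x (F x)%:E <= K%:E)%E.
  under eq_integral do rewrite EFinD.
  have mgp' : measurable_fun setT (fun x => (gp x)%:E : \bar R) by apply/measurable_EFinP.
  have mfp' : measurable_fun setT (fun x => (fp x)%:E : \bar R) by apply/measurable_EFinP.
  have gp0' x : (0 <= (gp x)%:E)%E by rewrite lee_fin.
  have fp0' x : (0 <= (fp x)%:E)%E by rewrite lee_fin.
  rewrite ge0_integralD//.
  rewrite /K EFinD; apply: leeD.
    apply: (le_trans (eng j)); rewrite lee_fin lerD2l invf_le1//.
    by rewrite ler1n.
  by rewrite -Lnorm_leP// pK.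
have [k kM hk] := strip_pigeonhole sg i mF F0 FK (ltn0Sn _ : (0 < M)%N).
(* s >= 1, so that A lies on the side where f1 coincides with f. *)
set s := 1 + 2 * k%:R in hk.
have s1 : 1 <= s by rewrite lerDl mulr_ge0.
pose f1 y := cutoff (- sg) (- (s + 2)) i y * f y.
pose f2 y := cutoff sg s i y * f y.
have t1 : test f1 by apply: test_mul => // l; exact: Ck_cutoff.
have t2 : test f2 by apply: test_mul => // l; exact: Ck_cutoff.
have mf1 := C1c_measurable (test_C1c t1).
have mf2 := C1c_measurable (test_C1c t2).
have m1E := measurable_powR_norm p (measurable_gradient_euclid (test_C1c t1)).
have m2E := measurable_powR_norm p (measurable_gradient_euclid (test_C1c t2)).
have f1E x : sg * x ord0 i <= s + 1 -> f1 x = f x.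
  by move=> h; rewrite /f1 (cutoff_left h) mul1r.
have f2E x : s + 1 <= sg * x ord0 i -> f2 x = f x.
  by move=> h; rewrite /f2 (cutoff_right h) mul1r.
pose e1 x := `|euclid (gradient f1 x)| `^ p.
pose e2 x := `|euclid (gradient f2 x)| `^ p.
have e12 x : e1 x + e2 x <= gp x + Dcut p * ((\1_(strip sg i s) x : R) * F x).
  exact: (gradient_cut_split_norm i s x p0 sg1 Cf).
pose g1 x : \bar R := (e1 x)%:E.
pose g2 x : \bar R := (e2 x)%:E.
have g10 x : (0 <= g1 x)%E by rewrite lee_fin powR_ge0.
have g20 x : (0 <= g2 x)%E by rewrite lee_fin powR_ge0.
have energies : (\int[mu]_x g1 x + \int[mu]_x g2 x <= (lam + lam * d)%:E)%E.
  have E := ge0_integralD mu measurableT (fun x _ => g10 x) m1E (fun x _ => g20 x) m2E.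
  rewrite -E {E}.
  apply: (@le_trans _ _ (\int[mu]_x ((gp x)%:E + (Dcut p)%:E * ((\1_(strip sg i s) x : R) * F x)%:E))%E).
    apply: ge0_le_integral => //.
    - by move=> x _; exact: (adde_ge0 (g10 x) (g20 x)).
    - exact: (emeasurable_funD m1E m2E).
    - apply: emeasurable_funD; first by apply/measurable_EFinP.
      apply: measurable_funeM; apply/measurable_EFinP; apply: measurable_funM => //.
      by apply: measurable_indic; exact: measurable_strip.
    - move=> x _; have := e12 x; rewrite -lee_fin EFinD [in leRHS]EFinD [in leRHS]EFinM.
      exact.
  have mI : measurable_fun setT (fun x => ((\1_(strip sg i s) x : R) * F x)%:E : \bar R).
    apply/measurable_EFinP; apply: measurable_funM => //.
    by apply: measurable_indic; exact: measurable_strip.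
  have I0 x : (0 <= ((\1_(strip sg i s) x : R) * F x)%:E)%E by rewrite lee_fin mulr_ge0.
  have mgp' : measurable_fun setT (fun x => (gp x)%:E : \bar R) by apply/measurable_EFinP.
  have gp0' x : (0 <= (gp x)%:E)%E by rewrite lee_fin.
  have mDI : measurable_fun setT (fun x => (Dcut p)%:E * ((\1_(strip sg i s) x : R) * F x)%:E)%E.
    exact: measurable_funeM.
  have DI0 x : (0 <= (Dcut p)%:E * ((\1_(strip sg i s) x : R) * F x)%:E)%E.
    by rewrite mule_ge0.
  rewrite ge0_integralD// ge0_integralZl//.
  apply: (@le_trans _ _ ((lam + j.+1%:R^-1)%:E + (Dcut p)%:E * ((K + 1) / M%:R)%:E)%E).
    by apply: leeD; [exact: eng|rewrite lee_wpmul2l].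
  rewrite -EFinM -EFinD lee_fin; have := hJ j Jj; move: hM; rewrite /d'.
  move: (Dcut p * _) (j.+1%:R^-1) (lam * d) => w1 w2 w3 h1 h2; lra.
pose a := fine 'N_q[f1]; pose b := fine 'N_q[f2].
have aE : 'N_q[f1] = a%:E by rewrite fineK// Nfin.
have bE : 'N_q[f2] = b%:E by rewrite fineK// Nfin.
have a0 : 0 <= a by rewrite fine_ge0// Lnorm_ge0.
have b0 : 0 <= b by rewrite fine_ge0// Lnorm_ge0.
have ab1 : a `^ p + b `^ p <= 1 + d.
  have la : ((lam * a `^ p)%:E <= \int[mu]_x g1 x)%E.
    by apply: lamle => //; rewrite aE.
  have lb : ((lam * b `^ p)%:E <= \int[mu]_x g2 x)%E.
    by apply: lamle => //; rewrite bE.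
  have := le_trans (leeD la lb) energies.
  rewrite -EFinD lee_fin => h; rewrite -(ler_pM2l lam0) mulrDr; apply: (le_trans h).
  by rewrite mulrDr mulr1.
have fmax x : `|f x| <= Num.max `|f1 x| `|f2 x|.
  rewrite le_max; have [h|h] := leP (sg * x ord0 i) (s + 1).
    by rewrite (f1E _ h) lexx.
  by rewrite (f2E _ (ltW h)) lexx orbT.
have ab2 : 1 <= Num.max a b `^ (1 - p * einv q) * (a `^ p + b `^ p) `^ (einv q).
  rewrite -lee_fin -(N1 j); apply: (Lnorm_split_le p0 pq a0 b0 mf mf1 mf2 fmax); first by rewrite aE.
  by rewrite bE.
have ca : c <= a.
  rewrite -lee_fin -aE; apply: (le_trans (cA j)); apply: le_Lnorm => //.
    exact: measurable_patch.
  move=> x; rewrite patchE; case: ifPn => [|_]; last by rewrite normr0.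
  rewrite inE => /AS /= h; rewrite f1E//; apply: (le_trans h).
  by rewrite (le_trans s1)// lerDl ler01.
apply: (@le_trans _ _ 'N_q[f2]%E).
  apply: le_Lnorm => //.
    by apply: measurable_patch => //; exact: measurable_halfspace.
  move=> x; rewrite patchE; case: ifPn => [|_]; last by rewrite normr0.
  rewrite inE /= => h; rewrite f2E//; apply: le_trans h.
  by apply: two_lines; rewrite ler_nat ltnW.
by rewrite bE lee_fin; apply: hd ca ab1 ab2.
Qed.

End tightness.

(** * Uniform convexity of the p-th power of the Euclidean norm *)

Section uniform_convexity.
Context (R : realType).
Implicit Types (p t u x y a b : R).

(** From ln t > 1 - 1/t and exp y >= 1 + y, after dividing by t. *)
Lemma bernoulli_strict p t : 1 < p -> 0 < t -> t != 1 ->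
  1 + p * (t - 1) < t `^ p.
Proof.
move=> p1 t0 t1.
have lnt : 1 - t^-1 < ln t.
  have lnt0 : - ln t != 0.
    rewrite oppr_eq0; apply: contra t1 => /eqP h.
    by rewrite -(lnK t0) h expR0.
  have := expR_gt1Dx lnt0; rewrite expRN lnK ?posrE//; lra.
have h1 : 1 + (p - 1) * (1 - t^-1) < t `^ (p - 1).
  rewrite /powR gt_eqF//.
  apply: le_lt_trans (expR_ge1Dx _) _.
  by rewrite ltr_expR ltr_pM2l// subr_gt0.
have -> : t `^ p = t * t `^ (p - 1) by rewrite mulr_powRB1 ?(ltW t0)// (lt_trans ltr01).
have -> : 1 + p * (t - 1) = t * (1 + (p - 1) * (1 - t^-1)) by field; rewrite gt_eqF.
by rewrite ltr_pM2l.
Qed.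

Lemma bernoulli p t : 1 < p -> 0 <= t -> 1 + p * (t - 1) <= t `^ p.
Proof.
move=> p1; rewrite le_eqVlt => /predU1P[<-|t0].
  rewrite powR0 ?gt_eqF ?(lt_trans ltr01)//; lra.
have [->|t1] := eqVneq t 1; first by rewrite subrr mulr0 addr0 powR1.
exact/ltW/bernoulli_strict.
Qed.

Lemma powR_sum_ge2 p u : 1 < p -> `|u| <= 1 -> 2 <= (1 + u) `^ p + (1 - u) `^ p.
Proof.
move=> p1; rewrite ler_norml => /andP[u1 u2].
have h1 : 0 <= 1 + u by lra.
have h2 : 0 <= 1 - u by lra.
have := bernoulli p1 h1; have := bernoulli p1 h2; lra.
Qed.

(** Convexity of t^p makes the excess at u0 propagate to every u >= u0: [bernoulli]
    at (1 + u)/(1 + u0) bounds (1 + u)^p from below by its tangent at u0, of slope at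
    least p, which compensates the slope -p of the lower bound for (1 - u)^p. *)
Lemma powR_sum_gap p u0 : 1 < p -> 0 < u0 -> exists2 be : R, 0 < be &
  forall u, u0 <= u <= 1 -> 2 + be <= (1 + u) `^ p + (1 - u) `^ p.
Proof.
move=> p1 u00.
have t0 : 0 < 1 + u0 by lra.
exists ((1 + u0) `^ p - (1 + p * u0)).
  have := @bernoulli_strict p (1 + u0) p1 t0; rewrite addrAC subrr add0r subr_gt0; apply.
  by rewrite gt_eqF// ltrDl.
move=> u /andP[u0u u1].
have h2 : 0 <= 1 - u by lra.
have b2 := bernoulli p1 h2.
have r0 : 0 <= (1 + u) / (1 + u0) by rewrite divr_ge0//; lra.
have b1 := bernoulli p1 r0.
have e1 : (1 + u) `^ p = (1 + u0) `^ p * ((1 + u) / (1 + u0)) `^ p.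
  rewrite -powRM ?(ltW t0)//; congr (_ `^ _); field; rewrite gt_eqF//.
have b0 : 1 + u0 <= (1 + u0) `^ p.
  have := bernoulli p1 (ltW t0); apply: le_trans.
  rewrite addrAC subrr add0r lerD2l ler_peMl//; exact: ltW.
have key : (1 + u0) `^ p + p * (u - u0) <= (1 + u) `^ p.
  rewrite e1; apply: (@le_trans _ _ ((1 + u0) `^ p * (1 + p * ((1 + u) / (1 + u0) - 1)))); last first.
    by rewrite ler_wpM2l ?powR_ge0.
  have -> : (1 + u) / (1 + u0) - 1 = (u - u0) / (1 + u0) by field; rewrite gt_eqF.
  rewrite [leRHS]mulrDr mulr1 lerD2l.
  have -> : (1 + u0) `^ p * (p * ((u - u0) / (1 + u0))) =
     (p * (u - u0)) * ((1 + u0) `^ p / (1 + u0)) by ring.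
  rewrite ler_peMr//; last by rewrite ler_pdivlMr// mul1r.
  by rewrite mulr_ge0 ?subr_ge0// ltW// (lt_trans ltr01).
lra.
Qed.

Lemma powR_mean_le p x y : 1 < p -> 0 <= x -> 0 <= y ->
  2 * ((x + y) / 2) `^ p <= x `^ p + y `^ p.
Proof.
move=> p1 x0 y0; have p0 : 0 < p by exact: lt_trans p1.
have [t0|t0] := ltP 0 (x + y); last first.
  have -> : x + y = 0 by apply/eqP; rewrite eq_le t0 addr_ge0.
  by rewrite mul0r powR0 ?gt_eqF// mulr0 addr_ge0 ?powR_ge0.
set t := (x + y) / 2.
have tp : 0 < t by rewrite divr_gt0.
pose u := (x - y) / (x + y).
have u1 : `|u| <= 1.
  rewrite normrM normfV (gtr0_norm t0) ler_pdivrMr// mul1r ler_norml.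
  by apply/andP; split; lra.
have := powR_sum_ge2 p1 u1.
have xE : x = t * (1 + u) by rewrite /t /u; field; rewrite gt_eqF.
have yE : y = t * (1 - u) by rewrite /t /u; field; rewrite gt_eqF.
move: u1; rewrite ler_norml => /andP[u1 u2].
have h1 : 0 <= 1 + u by lra.
have h2 : 0 <= 1 - u by lra.
rewrite xE yE (powRM p (ltW tp) h1) (powRM p (ltW tp) h2) -mulrDr (mulrC 2) => h.
by rewrite ler_wpM2l ?powR_ge0.
Qed.

(** The numbers x, y, m, d stand for the norms of a, b, (a + b)/2 and a - b; the
    hypotheses are the parallelogram identity and two triangle inequalities.
    If d^p is not already bounded by the first term, then d > ka t with
    t = (x + y)/2.  Either x and y differ by a fraction of t, and
    [powR_sum_gap] gives a gap between (x^p + y^p)/2 and t^p; or they nearly agree,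
    and the identity forces m <= w t with w < 1.  In both cases the convexity gap
    is at least de (x^p + y^p), which exceeds a multiple of d^p. *)
Lemma uniform_convexity_real p e : 1 < p -> 0 < e -> exists2 C : R, 0 <= C &
  forall x y m d, 0 <= x -> 0 <= y -> 0 <= m -> 0 <= d ->
    m ^+ 2 + d ^+ 2 / 4 = (x ^+ 2 + y ^+ 2) / 2 -> m <= (x + y) / 2 -> d <= x + y ->
    d `^ p <= e * (x `^ p + y `^ p) + C * ((x `^ p + y `^ p) / 2 - m `^ p).
Proof.
move=> p1 e0; have p0 : 0 < p by exact: lt_trans p1.
(* If d <= ka t, then d^p <= 2 e t^p <= e (x^p + y^p) and nothing is left to prove. *)
pose ka := Num.min ((2 * e) `^ p^-1) 1.
have ka0 : 0 < ka by rewrite lt_min ltr01 andbT powR_gt0// mulr_gt0.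
have ka1 : ka <= 1 by rewrite ge_min lexx orbT.
have kap : ka `^ p <= 2 * e.
  have -> : 2 * e = ((2 * e) `^ p^-1) `^ p.
    by rewrite -powRrM mulVf ?gt_eqF// powRr1// mulr_ge0// ltW.
  apply: ge0_ler_powR; rewrite ?nnegrE ?powR_ge0 ?(ltW p0) ?(ltW ka0)//.
  by rewrite /ka ge_min lexx.
have u00 : 0 < ka / 4 by rewrite divr_gt0.
have [be be0 hbe] := powR_sum_gap p1 u00.
(* If |x - y|/2 < ka t/4 and d > ka t, the identity gives
   m^2 <= t^2 + (ka t/4)^2 - (ka t)^2/4 = (w t)^2. *)
pose w := Num.sqrt (1 - 3 * ka ^+ 2 / 16).
have w2 : w ^+ 2 = 1 - 3 * ka ^+ 2 / 16.
  rewrite sqr_sqrtr//.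
  have : ka ^+ 2 <= 1 by rewrite expr_le1// ltW.
  lra.
have w0 : 0 <= w by exact: sqrtr_ge0.
have w1 : w < 1.
  rewrite -(@ltr_pXn2r _ 2)// ?nnegrE// w2 expr1n.
  have : 0 < ka ^+ 2 by rewrite exprn_gt0.
  lra.
have wp : w `^ p < 1.
  have -> : 1 = 1 `^ p :> R by rewrite powR1.
  by apply: gt0_ltr_powR; rewrite ?nnegrE.
pose de := Num.min ((1 - (1 + be / 2)^-1) / 2) ((1 - w `^ p) / 2).
have de0 : 0 < de.
  rewrite lt_min; apply/andP; split; last by rewrite divr_gt0// subr_gt0.
  by rewrite divr_gt0// subr_gt0 invf_lt1; lra.
exists (2 `^ p / de); first by rewrite divr_ge0 ?powR_ge0// ltW.
move=> x y m d x0 y0 m0 d0 par mxy dxy.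
set S := x `^ p + y `^ p.
have S0 : 0 <= S by rewrite addr_ge0 ?powR_ge0.
set t := (x + y) / 2.
have tS : 2 * t `^ p <= S by exact: powR_mean_le.
have t0 : 0 <= t by rewrite divr_ge0// addr_ge0.
have mt : m `^ p <= t `^ p by apply: ge0_ler_powR; rewrite ?nnegrE ?(ltW p0).
have Del0 : 0 <= S / 2 - m `^ p by lra.
have C0 : 0 <= 2 `^ p / de by rewrite divr_ge0 ?powR_ge0// ltW.
have [hd|hd] := leP (d `^ p) (e * S).
  by rewrite (le_trans hd)// lerDl mulr_ge0.
apply: (@le_trans _ _ (2 `^ p / de * (S / 2 - m `^ p))); last first.
  by rewrite lerDr mulr_ge0// ltW.
suff claim : de * S <= S / 2 - m `^ p.
  apply: (@le_trans _ _ (2 `^ p * S)).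
    apply: (@le_trans _ _ ((2 * t) `^ p)).
      have -> : 2 * t = x + y by rewrite /t mulrC divfK.
      by apply: ge0_ler_powR; rewrite ?nnegrE ?(ltW p0) ?addr_ge0.
    rewrite powRM// ler_wpM2l ?powR_ge0//; have := powR_ge0 t p; lra.
  by rewrite -mulrA ler_wpM2l ?powR_ge0// mulrC ler_pdivlMr// mulrC.
have tpos : 0 < t.
  rewrite lt_neqAle t0 andbT eq_sym; apply/negP => /eqP t00.
  have xy0 : x + y = 0 by move: t00; rewrite /t; lra.
  have d00 : d = 0 by apply/eqP; rewrite eq_le d0 andbT -xy0.
  by move: hd; rewrite d00 powR0 ?gt_eqF// ltNge mulr_ge0// ltW.
have dka : ka * t < d.
  rewrite ltNge; apply/negP => dle.
  have : d `^ p <= (ka * t) `^ p.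
    have kt0 : 0 <= ka * t by rewrite mulr_ge0// ltW.
    by apply: ge0_ler_powR; rewrite ?nnegrE ?(ltW p0).
  rewrite powRM// ?(ltW ka0)// => h.
  have h2 : ka `^ p * t `^ p <= e * S.
    apply: (@le_trans _ _ (2 * e * t `^ p)); first by rewrite ler_wpM2r ?powR_ge0.
    by rewrite (mulrC 2) -mulrA ler_wpM2l// ltW.
  by move: (le_lt_trans h2 hd); rewrite ltNge h.
have [caseA|caseB] := leP (ka / 4 * t) (`|x - y| / 2).
  pose u := `|x - y| / (x + y).
  have xy0 : 0 < x + y by move: tpos; rewrite /t; lra.
  have uE : u = (`|x - y| / 2) / t by rewrite /u /t; field; rewrite gt_eqF.
  have u1 : ka / 4 <= u <= 1.
    rewrite uE ler_pdivlMr// caseA /= ler_pdivrMr// mul1r /t.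
    rewrite ler_pM2r ?invr_gt0// ler_norml; apply/andP; split; lra.
  have SE : S = t `^ p * ((1 + u) `^ p + (1 - u) `^ p).
    have /andP[ua ub] := u1.
    have h1 : 0 <= 1 + u by lra.
    have h2 : 0 <= 1 - u by lra.
    rewrite mulrDr -!powRM// /S /t /u.
    have [xy|xy] := leP y x.
      rewrite ger0_norm ?subr_ge0//.
      by congr (_ `^ _ + _ `^ _); field; rewrite gt_eqF.
    rewrite ltr0_norm ?subr_lt0// addrC.
    by congr (_ `^ _ + _ `^ _); field; rewrite gt_eqF.
  have h := hbe u u1.
  have tb : t `^ p <= (1 + be / 2)^-1 * (S / 2).
    rewrite mulrC ler_pdivlMr; last by lra.
    rewrite SE; have := ler_wpM2l (powR_ge0 t p) h; lra.
  have d1 : de <= (1 - (1 + be / 2)^-1) / 2 by rewrite ge_min lexx.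
  have := ler_wpM2r S0 d1; lra.
have mwt : m <= w * t.
  suff : m ^+ 2 <= (w * t) ^+ 2 by rewrite ler_pXn2r ?nnegrE ?(mulr_ge0 w0 t0).
  rewrite exprMn w2.
  have e1 : t ^+ 2 + (`|x - y| / 2) ^+ 2 = (x ^+ 2 + y ^+ 2) / 2.
    rewrite /t !expr_div_n real_normK ?num_real//; by field.
  have e2 : (`|x - y| / 2) ^+ 2 <= ka ^+ 2 * t ^+ 2 / 16.
    have -> : ka ^+ 2 * t ^+ 2 / 16 = (ka / 4 * t) ^+ 2 by field.
    by apply: lerXn2r; rewrite ?nnegrE ?divr_ge0// ?(mulr_ge0 (ltW u00) t0) ?(ltW caseB).
  have e3 : ka ^+ 2 * t ^+ 2 <= d ^+ 2.
    rewrite -exprMn.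
    by apply: lerXn2r; rewrite ?nnegrE ?(mulr_ge0 (ltW ka0) t0) ?(ltW dka).
  move: par e1 e2 e3; rewrite -/t.
  move: (ka ^+ 2) (t ^+ 2) (d ^+ 2) (m ^+ 2) ((`|x - y| / 2) ^+ 2) ((x ^+ 2 + y ^+ 2) / 2).
  move=> K T D M Q P e4 e1 e2 e3.
  have -> : (1 - 3 * K / 16) * T = T - 3 * (K * T) / 16 by field.
  move: (K * T) e2 e3 => z e2 e3; lra.
have mp : m `^ p <= w `^ p * (S / 2).
  apply: (@le_trans _ _ ((w * t) `^ p)).
    by apply: ge0_ler_powR; rewrite ?nnegrE ?(ltW p0) ?(mulr_ge0 w0 t0).
  by rewrite powRM// ler_wpM2l ?powR_ge0//; lra.
have d1 : de <= (1 - w `^ p) / 2 by rewrite ge_min lexx orbT.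
have := ler_wpM2r S0 d1; lra.
Qed.

Lemma uniform_convexity_euclid (n : nat) p e : 1 < p -> 0 < e -> exists2 C : R, 0 <= C &
  forall a b : 'rV[R]_n, euclid (a - b) `^ p <=
    e * (euclid a `^ p + euclid b `^ p) +
    C * ((euclid a `^ p + euclid b `^ p) / 2 - euclid (2^-1 *: (a + b)) `^ p).
Proof.
move=> p1 e0; have [C C0 hC] := uniform_convexity_real p1 e0; exists C => // a b.
have mE : euclid (2^-1 *: (a + b)) = euclid (a + b) / 2.
  by rewrite euclidZ ger0_norm ?invr_ge0// mulrC.
apply: hC; rewrite ?euclid_ge0//.
- rewrite mE; have := parallelogram a b; rewrite expr_div_n.
  move: (euclid (a + b) ^+ 2) (euclid (a - b) ^+ 2) (euclid a ^+ 2) (euclid b ^+ 2) => P Q S T.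
  lra.
- by rewrite mE ler_pM2r ?invr_gt0// ler_euclidD.
- by rewrite (le_trans (ler_euclidD _ _))// euclidN.
Qed.
End uniform_convexity.

(** * Compactness in L^q along an ultrafilter *)

Section compactness.
Context (R : realType) (n : nat) (Omega : set 'rV[R]_n).
Local Notation V := 'rV[R]_n.
Local Notation mu := (@lebesgue_rV R n).
Implicit Types (f g : V -> R) (x y v : V) (K a p : R).
Local Notation "'N_ q [ f ]" := (Lnorm mu q (EFin \o f)).

Lemma partial_sub f g i x : test_function Omega f -> test_function Omega g ->
  partial i (fun y => f y - g y) x = partial i f x - partial i g x.
Proof.
move=> tf tg; have Cf := test_C1c tf; have Cg := test_C1c tg.
by rewrite /partial deriveB//; exact: C1c_der.
Qed.

Lemma ultra_bounded (U : set_system nat) (a : nat -> R) (M : R) : UltraFilter U ->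
  (forall j, `|a j| <= M) -> exists l : R, forall d : R, 0 < d -> U [set j | `|a j - l| <= d].
Proof.
move=> Uu aM; have UP : ProperFilter U by exact: ultra_proper.
have aF : (a @ U) `[- M, M]%classic.
  by apply: (@filterS _ U _ setT); [move=> j _ /=; rewrite in_itv/= -ler_norml; exact: aM|exact: filterT].
have [l [_ cl]] := @segment_compact R (- M) M (a @ U) (fmap_proper_filter a UP) aF.
exists l => d d0.
have [//|h] := in_ultra_setVsetC [set j | `|a j - l| <= d] Uu.
have F1 : (a @ U) [set y | ~ `|y - l| <= d] by [].
have [y [/= ny ly]] := cl _ _ F1 (nbhsx_ballx l d d0).
by exfalso; apply: ny; rewrite distrC ltW.
Qed.

Definition centered_box (L : R) : set V := [set x | forall i, `|x ord0 i| <= L].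

Lemma measurable_centered_box L : measurable (centered_box L).
Proof.
apply: (measurable_box (A := fun=> [set t | `|t| <= L])) => i.
rewrite (_ : [set t : R | _] = `[- L, L]%classic); first exact: measurable_itv.
by apply/seteqP; split => t /=; rewrite in_itv/= ler_norml.
Qed.

Lemma box_cells (L : R) (m : nat) : exists (B : nat),
  forall x, centered_box L x -> exists g : {ffun 'I_n -> 'I_(B.*2.+1)},
    cell m x = \row_i ((g i)%:Z - B%:Z).
Proof.
pose B := Num.bound (2 ^+ m * L + 1).
exists B => x xL.
have hB i : (`|Num.floor (2 ^+ m * x ord0 i)| <= B%:Z)%R.
  have [L0|L0] := ltP L 0.
    by have := xL i; rewrite leNgt (lt_le_trans L0).
  have b1 : 2 ^+ m * L + 1 < B%:R.
    apply: le_lt_trans (archi_boundP _); first exact: lexx.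
    by rewrite addr_ge0// mulr_ge0// exprn_ge0.
  have b2 : `|2 ^+ m * x ord0 i| <= 2 ^+ m * L.
    by rewrite normrM ger0_norm ?exprn_ge0// ler_wpM2l ?exprn_ge0.
  move: b2; rewrite !ler_norml => /andP[b2 b3].
  have f1 := ge_floor (2 ^+ m * x ord0 i).
  have f2 := lt_succ_floor (2 ^+ m * x ord0 i).
  rewrite -!(ler_int R) intrN -!pmulrn.
  move: f2; rewrite intrD /= => f2; lra.
(* Shifting by B makes the index of every cube in the box a natural number. *)
exists [ffun i => inord (absz (Num.floor (2 ^+ m * x ord0 i) + B%:Z))].
apply/rowP => i; rewrite !mxE ffunE.
have := hB i; move: (Num.floor _) => z; rewrite ler_norml => /andP[z1 z2].
have z0 : 0 <= z + B%:Z by rewrite -lerBlDr sub0r.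
rewrite inordK ?gez0_abs ?addrK//.
rewrite ltnS -lez_nat gez0_abs// -addnn PoszD lerD2r//.
Qed.

Context (p A K : R) (q : \bar R) (psi : nat -> V -> R) (U : set_system nat).
Hypothesis p1 : 1 < p.
Hypothesis pq : (p%:E < q)%E.
Hypothesis subcritical : n%:R * (p^-1 - einv q) < 1.
Hypothesis A0 : 0 <= A.
Hypothesis K0 : 0 <= K.
Hypothesis tpsi : forall j, test_function Omega (psi j).
Hypothesis psiA : forall j, ('N_p%:E[psi j] <= A%:E)%E.
Hypothesis psiK : forall j i, ('N_p%:E[partial i (psi j)] <= K%:E)%E.
Hypothesis Uu : UltraFilter U.
Hypothesis Uoo : \oo `<=` U.

Let p0 : 0 < p. Proof. exact: lt_trans p1. Qed.
Let p1' : 1 <= p. Proof. exact: ltW. Qed.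
Let q1 : (1 <= q)%E. Proof. by apply: (le_trans _ (ltW pq)). Qed.
Let q0 : (0 < q)%E. Proof. exact: lt_le_trans q1. Qed.
Let ps1 : p * einv q < 1. Proof. exact: mul_einv_lt1. Qed.
Let UP : ProperFilter U. Proof. exact: ultra_proper. Qed.

(** Only finitely many cubes meet the box, and each average converges along the
    ultrafilter.  The ultrafilter replaces a diagonal extraction over all scales
    and all cubes. *)
Lemma ultra_avg_cauchy (L d : R) (m : nat) : 0 < d ->
  exists2 S, U S & forall j j', S j -> S j' -> forall x, centered_box L x ->
    `|avg m (psi j) x - avg m (psi j') x| <= d.
Proof.
move=> d0; have [B hB] := box_cells L m.
pose M := (vol R n m)^-1 `^ p^-1 * (A + Cavg R n * (2 ^+ m)^-1 * K).
have AK0 : 0 <= A + Cavg R n * (2 ^+ m)^-1 * K.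
  by rewrite addr_ge0// mulr_ge0// mulr_ge0 ?Cavg_ge0// invr_ge0 exprn_ge0.
have aM j x : `|avg m (psi j) x| <= M.
  apply: (step_sup (m := m) p0 AK0).
    by move=> y z; exact: avg_cell.
  by apply: Lnorm_avg_le => //; exact: test_C1c.
pose c (g : {ffun 'I_n -> 'I_(B.*2.+1)}) : V := corner R m (\row_i ((g i)%:Z - B%:Z)).
have /choice[l hl] (g : {ffun 'I_n -> 'I_(B.*2.+1)}) :
    exists l : R, forall d : R, 0 < d -> U [set j | `|avg m (psi j) (c g) - l| <= d].
  by apply: (@ultra_bounded U _ M).
have d2 : 0 < d / 2 by rewrite divr_gt0.
have h := @filter_forall _ _ (fun g : {ffun 'I_n -> 'I_(B.*2.+1)} => [set j | `|avg m (psi j) (c g) - l g| <= d / 2]) U _ (fun g : {ffun 'I_n -> 'I_(B.*2.+1)} => hl g _ d2).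
exists [set j | forall g : {ffun 'I_n -> 'I_(B.*2.+1)}, `|avg m (psi j) (c g) - l g| <= d / 2]; first exact: h.
move=> j j' /= hj hj' x /hB[g gx].
have cx : cell m x = cell m (c g) by rewrite /c cell_corner.
rewrite (avg_cell (psi j) cx) (avg_cell (psi j') cx).
rewrite (_ : _ - _ = (avg m (psi j) (c g) - l g) - (avg m (psi j') (c g) - l g)); last by ring.
by rewrite (le_trans (ler_normB _ _))// (splitr d) lerD.
Qed.

Hypothesis tail : forall e : R, 0 < e -> exists (L : R) (J : nat), forall j, (J <= j)%N ->
  ('N_q[psi j \_ (~` centered_box L)] <= e%:E)%E.

(** Let f be the difference of two terms.  Outside a box f is small by the tails;
    inside, f is close to its averages by [avg_sobolev], and the averages are
    uniformly small, hence small in L^q by [Lnorm_interp]. *)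
Lemma ultra_Lnorm_cauchy (e : R) : 0 < e -> exists2 S, U S &
  forall j j', S j -> S j' -> ('N_q[(fun x => psi j x - psi j' x)%R] <= e%:E)%E.
Proof.
move=> e0; have e4 : 0 < e / 4 by rewrite divr_gt0.
have [C [rho [C0 rho0 rho1 hC]]] := avg_sobolev p1' pq subcritical.
have [m hm] : exists m, C * rho ^+ m * (K + K) <= e / 4.
  have : C * rho ^+ m * (K + K) @[m --> \oo] --> C * 0 * (K + K).
    apply: cvgM; last exact: cvg_cst.
    apply: cvgM; first exact: cvg_cst.
    by apply: cvg_expr; rewrite ger0_norm.
  rewrite mulr0 mul0r => /cvgr0Pnorm_le/(_ _ e4)[m _ /(_ m (leqnn m))/= h].
  by exists m; rewrite (le_trans (ler_norm _)).
have [L [J hJ]] := tail e4.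
pose A2 := (A + A) + Cavg R n * (2 ^+ m)^-1 * (K + K) + 1.
have c0 : 0 <= Cavg R n * (2 ^+ m)^-1 * (K + K).
  by rewrite !mulr_ge0 ?Cavg_ge0 ?addr_ge0// invr_ge0 exprn_ge0.
have A20 : 0 < A2 by rewrite ltr_wpDl// !addr_ge0.
have r0 : 0 < 1 - p * einv q by rewrite subr_gt0.
(* The solution of d^(1-ps) A2^(ps) = e/4. *)
pose d := (e / 4 / A2 `^ (p * einv q)) `^ (1 - p * einv q)^-1.
have d0 : 0 < d by rewrite powR_gt0// divr_gt0// powR_gt0.
have dE : d `^ (1 - p * einv q) * A2 `^ (p * einv q) = e / 4.
  rewrite /d -powRrM mulVf ?gt_eqF// powRr1 ?divr_ge0 ?powR_ge0 ?(ltW e0)//.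
  by rewrite divfK// gt_eqF// powR_gt0.
have [S US hS] := ultra_avg_cauchy L m d0.
exists (S `&` [set j | (J <= j)%N]).
  by apply: filterI => //; apply: Uoo; exists J.
move=> j j' [/= Sj Jj] [Sj' Jj'].
pose f := fun x => psi j x - psi j' x.
have tf : test_function Omega f by exact: test_sub.
have Cf := test_C1c tf; have mf := C1c_measurable Cf.
have mpsi k := C1c_measurable (test_C1c (tpsi k)).
have mB := measurable_centered_box L; have mBc := measurableC mB.
have fA : ('N_p%:E[f] <= (A + A)%:E)%E by exact: LnormB_le.
have fK i : ('N_p%:E[partial i f] <= (K + K)%:E)%E.
  rewrite (_ : partial i f = fun x => partial i (psi j) x - partial i (psi j') x).
    by apply: LnormB_le => //; apply: C1c_measurable_partial; exact: test_C1c.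
  by apply/funext => x; exact: partial_sub.
have KK : 0 <= K + K by rewrite addr_ge0.
have ma := measurable_avg m f.
have h1 := hC f _ m Cf KK fK.
have aL := @Lnorm_avg_le R n p f m _ _ p1' Cf KK fA fK.
have h2 : ('N_q[avg m f \_ (centered_box L)] <= (e / 4)%:E)%E.
  rewrite -dE; apply: Lnorm_interp => //; first exact: ltW; first exact: ltW.
  - exact: measurable_patch.
  - move=> x; rewrite patchE; case: ifPn => [|_]; last by rewrite normr0 ltW.
    rewrite inE => xL; rewrite avgB; [|exact: test_C1c..].
    exact: hS.
  - apply: (@le_trans _ _ 'N_p%:E[avg m f]).
      apply: le_Lnorm => //; first exact: measurable_patch.
      by move=> x; rewrite patchE; case: ifP => _; rewrite ?normr0.
    by apply: (le_trans aL); rewrite lee_fin /A2 lerDl.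
have h3 : ('N_q[(fun x => f x - avg m f x)%R \_ (centered_box L)] <= (e / 4)%:E)%E.
  apply: (@le_trans _ _ 'N_q[(fun x => f x - avg m f x)%R]).
    have mg : measurable_fun setT (fun x => f x - avg m f x) by exact: measurable_funB.
    apply: le_Lnorm => //; first exact: measurable_patch.
    by move=> x; rewrite patchE; case: ifP => _; rewrite ?normr0.
  by apply: (le_trans h1); rewrite lee_fin.
have mg : measurable_fun setT ((fun x => f x - avg m f x) \_ (centered_box L)).
  by apply: measurable_patch => //; exact: measurable_funB.
have ma' : measurable_fun setT (avg m f \_ (centered_box L)) by exact: measurable_patch.
have mt k : measurable_fun setT (psi k \_ (~` centered_box L)) by exact: measurable_patch.
have h4 := LnormB_le q1 (mt j) (mt j') (hJ j Jj) (hJ j' Jj').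
have h5 := LnormD_le q1 mg ma' h3 h2.
have h6 := LnormD_le q1 (measurable_funD mg ma') (measurable_funB (mt j) (mt j')) h5 h4.
have E : (fun x => (((fun x => f x - avg m f x) \_ (centered_box L)) \+ (avg m f \_ (centered_box L))) x +
   ((psi j \_ (~` centered_box L)) \- (psi j' \_ (~` centered_box L))) x) = f.
  apply/funext => x /=; rewrite !patchE in_setC; case: ifP => _ /=.
    by rewrite subrK subr0 addr0.
  by rewrite !add0r.
rewrite E in h6.
apply: (le_trans h6); rewrite lee_fin; lra.
Qed.

End compactness.

(** * From half-spaces to boxes *)

Section tails.
Context (R : realType) (n : nat).
Local Notation V := 'rV[R]_n.
Local Notation mu := (@lebesgue_rV R n).
Implicit Types (f : V -> R) (K a : R).
Local Notation "'N_ q [ f ]" := (Lnorm mu q (EFin \o f)).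

Lemma Lnorm_sum_le q (I : Type) (s : seq I) (g : I -> V -> R) a : (1 <= q)%E ->
  (forall i, measurable_fun setT (g i)) -> (forall i, ('N_q[g i] <= a%:E)%E) ->
  ('N_q[(fun x => \sum_(i <- s) g i x)%R] <= ((size s)%:R * a)%:E)%E.
Proof.
move=> q1 mg ga; elim: s => [|i s IH].
  rewrite (_ : (fun x => _) = cst 0); last by apply/funext => x; rewrite big_nil.
  by rewrite Lnorm0 ?mul0r// gt_eqF// (lt_le_trans _ q1).
rewrite (_ : (fun x => _) = fun x => g i x + \sum_(i <- s) g i x); last first.
  by apply/funext => x; rewrite big_cons.
rewrite -natr1 mulrDl mul1r addrC; apply: LnormD_le => //.
by apply: measurable_sum.
Qed.

(** The complement of a box is covered by 2n half-spaces. *)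
Lemma box_tail q (psi : nat -> V -> R) : (1 <= q)%E ->
  (forall j, measurable_fun setT (psi j)) ->
  (forall (sg : R) i e, (sg == 1) || (sg == -1) -> 0 < e ->
    exists (L : R) (J : nat), forall j, (J <= j)%N ->
      ('N_q[psi j \_ [set x : V | (L <= sg * x ord0 i)%R]] <= e%:E)%E) ->
  forall e, 0 < e -> exists (L : R) (J : nat), forall j, (J <= j)%N ->
    ('N_q[psi j \_ (~` centered_box L)] <= e%:E)%E.
Proof.
move=> q1 mpsi h e e0.
have q0 : (0 < q)%E by exact: lt_le_trans q1.
pose e' := e / (n%:R * 2 + 1).
have n0 : 0 < n%:R * 2 + 1 :> R by rewrite ltr_wpDl// mulr_ge0.
have e'0 : 0 < e' by rewrite divr_gt0.
have s1 : ((1 : R) == 1) || ((1 : R) == -1) by rewrite eqxx.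
have s2 : ((-1 : R) == 1) || ((-1 : R) == -1) by rewrite eqxx orbT.
have /choice[L1 /choice[J1 h1]] := fun i => h 1 i e' s1 e'0.
have /choice[L2 /choice[J2 h2]] := fun i => h (-1) i e' s2 e'0.
pose L := \big[Num.max/0]_i (Num.max (L1 i) (L2 i)).
have LL i : L1 i <= L /\ L2 i <= L.
  have : Num.max (L1 i) (L2 i) <= L by exact: le_bigmax.
  by rewrite ge_max => /andP.
exists L, (\max_i (maxn (J1 i) (J2 i)))%N => j Jj.
have Jj' i : (J1 i <= j)%N /\ (J2 i <= j)%N.
  by apply/andP; rewrite -geq_max (leq_trans _ Jj)// (@leq_bigmax _ (fun i => maxn (J1 i) (J2 i)) i).
pose g i x := `|(psi j \_ [set x : V | L1 i <= 1 * x ord0 i]) x| +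
  `|(psi j \_ [set x : V | L2 i <= -1 * x ord0 i]) x|.
have m1 i : measurable_fun setT (psi j \_ [set x : V | L1 i <= 1 * x ord0 i]).
  by apply: measurable_patch => //; exact: measurable_halfspace.
have m2 i : measurable_fun setT (psi j \_ [set x : V | L2 i <= -1 * x ord0 i]).
  by apply: measurable_patch => //; exact: measurable_halfspace.
have mg i : measurable_fun setT (g i).
  by apply: measurable_funD; exact: measurableT_comp.
have g0 i x : 0 <= g i x by rewrite addr_ge0.
have gle i : ('N_q[g i] <= (e' + e')%:E)%E.
  apply: LnormD_le => //; try exact: measurableT_comp.
    have [J1j _] := Jj' i; apply: le_trans (h1 i j J1j).
    by apply: le_Lnorm => //; [exact: measurableT_comp|move=> x; rewrite normr_id].
  have [_ J2j] := Jj' i; apply: le_trans (h2 i j J2j).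
  by apply: le_Lnorm => //; [exact: measurableT_comp|move=> x; rewrite normr_id].
have := Lnorm_sum_le (index_enum 'I_n) q1 mg gle.
have mb : measurable_fun setT (psi j \_ (~` centered_box L)).
  by apply: measurable_patch => //; apply: measurableC; exact: measurable_centered_box.
move=> hs; apply: (@le_trans _ _ 'N_q[(fun x => \sum_i g i x)%R]).
  apply: le_Lnorm => //; first exact: measurable_sum.
  move=> x; rewrite patchE; case: ifPn => [|_]; last by rewrite normr0.
  rewrite in_setC => /negP xL; rewrite [leRHS]ger0_norm ?sumr_ge0//.
  have [i xi] : exists i, ~ `|x ord0 i| <= L.
    by apply/existsNP => hx; apply: xL; rewrite inE.
  rewrite (bigD1 i)//=. apply: (@le_trans _ _ (g i x)); last by rewrite lerDl sumr_ge0.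
  move/negP : xi; rewrite -ltNge lter_normr; have [L1L L2L] := LL i => /orP[xi|xi].
    rewrite /g !patchE mem_set/=; last by rewrite mul1r (le_trans L1L)// ltW.
    by rewrite lerDl.
  rewrite /g !patchE [in leRHS](@mem_set _ [set x : V | L2 i <= -1 * x ord0 i] x); last first.
    by rewrite /= mulN1r (le_trans L2L)// ltW.
  by rewrite lerDr.
apply: (le_trans hs); rewrite lee_fin.
have -> : size (index_enum 'I_n) = n by rewrite -[RHS](card_ord n) cardT enumT.
have -> : n%:R * (e' + e') = e * (n%:R * 2 / (n%:R * 2 + 1)).
  by rewrite /e'; field; rewrite gt_eqF.
by rewrite ler_piMr ?(ltW e0)// ler_pdivrMr// mul1r lerDl.
Qed.

End tails.

(** * Almost minimizers that are close in L^q have close gradients *)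

Section strong_convergence.
Context (R : realType) (n : nat) (Omega : set 'rV[R]_n).
Local Notation V := 'rV[R]_n.
Local Notation mu := (@lebesgue_rV R n).
Implicit Types (f g : V -> R) (x y v : V) (K a : R).
Local Notation "'N_ q [ f ]" := (Lnorm mu q (EFin \o f)).
Local Notation test := (test_function Omega).
Local Notation dirichlet p f := (\int[mu]_x (`|euclid (gradient f x)| `^ p)%:E)%E.

Lemma gradient_sub f g x : test f -> test g ->
  gradient (fun y => f y - g y) x = gradient f x - gradient g x.
Proof. by move=> tf tg; apply/rowP => i; rewrite !mxE (partial_sub i x tf tg). Qed.

Lemma gradient_mid f g x : test f -> test g ->
  gradient (fun y => 2^-1 * (f y + g y)) x = 2^-1 *: (gradient f x + gradient g x).
Proof.
move=> tf tg; rewrite (gradient_scale 2^-1 x (test_add tf tg)); congr (_ *: _).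
apply/rowP => i; rewrite !mxE.
have df := @C1c_der _ _ _ (test_C1c tf) i x; have dg := @C1c_der _ _ _ (test_C1c tg) i x.
exact: deriveD.
Qed.

Lemma measurable_dirichlet p f : test f ->
  measurable_fun setT (fun x => (`|euclid (gradient f x)| `^ p)%:E).
Proof.
by move=> tf; apply: measurable_powR_norm; apply: measurable_gradient_euclid; exact: (test_C1c tf).
Qed.

(** The pointwise inequality is kept free of subtractions, so that it can be
    integrated without integrability assumptions. *)
Lemma integral_uniform_convexity (F G D M : V -> \bar R) (e C a b m : R) :
  0 <= e -> 0 <= C ->
  measurable_fun setT F -> measurable_fun setT G ->
  measurable_fun setT D -> measurable_fun setT M ->
  (forall x, 0 <= F x)%E -> (forall x, 0 <= G x)%E ->
  (forall x, 0 <= D x)%E -> (forall x, 0 <= M x)%E ->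
  (forall x, D x + C%:E * M x <= (e + C / 2)%:E * (F x + G x))%E ->
  (\int[mu]_x F x <= a%:E)%E -> (\int[mu]_x G x <= b%:E)%E ->
  (m%:E <= \int[mu]_x M x)%E ->
  (\int[mu]_x D x <= (e * (a + b) + C * ((a + b) / 2 - m))%:E)%E.
Proof.
move=> e0 C0 mF mG mD mM F0 G0 D0 M0 h fa gb fgm.
have CM0 x : (0 <= C%:E * M x)%E by rewrite mule_ge0.
have mCM : measurable_fun setT (fun x => C%:E * M x)%E by exact: measurable_funeM.
have eC : 0 <= e + C / 2 by rewrite addr_ge0 ?divr_ge0.
have : (\int[mu]_x (D x + C%:E * M x) <= \int[mu]_x ((e + C / 2)%:E * (F x + G x)))%E.
  apply: ge0_le_integral => //.
  - by move=> x _; rewrite adde_ge0.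
  - exact: emeasurable_funD.
  - by apply: measurable_funeM; exact: emeasurable_funD.
rewrite ge0_integralD// ge0_integralZl//.
have mFG : measurable_fun setT (fun x => F x + G x)%E by exact: emeasurable_funD.
have FG0 x : (0 <= F x + G x)%E by rewrite adde_ge0.
rewrite [leRHS]ge0_integralZl// ge0_integralD// => H.
have H1 : ((e + C / 2)%:E * (\int[mu]_x F x + \int[mu]_x G x) <= (e + C / 2)%:E * (a + b)%:E)%E.
  by rewrite lee_wpmul2l ?lee_fin// EFinD leeD.
have H2 : (\int[mu]_x D x + (C * m)%:E <= \int[mu]_x D x + C%:E * \int[mu]_x M x)%E.
  by rewrite leeD2l// EFinM lee_wpmul2l// lee_fin.
have := le_trans H2 (le_trans H H1).
rewrite -EFinM -leeBrDr// -EFinB => /le_trans; apply.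
rewrite lee_fin; lra.
Qed.

Lemma dirichlet_uniform_convexity p e : 1 < p -> 0 < e -> exists2 C : R, 0 <= C &
  forall f g a b m, test f -> test g ->
    (dirichlet p f <= a%:E)%E -> (dirichlet p g <= b%:E)%E ->
    (m%:E <= dirichlet p (fun y => 2^-1 * (f y + g y))%R)%E ->
    (dirichlet p (fun y => f y - g y)%R <= (e * (a + b) + C * ((a + b) / 2 - m))%:E)%E.
Proof.
move=> p1 e0; have p0 : 0 < p by exact: lt_trans p1.
have [C C0 hC] := uniform_convexity_euclid n p1 e0.
exists C => // f g a b m tf tg fa gb fgm.
have aux (r s t u : R) : 0 <= r -> 0 <= s -> 0 <= t -> 0 <= u ->
    r `^ p <= e * (t `^ p + u `^ p) + C * ((t `^ p + u `^ p) / 2 - s `^ p) ->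
    ((`|r| `^ p)%:E + C%:E * (`|s| `^ p)%:E <=
      (e + C / 2)%:E * ((`|t| `^ p)%:E + (`|u| `^ p)%:E))%E.
  move=> r0 s0 t0 u0; rewrite -!EFinD -?EFinM -?EFinD lee_fin !ger0_norm//.
  move: (r `^ p) (s `^ p) (t `^ p) (u `^ p) => {r0 s0 t0 u0}{}r {}s {}t {}u; lra.
apply: (integral_uniform_convexity (F := fun x => (`|euclid (gradient f x)| `^ p)%:E)
  (G := fun x => (`|euclid (gradient g x)| `^ p)%:E) _ _ _ _ _ _ _ _ _ _ _ fa gb fgm).
- exact: ltW.
- exact: C0.
- exact: measurable_dirichlet.
- exact: measurable_dirichlet.
- exact: (measurable_dirichlet p (test_sub tf tg)).
- exact: (measurable_dirichlet p (test_scale 2^-1 (test_add tf tg))).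
- by move=> x; rewrite lee_fin powR_ge0.
- by move=> x; rewrite lee_fin powR_ge0.
- by move=> x; rewrite lee_fin powR_ge0.
- by move=> x; rewrite lee_fin powR_ge0.
move=> x; have H := hC (gradient f x) (gradient g x).
rewrite -(gradient_mid x tf tg) -(gradient_sub x tf tg) in H.
exact: (aux _ _ _ _ (euclid_ge0 _) (euclid_ge0 _) (euclid_ge0 _) (euclid_ge0 _) H).
Qed.

(** The midpoint of f and g has norm at least 1 - d/2 in L^q, hence energy at least
    lam (1 - d/2)^p >= lam (1 - p d/2): the convexity gap is of order d. *)
Lemma near_minimizers p q lam eta : 1 < p -> (p%:E < q)%E -> 0 < lam -> 0 < eta ->
  (forall f a, test f -> 0 <= a -> (a%:E <= 'N_q[f])%E -> ((lam * a `^ p)%:E <= dirichlet p f)%E) ->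
  exists2 d : R, 0 < d & forall f g, test f -> test g ->
    'N_q[f] = 1%E -> ('N_q[(fun x => f x - g x)%R] <= d%:E)%E ->
    (dirichlet p f <= (lam + d)%:E)%E -> (dirichlet p g <= (lam + d)%:E)%E ->
    (dirichlet p (fun x => f x - g x)%R <= eta%:E)%E.
Proof.
move=> p1 pq lam0 eta0 lamle; have p0 : 0 < p by exact: lt_trans p1.
have q1 : (1 <= q)%E by apply: (le_trans _ (ltW pq)); rewrite lee_fin ltW.
pose e := eta / (4 * (lam + 1)).
have l1 : 0 < 4 * (lam + 1) by rewrite mulr_gt0// addr_gt0.
have e0 : 0 < e by rewrite divr_gt0.
have [C C0 hC] := dirichlet_uniform_convexity p1 e0.
pose c := C * (1 + lam * p).
have c0 : 0 <= c by rewrite mulr_ge0// addr_ge0// mulr_ge0// ltW.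
pose d := Num.min 1 (eta / 2 / (c + 1)).
have c1 : 0 < c + 1 by rewrite ltr_wpDl.
have d0 : 0 < d by rewrite lt_min ltr01/= divr_gt0// divr_gt0.
have d1 : d <= 1 by rewrite ge_min lexx.
have d2 : c * d <= eta / 2.
  apply: (@le_trans _ _ ((c + 1) * d)); first by rewrite ler_wpM2r ?(ltW d0)// lerDl.
  by rewrite mulrC -ler_pdivlMr// ge_min lexx orbT.
exists d => // f g tf tg f1 fg fd gd.
have tm : test (fun y => 2^-1 * (f y + g y)) by exact: test_scale (test_add tf tg).
have ts : test (fun y => f y - g y) by exact: test_sub.
have m0 : ((1 - d / 2)%:E <= 'N_q[(fun y => 2^-1 * (f y + g y))%R])%E.
  have mm := C1c_measurable (test_C1c tm); have ms := C1c_measurable (test_C1c ts).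
  rewrite leNgt; apply/negP => lt.
  have h1 := LnormZ_le 2^-1 q1 ms fg.
  have fin : 'N_q[(fun y => 2^-1 * (f y + g y))%R] \is a fin_num.
    by rewrite ge0_fin_numE ?Lnorm_ge0// (lt_trans lt)// ltry.
  have h2 : ('N_q[(fun y => 2^-1 * (f y + g y))%R] <=
    (fine 'N_q[(fun y => 2^-1 * (f y + g y))%R])%:E)%E by rewrite fineK.
  have mh : measurable_fun setT (fun x => 2^-1 * (f x - g x)) by exact: measurable_funM.
  have := LnormD_le q1 mm mh h2 h1.
  have fE : (fun x => 2^-1 * (f x + g x) + 2^-1 * (f x - g x)) = f.
    by apply/funext => x; field.
  rewrite fE.
  rewrite f1 lee_fin ger0_norm ?invr_ge0// => h3.
  move: lt; rewrite -(fineK fin) lte_fin => lt; move: h3 lt.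
  move: (fine _) => z; lra.
have d3 : 0 <= 1 - d / 2 by lra.
have low := lamle _ _ tm d3 m0.
have B := bernoulli p1 d3.
have up := hC f g _ _ _ tf tg fd gd low.
apply: (le_trans up); rewrite lee_fin.
have E1 : e * (lam + d + (lam + d)) <= eta / 2.
  rewrite (_ : eta / 2 = e * (2 * (lam + 1))); last by rewrite /e; field; lra.
  by rewrite ler_wpM2l ?(ltW e0)//; lra.
have E2 : C * ((lam + d + (lam + d)) / 2 - lam * (1 - d / 2) `^ p) <= c * d.
  rewrite /c -mulrA ler_wpM2l//.
  have := ler_wpM2l (ltW lam0) B.
  have := mulr_ge0 (mulr_ge0 (ltW lam0) (ltW p0)) (ltW d0).
  move: ((1 - d / 2) `^ p) => z.
  move=> u v; move: v u; rewrite !mulrDr !mulrDl; lra.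
lra.
Qed.

End strong_convergence.

(** * Passage to the limit *)

Section extraction.
Context (U : set_system nat) (R : realType).
Hypothesis UP : ProperFilter U.
Hypothesis Uoo : \oo `<=` U.

(** The k-th index is taken in the intersection of the first k + 1 good sets, so
    that later indices remain good for earlier tolerances. *)
Lemma fast_subsequence (good : R -> nat -> nat -> Prop) :
  (forall e : R, 0 < e -> exists2 S, U S & forall j l, S j -> S l -> good e j l) ->
  exists s : nat -> nat, forall k, (k <= s k)%N /\
    forall l, (k <= l)%N -> good (4^-1 ^+ k) (s k) (s l).
Proof.
move=> h.
have /choice[S hS] (k : nat) : exists S : set nat, U S /\
    forall j l, S j -> S l -> good (4^-1 ^+ k) j l.
  have [|S US hS] := h (4^-1 ^+ k); first by rewrite exprn_gt0// invr_gt0.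
  by exists S.
have /choice[s hs] (k : nat) : exists j, (k <= j)%N /\ forall i : 'I_k.+1, S i j.
  apply: (@filter_ex _ U); apply: filterI.
    by apply: Uoo; exists k.
  apply: (@filter_forall _ _ (fun (i : 'I_k.+1) => S i) U) => i.
  by have [] := hS i.
exists s => k; have [ks Sk] := hs k; split => // l kl.
have [_ Sl] := hs l.
have [_ good_k] := hS k.
apply: good_k; first exact: (Sk ord_max).
by have := Sl (Ordinal (kl : (k < l.+1)%N)).
Qed.

End extraction.

Lemma euclid_le_norm1 (R : realType) (n : nat) (v : 'rV[R]_n) :
  euclid v <= \sum_(i < n) `|v ord0 i|.
Proof.
have s0 : 0 <= \sum_(i < n) `|v ord0 i| by apply: sumr_ge0.
rewrite -ler_sqr ?nnegrE ?euclid_ge0// sqr_euclid expr2 mulr_suml.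
apply: ler_sum => i _; rewrite -[leLHS]real_normK ?num_real// expr2 ler_wpM2l//.
by rewrite (bigD1 i)//= lerDl sumr_ge0.
Qed.

Section limit.
Context (R : realType) (n : nat) (Omega : set 'rV[R]_n) (p : R) (q : \bar R) (lam : R).
Local Notation V := 'rV[R]_n.
Local Notation mu := (@lebesgue_rV R n).
Implicit Types (f g : V -> R) (x y v : V) (K a : R).
Local Notation "'N_ q [ f ]" := (Lnorm mu q (EFin \o f)).
Local Notation test := (test_function Omega).
Context (phi : nat -> V -> R).
Hypothesis p1 : 1 < p.
Hypothesis q1 : (1 <= q)%E.
Hypothesis lam0 : 0 < lam.
Hypothesis lamE : lambda Omega p q = lam%:E.
Hypothesis tphi : forall k, test (phi k).
Hypothesis phi1 : forall k, 'N_q[phi k] = 1%E.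
Hypothesis phiE : forall k, (energy Omega p (gradient (phi k)) <= (lam + k.+1%:R^-1)%:E)%E.
Hypothesis phip : forall k l, (k <= l)%N ->
  ('N_p%:E[(fun x => phi l x - phi k x)%R] <= (4^-1 ^+ k)%:E)%E.
Hypothesis phiq : forall k l, (k <= l)%N ->
  ('N_q[(fun x => phi l x - phi k x)%R] <= (4^-1 ^+ k)%:E)%E.
Hypothesis phig : forall k l i, (k <= l)%N ->
  ('N_p%:E[(fun x => partial i (phi l) x - partial i (phi k) x)%R] <= (4^-1 ^+ k)%:E)%E.

Let p0 : 0 < p. Proof. exact: lt_trans p1. Qed.
Let q0 : (0 < q)%E. Proof. exact: lt_le_trans q1. Qed.
Let pe1 : (1 <= p%:E)%E. Proof. by rewrite lee_fin ltW. Qed.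

Let r4 k : 0 <= 4^-1 ^+ k :> R. Proof. by rewrite exprn_ge0// invr_ge0. Qed.
Let mphi k := C1c_measurable (test_C1c (tphi k)).
Let mdphi k i := C1c_measurable_partial i (test_C1c (tphi k)).

Lemma Lnorm_limit (r : \bar R) (f : nat -> V -> R) (u : V -> R) k : (0 < r)%E ->
  (forall k, measurable_fun setT (f k)) -> measurable_fun setT u ->
  (\forall x \ae mu, f l x @[l --> \oo] --> u x) ->
  (forall l, (k <= l)%N -> ('N_r[(fun x => f l x - f k x)%R] <= (4^-1 ^+ k)%:E)%E) ->
  ('N_r[(fun x => u x - f k x)%R] <= (4^-1 ^+ k)%:E)%E.
Proof.
move=> r0 mf mu0 fu fk.
apply: (Lnorm_fatou (f_ := fun l x => f l x - f k x)) => //.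
- by move=> l; exact: measurable_funB.
- by apply: filterS fu => x fx; apply: cvgB => //; exact: cvg_cst.
- exact: measurable_funB.
- by exists k.
Qed.

Lemma limit_exists : exists (u : V -> R) (G : V -> V), [/\
  measurable_fun setT u, forall i, measurable_fun setT (fun x => G x ord0 i),
  forall x, ~ Omega x -> u x = 0 /\ G x = 0 &
  forall k, [/\ ('N_p%:E[(fun x => u x - phi k x)%R] <= (4^-1 ^+ k)%:E)%E,
    ('N_q[(fun x => u x - phi k x)%R] <= (4^-1 ^+ k)%:E)%E &
    forall i, ('N_p%:E[(fun x => G x ord0 i - partial i (phi k) x)%R] <= (4^-1 ^+ k)%:E)%E]].
Proof.
have [u [mu0 uc u0]] := Lnorm_fast_cauchy p0 mphi (fun k => phip (leqnSn k)).
have h i := Lnorm_fast_cauchy p0 (fun k => mdphi k i) (fun k => phig i (leqnSn k)).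
have /choice[g hg] := h.
exists u, (fun x => \row_i g i x); split => //.
- by move=> i; under eq_fun do rewrite mxE; have [] := hg i.
- move=> x nO; split.
    by apply: u0 => k; have [] := test_out (tphi k) nO.
  apply/rowP => i; rewrite !mxE; have [_ _ g0] := hg i; apply: g0 => k.
  by have [_ ->] := test_out (tphi k) nO.
move=> k; split.
- by apply: Lnorm_limit => // l; exact: phip.
- by apply: Lnorm_limit => // l; exact: phiq.
move=> i; have [mg gc _] := hg i.
under eq_fun do rewrite mxE.
apply: (Lnorm_limit (f := fun k => partial i (phi k))) => // l.
exact: phig.
Qed.

Lemma hoelder_conj f g : measurable_fun setT f -> measurable_fun setT g ->
  ('N_1%E[(fun x => f x * g x)%R] <= 'N_p%:E[f] * 'N_(p / (p - 1))%:E[g])%E.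
Proof.
move=> mf mg; apply: (hoelder mu mf mg) => //.
  by rewrite divr_gt0// subr_gt0.
by field; rewrite !gt_eqF ?subr_gt0.
Qed.

Lemma integral_mul_le f g a b : measurable_fun setT f -> measurable_fun setT g ->
  0 <= a -> 0 <= b -> ('N_p%:E[f] <= a%:E)%E -> ('N_(p / (p - 1))%:E[g] <= b%:E)%E ->
  (\int[mu]_x `|(f x * g x)%:E| <= (a * b)%:E)%E.
Proof.
move=> mf mg a0 b0 fa gb.
have := hoelder_conj mf mg; rewrite Lnorm1 => /le_trans; apply.
by rewrite (EFinM a b) lee_pmul// Lnorm_ge0.
Qed.

Lemma integrable_mul f g a b : measurable_fun setT f -> measurable_fun setT g ->
  0 <= a -> 0 <= b -> ('N_p%:E[f] <= a%:E)%E -> ('N_(p / (p - 1))%:E[g] <= b%:E)%E ->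
  mu.-integrable setT (fun x => (f x * g x)%:E).
Proof.
move=> mf mg a0 b0 fa gb; apply/integrableP; split.
  by apply/measurable_EFinP; exact: measurable_funM.
by rewrite (le_lt_trans (integral_mul_le mf mg a0 b0 fa gb))// ltry.
Qed.

Lemma small_power4 (b e : R) : 0 < e -> exists k, 4^-1 ^+ k * b <= e.
Proof.
move=> e0; have : 4^-1 ^+ k * b @[k --> \oo] --> 0 * b.
  apply: cvgM; last exact: cvg_cst.
  by apply: cvg_expr; rewrite ger0_norm ?invr_ge0// invf_lt1// ltr1n.
rewrite mul0r => /cvgr0Pnorm_le/(_ _ e0)[k _ /(_ k (leqnn k))/= h].
by exists k; rewrite (le_trans (ler_norm _)).
Qed.

Context (u : V -> R) (G : V -> V).
Hypothesis mu_ : measurable_fun setT u.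
Hypothesis mG : forall i, measurable_fun setT (fun x => G x ord0 i).
Hypothesis uG0 : forall x, ~ Omega x -> u x = 0 /\ G x = 0.
Hypothesis up : forall k, ('N_p%:E[(fun x => u x - phi k x)%R] <= (4^-1 ^+ k)%:E)%E.
Hypothesis uq : forall k, ('N_q[(fun x => u x - phi k x)%R] <= (4^-1 ^+ k)%:E)%E.
Hypothesis ug : forall k i,
  ('N_p%:E[(fun x => G x ord0 i - partial i (phi k) x)%R] <= (4^-1 ^+ k)%:E)%E.

Lemma Lnorm_p_limit : exists2 c : R, 0 <= c & ('N_p%:E[u] <= c%:E)%E.
Proof.
have [c c0 kc] := C1c_Lnorm_fin p0 (test_C1c (tphi 0%N)).
exists (4^-1 ^+ 0 + c); first by rewrite addr_ge0.
have mB : measurable_fun setT (fun x => u x - phi 0%N x) by exact: measurable_funB.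
have := LnormD_le pe1 mB (mphi 0%N) (up 0%N) kc.
by under [X in EFin \o X]eq_fun do rewrite subrK.
Qed.

Lemma Lnorm_p_limit_grad i : exists2 c : R, 0 <= c & ('N_p%:E[(fun x => G x ord0 i)] <= c%:E)%E.
Proof.
have [M _ kM] := C1c_bounded_partial i (test_C1c (tphi 0%N)).
have [L _ kL] := C1c_supp (test_C1c (tphi 0%N)).
have [c c0 kc] := supported_Lnorm p0 (mdphi 0%N i) (supported_partial i kL) kM.
exists (4^-1 ^+ 0 + c); first by rewrite addr_ge0.
have mB : measurable_fun setT (fun x => G x ord0 i - partial i (phi 0%N) x).
  by apply: measurable_funB; [exact: mG|exact: mdphi].
have := LnormD_le pe1 mB (mdphi 0%N i) (ug 0%N i) kc.
by under [X in EFin \o X]eq_fun do rewrite subrK.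
Qed.

(** Each term satisfies the integration by parts formula because the integral of
    a partial derivative of phi_k f vanishes; the error made by replacing the limit
    by phi_k is bounded by the Hoelder inequality. *)
Lemma limit_weak_gradient : weak_gradient Omega u G.
Proof.
move=> f i tf; have Cf := test_C1c tf.
have mf := C1c_measurable Cf; have mdf := C1c_measurable_partial i Cf.
have [L _ fL] := C1c_supp Cf.
have pc0 : 0 < p / (p - 1) by rewrite divr_gt0// subr_gt0.
have [b1 b10 fb] := C1c_Lnorm_fin pc0 Cf.
have [M _ fM] := C1c_bounded_partial i Cf.
have [b2 b20 dfb] := supported_Lnorm pc0 mdf (supported_partial i fL) fM.
have Z k : (\int[mu]_x (phi k x * partial i f x + partial i (phi k) x * f x)%:E = 0)%E.
  have tz : test (fun x => f x * phi k x).
    by apply: test_mul => //; move/testP : tf => [].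
  rewrite -(integral_partial i (test_C1c tz)); apply: eq_integral => x _.
  congr EFin; have dk := @C1c_der _ _ _ (test_C1c (tphi k)) i x.
  have df := @C1c_der _ _ _ Cf i x.
  rewrite /partial (deriveM df dk) addrC /GRing.scale/=.
  by rewrite [in LHS](mulrC _ (f x)) .
have up0 : ('N_p%:E[(fun x => u x - phi 0%N x)%R] <= 1%:E)%E by have := up 0%N; rewrite expr0.
pose F x := u x * partial i f x; pose H x := G x ord0 i * f x.
have bound k : (`|\int[mu]_x (F x + H x)%:E| <= (4^-1 ^+ k * (b2 + b1))%:E)%E.
  pose a x := (u x - phi k x) * partial i f x.
  pose b x := (G x ord0 i - partial i (phi k) x) * f x.
  have ma1 : measurable_fun setT (fun x => u x - phi k x) by exact: measurable_funB.
  have mb1 : measurable_fun setT (fun x => G x ord0 i - partial i (phi k) x).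
    by apply: measurable_funB; [exact: mG|exact: mdphi].
  have ha := integral_mul_le ma1 mdf (r4 k) b20 (up k) dfb.
  have hb := integral_mul_le mb1 mf (r4 k) b10 (ug k i) fb.
  have ia := integrable_mul ma1 mdf (r4 k) b20 (up k) dfb.
  have ib := integrable_mul mb1 mf (r4 k) b10 (ug k i) fb.
  have [c1 c10 kc1] := C1c_Lnorm_fin p0 (test_C1c (tphi k)).
  have [M' _ kM] := C1c_bounded_partial i (test_C1c (tphi k)).
  have [L' _ kL] := C1c_supp (test_C1c (tphi k)).
  have [c2 c20 kc2] := supported_Lnorm p0 (mdphi k i) (supported_partial i kL) kM.
  have ic := integrable_mul (mphi k) mdf c10 b20 kc1 dfb.
  have id := integrable_mul (mdphi k i) mf c20 b10 kc2 fb.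
  have E : (\int[mu]_x (F x + H x)%:E = \int[mu]_x (a x)%:E + \int[mu]_x (b x)%:E)%E.
    rewrite -(integralD measurableT ia ib) -[RHS]adde0 -(Z k).
    have -> : (\int[mu]_x (phi k x * partial i f x + partial i (phi k) x * f x)%:E =
      \int[mu]_x ((phi k x * partial i f x)%:E + (partial i (phi k) x * f x)%:E))%E by [].
    rewrite -(integralD measurableT (integrableD measurableT ia ib) (integrableD measurableT ic id)).
    apply: eq_integral => x _; rewrite -!EFinD; congr EFin.
    by rewrite /F /H /a /b; ring.
  rewrite E; apply: (le_trans (lee_abs_add _ _)).
  rewrite mulrDr EFinD; apply: leeD.
    by apply: le_trans ha; apply: le_abse_integral => //; exact: (measurable_int _ ia).
  by apply: le_trans hb; apply: le_abse_integral => //; exact: (measurable_int _ ib).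
have I0 : (\int[mu]_x (F x + H x)%:E = 0)%E.
  apply/eqP; rewrite -abse_eq0 eq_le abse_ge0 andbT; apply/lee_addgt0Pr => e e0.
  have [k hk] := small_power4 (b2 + b1) e0.
  by rewrite add0e (le_trans (bound k))// lee_fin.
have [c c0 uc] := Lnorm_p_limit.
have [c' c'0 gc] := Lnorm_p_limit_grad i.
have iF := integrable_mul mu_ mdf c0 b20 uc dfb.
have iH := integrable_mul (mG i) mf c'0 b10 gc fb.
have EF : (\int[mu]_(x in Omega) (u x * partial i f x)%:E = \int[mu]_x (F x)%:E)%E.
  rewrite integral_mkcond; apply: eq_integral => x _; rewrite patchE /F; case: ifPn => //.
  by move=> /negP xO; have [|-> _] := @uG0 x; [move=> Ox; apply: xO; rewrite inE|rewrite mul0r].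
have EH : (\int[mu]_(x in Omega) (G x ord0 i * f x)%:E = \int[mu]_x (H x)%:E)%E.
  rewrite integral_mkcond; apply: eq_integral => x _; rewrite patchE /H; case: ifPn => //.
  by move=> /negP xO; have [|_ ->] := @uG0 x; [move=> Ox; apply: xO; rewrite inE|rewrite mxE mul0r].
rewrite EF EH.
have fF := integrable_fin_num measurableT iF.
have fH := integrable_fin_num measurableT iH.
have : (\int[mu]_x (F x)%:E + \int[mu]_x (H x)%:E = 0)%E.
  by rewrite -(integralD measurableT iF iH) -[RHS]I0; apply: eq_integral.
rewrite -(fineK fF) -(fineK fH) -EFinD => -[/eqP].
by rewrite addr_eq0 => /eqP ->; rewrite EFinN.
Qed.

Lemma euclid_limit k :
  ('N_p%:E[(fun x => euclid (G x - gradient (phi k) x))] <= (n%:R * 4^-1 ^+ k)%:E)%E.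
Proof.
pose g i x := `|G x ord0 i - partial i (phi k) x|.
have mg i : measurable_fun setT (g i).
  by apply: measurableT_comp => //; apply: measurable_funB; [exact: mG|exact: mdphi].
have gk i : ('N_p%:E[g i] <= (4^-1 ^+ k)%:E)%E.
  apply: le_trans (ug k i); apply: le_Lnorm => //.
    by apply: measurable_funB; [exact: mG|exact: mdphi].
  by move=> x; rewrite normr_id.
have := Lnorm_sum_le (index_enum 'I_n) pe1 mg gk.
have -> : size (index_enum 'I_n) = n by rewrite -[RHS](card_ord n) cardT enumT.
apply: le_trans; apply: le_Lnorm => //.
- apply: measurable_euclid => i; under eq_fun do rewrite !mxE.
  by apply: measurable_funB; [exact: mG|exact: mdphi].
- exact: measurable_sum.
move=> x; rewrite ger0_norm ?euclid_ge0// [leRHS]ger0_norm ?sumr_ge0//.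
apply: (le_trans (euclid_le_norm1 _)); apply: ler_sum => i _.
  by rewrite /g !mxE.
by move=> i _; rewrite normr_ge0.
Qed.

Lemma measurable_euclid_sub k : measurable_fun setT (fun x => euclid (G x - gradient (phi k) x)).
Proof.
apply: measurable_euclid => i; under eq_fun do rewrite !mxE.
by apply: measurable_funB; [exact: mG|exact: mdphi].
Qed.

Lemma limit_Lnorm_q : 'N_q[u] = 1%E.
Proof.
have mB k : measurable_fun setT (fun x => u x - phi k x) by exact: measurable_funB.
have phiq1 k : ('N_q[phi k] <= 1%:E)%E by rewrite phi1.
have ub k : ('N_q[u] <= (4^-1 ^+ k + 1)%:E)%E.
  have := LnormD_le q1 (mB k) (mphi k) (uq k) (phiq1 k).
  by under [X in EFin \o X]eq_fun do rewrite subrK.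
have fin : 'N_q[u] \is a fin_num.
  by rewrite ge0_fin_numE ?Lnorm_ge0// (le_lt_trans (ub 0%N))// ltry.
have lb k : (1%:E <= (fine 'N_q[u] + 4^-1 ^+ k)%:E)%E.
  have uu : ('N_q[u] <= (fine 'N_q[u])%:E)%E by rewrite fineK.
  have := LnormB_le q1 mu_ (mB k) uu (uq k).
  under [X in EFin \o X]eq_fun do rewrite opprB addrCA subrr addr0.
  by rewrite phi1.
rewrite -(fineK fin); congr EFin; apply/eqP; rewrite eq_le; apply/andP; split.
  apply/ler_addgt0Pr => e e0; have [k hk] := small_power4 1 e0.
  rewrite mulr1 in hk; rewrite -lee_fin fineK// (le_trans (ub k))// lee_fin; lra.
apply/ler_addgt0Pr => e e0; have [k hk] := small_power4 1 e0.
rewrite mulr1 in hk; have := lb k; rewrite lee_fin; lra.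
Qed.

(** The energies of the sequence tend to lambda by minimality, and the norms of the
    gradients converge to that of G. *)
Lemma limit_energy : energy Omega p G = lam%:E.
Proof.
have mE k := measurable_gradient_euclid (test_C1c (tphi k)).
have mS := measurable_euclid_sub.
have mGe : measurable_fun setT (fun x => euclid (G x)) by exact: measurable_euclid.
pose l := lam `^ p^-1.
have l0 : 0 <= l by exact: powR_ge0.
have lp : l `^ p = lam by rewrite /l -powRrM mulVf ?gt_eqF// powRr1// ltW.
have G0 x : ~ Omega x -> G x = 0 by move=> /uG0[].
have gub k : (grad_norm p (phi k) <= ((lam + k.+1%:R^-1) `^ p^-1)%:E)%E.
  rewrite -(energy_test_leP p1 (tphi k)) ?powR_ge0//.
  by rewrite -powRrM mulVf ?gt_eqF// powRr1 ?addr_ge0 ?(ltW lam0).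
have nk k : 0 <= n%:R * 4^-1 ^+ k :> R by rewrite mulr_ge0.
have Gub k : ('N_p%:E[(fun x => euclid (G x))] <=
    ((lam + k.+1%:R^-1) `^ p^-1 + n%:R * 4^-1 ^+ k)%:E)%E.
  have := LnormD_le pe1 (mE k) (mS k) (gub k) (euclid_limit k).
  apply: le_trans; apply: le_Lnorm => //; first exact: measurable_funD.
  move=> x; rewrite !ger0_norm ?addr_ge0 ?euclid_ge0//.
  rewrite -{1}(subrK (gradient (phi k) x) (G x)) addrC; exact: ler_euclidD.
have fin : 'N_p%:E[(fun x => euclid (G x))] \is a fin_num.
  by rewrite ge0_fin_numE ?Lnorm_ge0// (le_lt_trans (Gub 0%N))// ltry.
pose D := fine 'N_p%:E[(fun x => euclid (G x))].
have D0 : 0 <= D by rewrite fine_ge0// Lnorm_ge0.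
have DE : ('N_p%:E[(fun x => euclid (G x))] <= D%:E)%E by rewrite fineK.
have lD k : l <= D + n%:R * 4^-1 ^+ k.
  have h : (grad_norm p (phi k) <= (D + n%:R * 4^-1 ^+ k)%:E)%E.
    have := LnormD_le pe1 mGe (mS k) DE (euclid_limit k).
    apply: le_trans; apply: le_Lnorm => //; first exact: measurable_funD.
    move=> x; rewrite !ger0_norm ?addr_ge0 ?euclid_ge0//.
    have E : gradient (phi k) x = G x + - (G x - gradient (phi k) x).
      by rewrite opprB addrCA subrr addr0.
    rewrite [in leLHS]E; apply: (le_trans (ler_euclidD _ _)).
    by rewrite euclidN.
  have : (lambda Omega p q <= energy Omega p (gradient (phi k)))%E.
    by apply: ereal_inf_lbound; exists (phi k) => //; split => //; rewrite Lnorm_on_test.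
  rewrite lamE => /le_trans h2.
  have := h2 _ _; rewrite -(energy_test_leP p1 (tphi k)) in h; last by rewrite addr_ge0.
  move=> /(_ _ h); rewrite lee_fin -lp => h3.
  rewrite leNgt; apply/negP => h4; move: h3; rewrite leNgt => /negP; apply.
  by apply: gt0_ltr_powR; rewrite ?nnegrE ?addr_ge0.
have Dl : D = l.
  apply/eqP; rewrite eq_le; apply/andP; split; last first.
    apply/ler_addgt0Pr => e e0; have [k hk] := small_power4 n%:R e0.
    by rewrite (le_trans (lD k))// lerD2l mulrC.
  have cv : (lam + k.+1%:R^-1) `^ p^-1 + n%:R * 4^-1 ^+ k @[k --> \oo] --> (lam + 0) `^ p^-1 + n%:R * 0.
    apply: cvgD; last first.
      apply: cvgM; first exact: cvg_cst.
      by apply: cvg_expr; rewrite ger0_norm ?invr_ge0// invf_lt1// ltr1n.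
    apply: (@cvg_powR R nat \oo _ (fun k => lam + k.+1%:R^-1) (lam + 0) p^-1).
    - by rewrite invr_gt0.
    - by move=> k; rewrite addr_ge0// ltW.
    by apply: cvgD; [exact: cvg_cst|exact: cvg_harmonic].
  rewrite addr0 mulr0 addr0 in cv.
  apply: (ler_cvg_to (cvg_cst D) cv); apply: nearW => k.
  by have := Gub k; rewrite -(fineK fin) lee_fin.
rewrite energyE// -lp -Dl.
by rewrite -poweR_EFin fineK// poweR_Lnorm ?gt_eqF.
Qed.

Lemma limit_extremal : extremal Omega p q u.
Proof.
have uO : u \_ Omega = u.
  apply/funext => x; rewrite patchE; case: ifPn => // /negP xO.
  by have [|->] := @uG0 x; first by move=> Ox; apply: xO; rewrite inE.
have GO i : (fun x => G x ord0 i) \_ Omega = fun x => G x ord0 i.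
  apply/funext => x; rewrite patchE; case: ifPn => // /negP xO.
  by have [|_ ->] := @uG0 x; [move=> Ox; apply: xO; rewrite inE|rewrite mxE].
have Lf f : measurable_fun setT f -> (exists2 c : R, 0 <= c & ('N_p%:E[f] <= c%:E)%E) ->
    f \in Lfun mu p%:E.
  move=> mf [c _ fc]; apply/andP; split; rewrite inE//=.
  by rewrite /finite_norm (le_lt_trans fc)// ltry.
exists G; split.
- split.
  + by rewrite /L_on uO; apply: Lf => //; exact: Lnorm_p_limit.
  + by move=> i; rewrite /L_on GO; apply: Lf => //; exact: Lnorm_p_limit_grad.
  + exact: limit_weak_gradient.
- move=> e e0; have e2 : 0 < e / 2 by rewrite divr_gt0.
  have [k hk] := small_power4 (1 + n%:R) e2.
  exists (phi k) => //.
  rewrite /W1p_norm /Lnorm_on.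
  have -> : (u \- phi k)%R \_ Omega = fun x => u x - phi k x.
    apply/funext => x; rewrite patchE; case: ifPn => //= /negP xO.
    have nO : ~ Omega x by move=> Ox; apply: xO; rewrite inE.
    by have [-> _] := uG0 nO; have [-> _] := test_out (tphi k) nO; rewrite subr0.
  have -> : (@euclid R n \o (G \- gradient (phi k))%R) \_ Omega =
      fun x => euclid (G x - gradient (phi k) x).
    apply/funext => x; rewrite patchE; case: ifPn => //= /negP xO.
    have nO : ~ Omega x by move=> Ox; apply: xO; rewrite inE.
    have [_ ->] := uG0 nO; rewrite (gradient_out (tphi k) nO) subr0 euclid0 //.
  apply: (le_lt_trans (leeD (up k) (euclid_limit k))).
  rewrite -EFinD lte_fin; apply: le_lt_trans (_ : e / 2 < e); last by lra.
  by apply: le_trans hk; rewrite le_eqVlt; apply/orP; left; apply/eqP; ring.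
- move=> ae0; have : ('N_q[u] <= 0%:E)%E.
    apply: (Lnorm_fatou (f_ := fun _ => cst 0)) => //.
      apply: filterS ae0 => x h.
      have -> : u x = 0 by have [/h//|/uG0[]] := pselect (Omega x).
      exact: cvg_cst.
    by apply: nearW => _; rewrite Lnorm0// gt_eqF.
  by rewrite limit_Lnorm_q lee_fin ler10.
- by rewrite /Lnorm_on uO limit_Lnorm_q ltry.
- by rewrite limit_energy lamE /Lnorm_on uO limit_Lnorm_q poweR_EFin powR1 mule1.
Qed.

End limit.

(** * Existence of an extremal *)

Section existence.
Context (R : realType) (n : nat) (Omega : set 'rV[R]_n) (T : pred 'I_n).
Context (p : R) (q : \bar R) (B : R) (i0 : 'I_n).
Local Notation V := 'rV[R]_n.
Local Notation mu := (@lebesgue_rV R n).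
Implicit Types (f g u : V -> R) (x y v : V) (K a : R).
Local Notation "'N_ q [ f ]" := (Lnorm mu q (EFin \o f)).
Local Notation test := (test_function Omega).
Local Notation dirichlet p f := (\int[mu]_x (`|euclid (gradient f x)| `^ p)%:E)%E.

Hypothesis p1 : 1 < p.
Hypothesis pq : (p%:E < q)%E.
Hypothesis subcritical : n%:R * (p^-1 - einv q) < 1.
Hypothesis B0 : 0 <= B.
Hypothesis Ti0 : ~~ T i0.
Hypothesis OB : forall x i, Omega x -> ~~ T i -> `|x ord0 i| <= B.
Hypothesis OT : forall x v, (forall i, ~~ T i -> v ord0 i = 0) -> Omega (x + v) -> Omega x.
Hypothesis nontrivial : exists2 f, test f & 'N_q[f] != 0%E.

Let p0 : 0 < p. Proof. exact: lt_trans p1. Qed.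
Let p1' : 1 <= p. Proof. exact: ltW. Qed.
Let q1 : (1 <= q)%E. Proof. by apply: (le_trans _ (ltW pq)). Qed.
Let q0 : (0 < q)%E. Proof. exact: lt_le_trans q1. Qed.

Section fixed_sequence.
Context (lam c C : R) (psi : nat -> V -> R).
Hypothesis lam0 : 0 < lam.
Hypothesis lamE : lambda Omega p q = lam%:E.
Hypothesis c0 : 0 < c.
Hypothesis C0 : 0 < C.
Hypothesis hC : forall f K, test f -> 0 <= K -> (grad_norm p f <= K%:E)%E ->
  ('N_p%:E[f] <= (C * K)%:E)%E /\ ('N_q[f] <= (C * K)%:E)%E.
Hypothesis tpsi : forall j, test (psi j).
Hypothesis psi1 : forall j, 'N_q[psi j] = 1%E.
Hypothesis psiE : forall j, (energy Omega p (gradient (psi j)) <= (lam + j.+1%:R^-1)%:E)%E.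
Hypothesis psic : forall j, (c%:E <= 'N_q[psi j \_ (@near0 R n T)])%E.

Let K := (lam + 1) `^ p^-1.
Let K0 : 0 <= K. Proof. exact: powR_ge0. Qed.

Lemma grad_norm_psi j : (grad_norm p (psi j) <= K%:E)%E.
Proof.
rewrite -(energy_test_leP p1 (tpsi j))// /K -powRrM mulVf ?gt_eqF// powRr1 ?addr_ge0 ?(ltW lam0)//.
apply: (le_trans (psiE j)); rewrite lee_fin lerD2l invf_le1//.
by rewrite ler1n.
Qed.

Lemma psi_dirichlet j : (dirichlet p (psi j) <= (lam + j.+1%:R^-1)%:E)%E.
Proof. by have := psiE j; rewrite (energy_test p1 (tpsi j)). Qed.

Lemma lambda_dirichlet f a : test f -> 0 <= a -> (a%:E <= 'N_q[f])%E ->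
  ((lam * a `^ p)%:E <= dirichlet p f)%E.
Proof.
move=> tf a0 af; rewrite -(energy_test p1 tf).
exact: (lambda_le p1 pq subcritical B0 Ti0 OB nontrivial lamE tf a0 af).
Qed.

(** In the directions selected by T this is [tightness], which applies on both sides
    because [near0] lies in both half-spaces of equations x_i <= 1 and -x_i <= 1; in the
    other directions the domain itself is bounded. *)
Lemma psi_tail e : 0 < e -> exists (L : R) (J : nat), forall j, (J <= j)%N ->
  ('N_q[psi j \_ (~` centered_box L)] <= e%:E)%E.
Proof.
apply: box_tail => //; first by move=> j; exact: C1c_measurable (test_C1c (tpsi j)).
move=> sg i {}e sg1 e0.
have sgn : `|sg| <= 1 by case/orP : sg1 => /eqP ->; rewrite ?normrN normr1.
have [Ti|Ti] := boolP (T i).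
  apply: (tightness (A := @near0 R n T) p0 pq lam0 c0 sgn lambda_dirichlet _ tpsi psi1 psi_dirichlet
    (mulr_ge0 (ltW C0) K0) _ (measurable_near0 T)) => //.
  - by move=> f; apply: (test_Lnorm_fin p1 pq subcritical B0 Ti0 OB).
  - by move=> j; have [] := hC (tpsi j) K0 (grad_norm_psi j).
  - move=> x /(_ i Ti) /= xi; apply: (le_trans (ler_norm _)).
    by rewrite normrM -[leRHS]mulr1 ler_pM.
exists (B + 1), 0%N => j _.
have -> : psi j \_ [set x : V | B + 1 <= sg * x ord0 i] = cst 0.
  apply/funext => x; rewrite patchE; case: ifPn => //; rewrite inE /= => xB.
  have [Ox|nO] := pselect (Omega x); last by have [] := test_out (tpsi j) nO.
  have := OB Ox Ti; rewrite leNgt => /negP[].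
  apply: (@lt_le_trans _ _ (B + 1)); first by rewrite ltrDl.
  apply: (le_trans xB); apply: (le_trans (ler_norm _)).
  by rewrite normrM ler_piMl.
by rewrite Lnorm0 ?gt_eqF// lee_fin ltW.
Qed.

Lemma minimizing_extremal : exists u, extremal Omega p q u.
Proof.
have [U [Uu Uoo]] := @ultraFilterLemma nat \oo _.
have UP : ProperFilter U by exact: ultra_proper.
have psiA j : ('N_p%:E[psi j] <= (C * K)%:E)%E.
  by have [] := hC (tpsi j) K0 (grad_norm_psi j).
have psiK j i : ('N_p%:E[partial i (psi j)] <= K%:E)%E.
  exact: (Lnorm_partial_le i p0 (test_C1c (tpsi j)) (grad_norm_psi j)).
have cauchy := ultra_Lnorm_cauchy p1 pq subcritical (mulr_ge0 (ltW C0) K0) K0 tpsi psiA psiK Uu Uoo psi_tail.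
pose good (e : R) (j l : nat) :=
  [/\ ('N_p%:E[(fun x => psi l x - psi j x)%R] <= e%:E)%E,
      ('N_q[(fun x => psi l x - psi j x)%R] <= e%:E)%E &
      forall i, ('N_p%:E[(fun x => partial i (psi l) x - partial i (psi j) x)%R] <= e%:E)%E].
have goodP e : 0 < e -> exists2 S, U S & forall j l, S j -> S l -> good e j l.
  move=> e0; have C1 : 0 < C + 1 by rewrite addr_gt0.
  pose e' := e / (C + 1).
  have e'0 : 0 < e' by rewrite divr_gt0.
  have eta0 : 0 < e' `^ p by rewrite powR_gt0.
  have [d d0 hd] := near_minimizers p1 pq lam0 eta0 lambda_dirichlet.
  have [S US hS] := cauchy d d0.
  have [J _ hJ] : \forall j \near \oo, j.+1%:R^-1 <= d :> R.
    by have /cvgr0Pnorm_le/(_ _ d0) := @cvg_harmonic R; apply: filterS => j; apply: le_trans; exact: ler_norm.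
  exists (S `&` [set j | (J <= j)%N]); first by apply: filterI => //; apply: Uoo; exists J.
  move=> j l [Sj Jj] [Sl Jl].
  have dd k : (J <= k)%N -> (dirichlet p (psi k) <= (lam + d)%:E)%E.
    move=> Jk; apply: (le_trans (psi_dirichlet k)); rewrite lee_fin lerD2l.
    exact: (hJ k Jk).
  have ts : test (fun x => psi l x - psi j x) by exact: test_sub.
  have gd : (grad_norm p (fun x => psi l x - psi j x)%R <= e'%:E)%E.
    rewrite -(energy_test_leP p1 ts (ltW e'0)) (energy_test p1 ts).
    exact: (hd _ _ (tpsi l) (tpsi j) (psi1 l) (hS _ _ Sl Sj) (dd l Jl) (dd j Jj)).
  have [h1 h2] := hC ts (ltW e'0) gd.
  have Ce : C * e' <= e.
    rewrite /e' mulrCA ler_piMr ?(ltW e0)// ler_pdivrMr// mul1r lerDl//.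
  split.
  - by apply: (le_trans h1); rewrite lee_fin.
  - by apply: (le_trans h2); rewrite lee_fin.
  move=> i; have := Lnorm_partial_le i p0 (test_C1c ts) gd.
  have -> : partial i (fun x => psi l x - psi j x) = fun x => partial i (psi l) x - partial i (psi j) x.
    by apply/funext => x; exact: partial_sub.
  move=> /le_trans; apply; rewrite lee_fin /e' ler_pdivrMr// ler_peMr ?(ltW e0)// lerDr ltW//.
have [s hs] := fast_subsequence UP Uoo goodP.
have t k : test (psi (s k)) by [].
have s1 k : 'N_q[psi (s k)] = 1%E by [].
have sE k : (energy Omega p (gradient (psi (s k))) <= (lam + k.+1%:R^-1)%:E)%E.
  apply: (le_trans (psiE (s k))); rewrite lee_fin lerD2l lef_pV2 ?posrE//.
  by rewrite ler_nat ltnS; have [] := hs k.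
have sp k l : (k <= l)%N -> ('N_p%:E[(fun x => psi (s l) x - psi (s k) x)%R] <= (4^-1 ^+ k)%:E)%E.
  by move=> kl; have [_ /(_ l kl)[]] := hs k.
have sq k l : (k <= l)%N -> ('N_q[(fun x => psi (s l) x - psi (s k) x)%R] <= (4^-1 ^+ k)%:E)%E.
  by move=> kl; have [_ /(_ l kl)[]] := hs k.
have sg k l i : (k <= l)%N ->
    ('N_p%:E[(fun x => partial i (psi (s l)) x - partial i (psi (s k)) x)%R] <= (4^-1 ^+ k)%:E)%E.
  by move=> kl; have [_ /(_ l kl)[]] := hs k.
have [u [G [mu_ mG uG0 uG]]] := limit_exists p1 q1 t sp sq sg.
exists u; apply: (limit_extremal p1 q1 lam0 lamE t s1 sE mu_ mG uG0).
- by move=> k; have [] := uG k.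
- by move=> k; have [] := uG k.
by move=> k i; have [] := uG k.
Qed.

End fixed_sequence.

Lemma extremal_exists : exists u, extremal Omega p q u.
Proof.
have [lam lam0 lamE] := lambda_fin p1 pq subcritical B0 Ti0 OB nontrivial.
have [c c0 [psi hpsi]] := centered_minimizing_sequence p1 pq subcritical B0 Ti0 OB OT lamE lam0.
have [C C0 hC] := sobolev p1 pq subcritical B0 Ti0 OB.
by apply: (minimizing_extremal lam0 lamE c0 C0 hC (psi := psi)) => j; have [] := hpsi j.
Qed.

End existence.

(** * Cylinders *)

Section bump.
Context (R : realType) (n : nat) (Omega : set 'rV[R]_n) (a : 'rV[R]_n) (r : R).
Local Notation V := 'rV[R]_n.
Local Notation mu := (@lebesgue_rV R n).
Implicit Types x : V.
Hypothesis r0 : 0 < r.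
Hypothesis aO : forall x, (forall i, `|x ord0 i - a ord0 i| <= r) -> Omega x.

(** A product of one-variable bumps, positive exactly on the open cube of centre a
    and half-side r: it shows that lambda is an infimum over a nonempty set. *)
Definition bump (x : V) : R :=
  \prod_(i < n) (flat 0 (ramp 1 (a ord0 i - r) i x) *
                 flat 0 (ramp (-1) (- a ord0 i - r) i x)).

Lemma bump_gt0 x : (forall i, `|x ord0 i - a ord0 i| < r) -> 0 < bump x.
Proof.
move=> xa; apply: prodr_gt0 => i _; have := xa i; rewrite ltr_norml => /andP[h1 h2].
by apply: mulr_gt0; apply: flat_gt0; rewrite /ramp; lra.
Qed.

Lemma bump_neq0 x : bump x != 0 -> forall i, `|x ord0 i - a ord0 i| <= r.
Proof.
move=> /prodf_neq0 h i; have := h i isT; rewrite mulf_eq0 negb_or => /andP[h1 h2].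
rewrite ler_norml; apply/andP; split.
  rewrite leNgt; apply/negP => xi; move/eqP : h1; apply.
  by apply: flat_le0; rewrite /ramp; lra.
rewrite leNgt; apply/negP => xi; move/eqP : h2; apply.
by apply: flat_le0; rewrite /ramp; lra.
Qed.

Lemma test_bump : test_function Omega bump.
Proof.
apply/testP; split.
  by move=> k; apply: Ck_prod => i; apply: Ck_mul; exact: Ck_flat.
pose A i : set R := `[a ord0 i - r, a ord0 i + r]%classic.
exists [set x | forall i, A i (x ord0 i)]; split.
- by apply: rV_compact => i; exact: segment_compact.
- move=> x /= h; apply: aO => i; have := h i; rewrite /A /= in_itv/= ler_norml.
  by move=> /andP[h1 h2]; apply/andP; split; lra.
- move=> x /bump_neq0 h i; have := h i; rewrite /A /= in_itv/= ler_norml.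
  by move=> /andP[h1 h2]; apply/andP; split; lra.
Qed.

Lemma Lnorm_bump (q : \bar R) : (0 < q)%E -> Lnorm mu q (EFin \o bump) != 0%E.
Proof.
move=> q0; apply/eqP => N0.
have mb := C1c_measurable (test_C1c test_bump).
have mb' : measurable_fun setT (EFin \o bump) by exact/measurable_EFinP.
have [m hm] : exists m, (2 ^+ m)^-1 < r :> R.
  have /cvgr0Pnorm_lt/(_ _ r0)[m _ /(_ m (leqnn m))/= h] := @cvg_exp2V R.
  by exists m; rewrite (le_lt_trans (ler_norm _)).
have mc := @measurable_cube R n m (cell m a).
have : mu.-negligible (cube m (cell m a)).
  have := Lnorm_eq0_eq0 mb' q0 N0; apply: negligibleS => y ya /= h.
  have : bump y = 0 by move: (h I) => [].
  apply/eqP; rewrite gt_eqF//; apply: bump_gt0 => i.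
  have := rV_norm_coord (y - a) i; rewrite !mxE => /le_lt_trans; apply.
  by apply: le_lt_trans hm; exact: cell_dist.
move/(negligibleP mu mc) => c0.
have := etrans (esym (@lebesgue_cube R n m (cell m a))) c0 => -[/eqP].
by rewrite gt_eqF// exprn_gt0// invr_gt0 exprn_gt0.
Qed.

End bump.

(** For p < N the bound q < Np/(N-p) says 1/q > 1/p - 1/N; for p >= N the only
    problem is the limit case p = N, q = +oo. *)
Lemma subcritical_exponent (R : realType) (N : nat) (p : R) (q : \bar R) :
  (0 < N)%N -> 1 < p -> (p%:E < q)%E ->
  (p < N%:R -> (q < (N%:R * p / (N%:R - p))%:E)%E) ->
  (p = N%:R -> (q < +oo)%E) ->
  N%:R * (p^-1 - einv q) < 1.
Proof.
move=> N0 p1 pq h1 h2; have p0 : 0 < p by exact: lt_trans p1.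
have N0' : 0 < N%:R :> R by rewrite ltr0n.
case: q pq h1 h2 => [r||//] pq h1 h2 /=; last first.
  rewrite subr0 ltr_pdivrMr// mul1r ltNge; apply/negP.
  by rewrite le_eqVlt => /predU1P[/h2|/h1].
rewrite lte_fin in pq; have r0 : 0 < r by exact: lt_trans pq.
have [pN|Np] := ltP p N%:R.
  have := h1 pN; rewrite lte_fin ltr_pdivlMr ?subr_gt0// => h.
  have -> : N%:R * (p^-1 - r^-1) = N%:R * (r - p) / (p * r) by field; rewrite !gt_eqF.
  rewrite ltr_pdivrMr ?mulr_gt0// mul1r; lra.
rewrite mulrBr; have : N%:R / p <= 1 by rewrite ler_pdivrMr// mul1r.
have : 0 < N%:R / r by rewrite divr_gt0.
lra.
Qed.

Section cylinder.
Context (R : realType) (N k : nat) (omega : set 'rV[R]_(N - k)).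

Lemma drop_ge (j : 'I_(N - k)) : (k <= Ordinal (drop_ord_subproof j))%N.
Proof. exact: leq_addr. Qed.

Lemma drop_coord (i : 'I_N) : ~~ (i < k)%N -> exists j : 'I_(N - k),
  forall x : 'rV[R]_N, rV_drop k x ord0 j = x ord0 i.
Proof.
rewrite -leqNgt => ki.
have h : (i - k < N - k)%N by rewrite ltn_sub2r// (leq_ltn_trans ki).
exists (Ordinal h) => x; rewrite mxE; congr (x _ _); apply: val_inj => /=.
by rewrite subnKC.
Qed.

Lemma cylinder_bounded : bounded_set omega -> exists2 B : R, 0 <= B &
  forall (x : 'rV[R]_N) (i : 'I_N), cylinder omega x -> ~~ (i < k)%N -> `|x ord0 i| <= B.
Proof.
move=> /pinfty_ex_gt0[B B0 hB]; exists B; first exact: ltW.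
move=> x i Ox /drop_coord[j <-].
exact: le_trans (rV_norm_coord _ _) (hB _ Ox).
Qed.

Lemma cylinder_translation (x v : 'rV[R]_N) :
  (forall i : 'I_N, ~~ (i < k)%N -> v ord0 i = 0) -> cylinder omega (x + v) -> cylinder omega x.
Proof.
move=> v0; rewrite /cylinder /=.
suff -> : rV_drop k (x + v) = rV_drop k x by [].
by apply/rowP => j; rewrite !mxE v0 ?addr0// -leqNgt drop_ge.
Qed.

Lemma cylinder_ball : omega !=set0 -> open omega -> exists (a : 'rV[R]_N) (r : R),
  0 < r /\ forall x : 'rV[R]_N, (forall i, `|x ord0 i - a ord0 i| <= r) -> cylinder omega x.
Proof.
move=> [y yo] oo; have /nbhs_ballP[e /= e0 he] := open_nbhs_nbhs (conj oo yo).
pose a : 'rV[R]_N := \row_i (if insub (i - k)%N is Some j then y ord0 j else 0).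
exists a, (e / 2); split; first by rewrite divr_gt0.
move=> x xa; apply: he; rewrite -ball_normE /=.
apply: (@le_lt_trans _ _ (e / 2)); last by lra.
apply: rV_norm_le; first by rewrite divr_ge0// ltW.
move=> j; have := xa (Ordinal (drop_ord_subproof j)).
by rewrite !mxE /= addKn (valK j) distrC.
Qed.

End cylinder.

Theorem corollary7p4 (R : realType) (N k : nat) (omega : set 'rV[R]_(N - k))
    (p : R) (q : \bar R) :
  (2 <= N)%N -> (1 <= k <= N - 1)%N ->
  omega !=set0 -> open omega -> bounded_set omega ->
  1 < p -> (p%:E < q)%E ->
  (p < N%:R -> (q < (N%:R * p / (N%:R - p))%:E)%E) ->
  (p = N%:R -> (q < +oo)%E) ->
  (N%:R < p -> (q <= +oo)%E) ->
  exists u : 'rV[R]_N -> R, extremal (cylinder omega) p q u.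
Proof.
move=> N2 /andP[_ kN] o0 oo bo p1 pq h1 h2 _.
have N0 : (0 < N)%N by exact: leq_trans N2.
have [B B0 hB] := cylinder_bounded bo.
have i0N : (N - 1 < N)%N by rewrite ltn_subrL.
have [a [r [r0 har]]] := cylinder_ball o0 oo.
have q0 : (0 < q)%E by apply: lt_trans pq; rewrite lte_fin (lt_trans ltr01).
have Ti0 : ~~ (Ordinal i0N < k)%N by rewrite -leqNgt.
apply: (@extremal_exists R N _ (fun i : 'I_N => (i < k)%N) p q B (Ordinal i0N)) => //.
- exact: subcritical_exponent.
- exact: cylinder_translation.
by exists (bump a r); [exact: test_bump|exact: Lnorm_bump].
Qed.
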